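(* Let $R$ be a commutative ring with unit and $\mathcal O$ a cofibrant unital augmented operad in differential graded $R$-modules with surjective augmentation $\mathcal O\to\mathcal Com$ and with each $\mathcal O(n)$ concentrated in degrees $\le0$. The contravariant functors $\Omega^{\mathcal O}$ (from simplicial sets to $\mathcal O$-algebras) and $\mathbb M$ (from $\mathcal O$-algebras to simplicial sets), where $\mathbb M(A)=\mathrm{Hom}_{\mathcal O\text{-}\mathrm{Alg}}(A,\Omega^{\mathcal O}_* )$, are adjoint functors in the sense of Quillen between the category of $\mathcal O$-algebras and the category of simplicial sets. That is, there is a natural bijection $\mathrm{Hom}_{\mathcal S}(X,\mathbb M(A))\cong\mathrm{Hom}_{\mathcal O\text{-}\mathrm{Alg}}(A,\Omega^{\mathcal O}(X))$, and this is a Quillen adjunction between simplicial sets and the opposite of the category of $\mathcal O$-algebras.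
   Context: A dg $R$-module is $\mathbb Z$-graded with differential of degree $+1$. Operads are symmetric operads in dg $R$-modules; $\mathcal Com(i)=R$. A unital augmented operad is an operad $\mathcal O$ with an operad morphism $\mathcal O\to\mathcal Com$ that is an isomorphism in arities $0,1$; morphisms are compatible with augmentations and the identity in arities $0,1$. It is cofibrant if the map to it from the initial unital augmented operad has the left lifting property against morphisms that are surjective quasi-isomorphisms in every arity. For such $\mathcal O$, the category of $\mathcal O$-algebras has the model structure whose weak equivalences are the quasi-isomorphisms and whose fibrations are the surjections; simplicial sets $\mathcal S$ carry the usual Kan–Quillen model structure. The free $\mathcal O$-algebra is $\mathcal O(M)=\bigoplus_p\mathcal O(p)\otimes_{R[\Sigma_p]}M^{\otimes p}$. $\Omega^{\mathcal O}_*$ is the simplicial $\mathcal O$-algebra with $\Omega^{\mathcal O}_n=\mathcal O(x_0,\dots,x_n;dx_0,\dots,dx_n)/I_n$, $x_i$ in degree $0$, $dx_i$ in degree $1$ (differential $x_i\mapsto dx_i$), $I_n$ generated by $\sum x_i=1_0$ (unit in $\mathcal O(0)=R$) and $\sum dx_i=0$. Faces: $\delta_j(x_j)=0$, $\delta_j(x_i)=x_i$ ($i<j$), $\delta_j(x_i)=x_{i-1}$ ($i>j$); degeneracies: $\sigma_j(x_j)=x_j+x_{j+1}$, $\sigma_j(x_i)=x_i$ ($i<j$), $\sigma_j(x_i)=x_{i+1}$ ($i>j$); same for the $dx$'s. $\Omega^{\mathcal O}(X)=\mathrm{Hom}_{\mathcal S}(X,\Omega^{\mathcal O}_* )$ (degree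 $k$ part: simplicial maps to the degree $k$ part), with pointwise operations. $\mathbb M(A)$ is the simplicial set with $n$-simplices $\mathrm{Hom}_{\mathcal O\text{-}\mathrm{Alg}}(A,\Omega^{\mathcal O}_n)$. *)

(* Defs.v *)
From HB Require Import structures.
From mathcomp Require Import all_boot all_order all_algebra perm zify.
From mathcomp Require Import generic_quotient boolp.
Set Implicit Arguments.
Unset Strict Implicit.
Unset Printing Implicit Defensive.
Import GRing.Theory.
Local Open Scope ring_scope.
Local Open Scope quotient_scope.

Record category := Category {
  ob :> Type;
  hom : ob -> ob -> Type;
  idm : forall A, hom A A;
  compm : forall A B C, hom B C -> hom A B -> hom A C;
  compm_idl : forall A B (f : hom A B), compm (idm B) f = f;
  compm_idr : forall A B (f : hom A B), compm f (idm A) = f;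
  compmA : forall A B C D (h : hom C D) (g : hom B C) (f : hom A B),
    compm h (compm g f) = compm (compm h g) f }.

Arguments hom {c} _ _.
Arguments idm {c} A.
Arguments compm {c A B C} _ _.

Definition op_category (C : category) : category.
Proof.
refine (@Category C (fun A B => @hom C B A) (@idm C)
  (fun A B D (f : @hom C D B) (g : @hom C B A) => compm g f) _ _ _).
- by move=> A B f; apply: compm_idr.
- by move=> A B f; apply: compm_idl.
- by move=> A B D E f g h; rewrite compmA.
Defined.

Record functor (C D : category) := Functor {
  fob :> C -> D;
  fmor : forall A B : C, hom A B -> hom (fob A) (fob B);
  fmor_id : forall A : C, fmor (idm A) = idm (fob A);
  fmor_comp : forall (A B E : C) (g : hom B E) (f : hom A B),
    fmor (compm g f) = compm (fmor g) (fmor f) }.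

Definition initial_object (C : category) (I : C) : Prop :=
  forall A : C, exists f : hom I A, forall g : hom I A, g = f.

(* Every commutative square from i to p has a diagonal filler. *)
Definition has_lift (C : category) (A B X Y : C) (i : hom A B) (p : hom X Y) :
  Prop :=
  forall (f : hom A X) (g : hom B Y), compm p f = compm g i ->
  exists h : hom B X, compm h i = f /\ compm p h = g.

Record model_classes (C : category) := ModelClasses {
  weq : forall A B : C, hom A B -> Prop;
  cof : forall A B : C, hom A B -> Prop;
  fib : forall A B : C, hom A B -> Prop }.

Definition op_model_classes (C : category) (M : model_classes C) :
  model_classes (op_category C) :=
  @ModelClasses (op_category C)
    (fun A B (f : @hom C B A) => weq M f)
    (fun A B (f : @hom C B A) => fib M f)
    (fun A B (f : @hom C B A) => cof M f).

(* F is the left adjoint; [adj_natural] is naturality in X and A. *)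
Record adjunction (C D : category) (F : functor C D) (G : functor D C) :=
  Adjunction {
  adj : forall (X : C) (A : D), hom (F X) A -> hom X (G A);
  adj_bij : forall X A, bijective (@adj X A);
  adj_natural : forall (X X' : C) (A A' : D)
    (f : hom X' X) (g : hom A A') (h : hom (F X) A),
    adj (compm g (compm h (fmor F f))) = compm (fmor G g) (compm (adj h) f) }.

Definition quillen_adjunction (C D : category) (MC : model_classes C)
  (MD : model_classes D) (F : functor C D) (G : functor D C) : Prop :=
  inhabited (adjunction F G) /\
  forall (X Y : C) (f : hom X Y),
    (cof MC f -> cof MD (fmor F f)) /\
    (cof MC f -> weq MC f -> cof MD (fmor F f) /\ weq MD (fmor F f)).

(* The proof argument of [dgd] (and of the structure maps below) lets the
   target degree be any integer provably equal to the expected one. *)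
Record dgmod (R : comPzRingType) := DGMod {
  dgC :> int -> lmodType R;
  dgd : forall k l, l = k + 1 -> dgC k -> dgC l;
  dgd_linear : forall k l (e : l = k + 1), linear (dgd e);
  dgd_dgd : forall k l m (e : l = k + 1) (e' : m = l + 1) (x : dgC k),
    dgd e' (dgd e x) = 0 }.
Arguments dgd {R} d {k l} e x.

Section DGModules.
Variable R : comPzRingType.
Implicit Types A B C : dgmod R.

Definition cocycle A k (x : A k) : Prop :=
  forall l (e : l = k + 1), dgd A e x = 0.

Definition coboundary A k (x : A k) : Prop :=
  exists j (e : k = j + 1) (y : A j), x = dgd A e y.

Definition chain_map A B (f : forall k, A k -> B k) : Prop :=
  (forall k, linear (f k)) /\
  (forall k l (e : l = k + 1) (x : A k), f l (dgd A e x) = dgd B e (f k x)).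

(* The map induced in cohomology is injective and surjective in each degree. *)
Definition quasi_iso A B (f : forall k, A k -> B k) : Prop :=
  forall k,
  (forall x : A k, cocycle x -> coboundary (f k x) -> coboundary x) /\
  (forall y : B k, cocycle y ->
     exists2 x : A k, cocycle x & coboundary (f k x - y)).

Definition surjective_map A B (f : forall k, A k -> B k) : Prop :=
  forall k (y : B k), exists x : A k, f k x = y.

Definition hel A := {k : int & A k}.

Definition mkhel A k (x : A k) : hel A := existT (fun k => A k) k x.

Definition hd A (u : hel A) : hel A := mkhel (dgd A erefl (tagged u)).

Definition hmap A B (f : forall k, A k -> B k) (u : hel A) : hel B :=
  mkhel (f (tag u) (tagged u)).

Definition sgn (k : int) : R := (-1) ^+ `|k|%N.

End DGModules.
Arguments sgn {R} k.

Definition upd (T : Type) n (x : 'I_n -> T) (i : 'I_n) (u : T) : 'I_n -> T :=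
  fun j => if j == i then u else x j.

(* [arity m n i p]: i is one of the inputs 0, ..., m - 1 and p = m + n - 1 is
   the arity of a o_i b for a of arity m and b of arity n. *)
Definition arity (m n i p : nat) : bool := (i < m)%N && (p.+1 == m + n)%N.

(* Inputs of a o_i b: the k-th input of b is the (i + k)-th one, and the j-th
   input of a, for j != i, is the q-th one with [outer n i j q]. *)
Definition outer (n i j q : nat) : bool :=
  if (j < i)%N then q == j else q.+1 == (j + n)%N.

(* Symmetric operads, presented by the partial compositions o_i. The right
   action follows the product of permutations (s * t = t \o s as functions):
   in an algebra, (a . s)(x_0, x_1, ..) = +/- a(x_(s 0), x_(s 1), ..). *)
Record operad (R : comPzRingType) := Operad {
  op_mod :> nat -> dgmod R;
  op_act : forall n, 'S_n -> forall k, op_mod n k -> op_mod n k;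
  op_one : op_mod 1%N 0;
  op_comp : forall m n i p, arity m n i p -> forall k l q, q = k + l ->
    op_mod m k -> op_mod n l -> op_mod p q;
  op_act_chain : forall n (s : 'S_n), chain_map (op_act s);
  op_act1 : forall n k (a : op_mod n k), op_act 1%g a = a;
  op_actM : forall n (s t : 'S_n) k (a : op_mod n k),
    op_act (s * t)%g a = op_act t (op_act s a);
  op_comp_linl : forall m n i p (h : arity m n i p) k l q (e : q = k + l)
    (b : op_mod n l), linear (fun a : op_mod m k => op_comp h e a b);
  op_comp_linr : forall m n i p (h : arity m n i p) k l q (e : q = k + l)
    (a : op_mod m k), linear (fun b : op_mod n l => op_comp h e a b);
  op_one_d : cocycle op_one;
  op_comp_d : forall m n i p (h : arity m n i p) k l q k' l' q'
    (e : q = k + l) (ek : k' = k + 1) (el : l' = l + 1) (eq : q' = q + 1)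
    (e1 : q' = k' + l) (e2 : q' = k + l') (a : op_mod m k) (b : op_mod n l),
    dgd _ eq (op_comp h e a b) =
    op_comp h e1 (dgd _ ek a) b + sgn k *: op_comp h e2 a (dgd _ el b);
  op_comp1l : forall n (h : arity 1 n 0 n) k (e : k = 0 + k) (b : op_mod n k),
    op_comp h e op_one b = b;
  op_comp1r : forall m i (h : arity m 1 i m) k (e : k = k + 0)
    (a : op_mod m k), op_comp h e a op_one = a;
  op_comp_seq : forall m n r i j mn nr p
    (h1 : arity m n i mn) (h2 : arity mn r (i + j) p)
    (h3 : arity n r j nr) (h4 : arity m nr i p)
    k l w kl lw q (e1 : kl = k + l) (e2 : q = kl + w)
    (e3 : lw = l + w) (e4 : q = k + lw)
    (a : op_mod m k) (b : op_mod n l) (c : op_mod r w),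
    op_comp h2 e2 (op_comp h1 e1 a b) c = op_comp h4 e4 a (op_comp h3 e3 b c);
  op_comp_par : forall m n r i j mn mr p, (i < j)%N -> forall
    (h1 : arity m n i mn) (h2 : arity mn r (j + n).-1 p)
    (h3 : arity m r j mr) (h4 : arity mr n i p)
    k l w kl kw q (e1 : kl = k + l) (e2 : q = kl + w)
    (e3 : kw = k + w) (e4 : q = kw + l)
    (a : op_mod m k) (b : op_mod n l) (c : op_mod r w),
    op_comp h2 e2 (op_comp h1 e1 a b) c =
    sgn (l * w) *: op_comp h4 e4 (op_comp h3 e3 a c) b;
  (* r is the permutation of the inputs of a o_i b induced by s and t *)
  op_comp_act : forall m n p (i : 'I_m) (s : 'S_m) (t : 'S_n) (r : 'S_p)
    (h : arity m n i p) (h' : arity m n (s i) p) k l q (e : q = k + l)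
    (a : op_mod m k) (b : op_mod n l),
    (forall (j : 'I_n) (u : 'I_p), u = (i + j)%N :> nat ->
       r u = (s i + t j)%N :> nat) ->
    (forall (j : 'I_m) (u : 'I_p), j != i -> outer n i j u ->
       outer n (s i) (s j) (r u)) ->
    op_comp h' e (op_act s a) (op_act t b) = op_act r (op_comp h e a b) }.

Arguments op_act {R} o {n} s {k} a.
Arguments op_one {R} o.
Arguments op_comp {R} o {m n i p} h {k l q} e a b.

Record operad_hom (R : comPzRingType) (P Q : operad R) := OperadHom {
  oh_map :> forall n k, P n k -> Q n k;
  oh_chain : forall n, chain_map (@oh_map n);
  oh_act : forall n (s : 'S_n) k (a : P n k),
    oh_map (op_act P s a) = op_act Q s (oh_map a);
  oh_one : oh_map (op_one P) = op_one Q;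
  oh_comp : forall m n i p (h : arity m n i p) k l q (e : q = k + l)
    (a : P m k) (b : P n l),
    oh_map (op_comp P h e a b) = op_comp Q h e (oh_map a) (oh_map b) }.
Arguments oh_map {R P Q} o n k x.

Lemma operad_hom_eq (R : comPzRingType) (P Q : operad R)
  (f g : operad_hom P Q) : (forall n k (a : P n k), f n k a = g n k a) -> f = g.
Proof.
case: f g => f f1 f2 f3 f4 [g g1 g2 g3 g4] /= fg.
have E : f = g.
  by apply: functional_extensionality_dep => n;
     apply: functional_extensionality_dep => k; apply: funext => a.
by case: g / E g1 g2 g3 g4 fg => *; congr OperadHom; apply: Prop_irrelevance.
Qed.

Section Com.
Variable R : comPzRingType.

Definition com_mod (k : int) : lmodType R :=
  match k with Posz 0 => R^o | _ => 'rV[R]_0 end.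

(* The coefficient of an element of [com_mod k], zero for k != 0; and the
   element with a given coefficient. *)
Definition com_val (k : int) : com_mod k -> R :=
  match k with Posz 0 => fun x => x | _ => fun=> 0 end.
Definition com_elt (k : int) : R -> com_mod k :=
  match k with Posz 0 => fun x => x | _ => fun=> 0 end.

Lemma com_val_inj k : injective (@com_val k).
Proof.
by case: k => [[|k]|k] //= x y _; apply/rowP; case.
Qed.

Lemma com_val_linear k (c : R) (x y : com_mod k) :
  com_val (c *: x + y) = c * com_val x + com_val y.
Proof. by case: k x y => [[|k]|k] //= x y; rewrite mulr0 addr0. Qed.

Lemma com_valK k (r : R) : com_val (com_elt k r) = if k == 0 then r else 0.
Proof. by case: k => [[|k]|k]. Qed.

Lemma com_val0 k (x : com_mod k) : k != 0 -> com_val x = 0.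
Proof. by case: k x => [[|k]|k]. Qed.

Fact com_dg_subproof k l (e : l = k + 1) :
  linear (fun _ : com_mod k => 0 : com_mod l).
Proof. by move=> c x y; rewrite scaler0 addr0. Qed.

Definition com_dg : dgmod R :=
  @DGMod R com_mod (fun _ _ _ _ => 0) com_dg_subproof (fun _ _ _ _ _ _ => erefl).

Definition com_comp k l q (e : q = k + l) (a : com_mod k) (b : com_mod l) :
  com_mod q := com_elt q (com_val a * com_val b).

Lemma com_val_comp k l q (e : q = k + l) (a : com_mod k) (b : com_mod l) :
  com_val (com_comp e a b) = com_val a * com_val b.
Proof.
rewrite com_valK; case: eqP => // /eqP q0.
have [k0|k0] := eqVneq k 0; last by rewrite (com_val0 a k0) mul0r.
have [l0|l0] := eqVneq l 0; last by rewrite (com_val0 b l0) mulr0.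
by rewrite e k0 l0 addr0 eqxx in q0.
Qed.

Lemma com_val_zero k : com_val (0 : com_mod k) = 0.
Proof. by case: k => [[|k]|k]. Qed.

Lemma com_val_scale k c (x : com_mod k) : com_val (c *: x) = c * com_val x.
Proof. by rewrite -[c *: x]addr0 com_val_linear com_val_zero addr0. Qed.

(* Com(n) = R in degree 0 for every n, including n = 0. *)
Definition Com : operad R.
Proof.
refine (@Operad R (fun=> com_dg) (fun _ _ _ a => a) (com_elt 0 1)
  (fun _ _ _ _ _ _ _ _ e a b => com_comp e a b) _ _ _ _ _ _ _ _ _ _ _ _).
all: rewrite /cocycle /=.
- by move=> n s; split.
- by [].
- by [].
- move=> m n i p h k l q e b c x y; apply: com_val_inj.
  by rewrite com_val_linear !com_val_comp com_val_linear mulrDl mulrA.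
- move=> m n i p h k l q e b c x y; apply: com_val_inj.
  by rewrite com_val_linear !com_val_comp com_val_linear mulrDr mulrCA.
- by [].
- move=> m n i p h k l q k' l' q' e ek el eq e1 e2 a b; apply: com_val_inj.
  rewrite addrC com_val_linear !com_val_comp !com_val_zero.
  by rewrite mul0r !mulr0 addr0.
- move=> n h k e b; apply: com_val_inj.
  by rewrite com_val_comp com_valK eqxx mul1r.
- move=> n i h k e b; apply: com_val_inj.
  by rewrite com_val_comp com_valK eqxx mulr1.
- move=> *; apply: com_val_inj; by rewrite !com_val_comp mulrA.
- move=> m n r i j mn mr p _ _ _ _ _ k l w kl kw q e1 e2 e3 e4 a b c.
  apply: com_val_inj; rewrite com_val_scale !com_val_comp.
  have [l0|l0] := eqVneq l 0; last by rewrite (com_val0 b l0) !(mulr0, mul0r).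
  have -> : sgn (l * w) = 1 by rewrite l0 mul0r.
  by rewrite mul1r mulrAC.
- by [].
Defined.

End Com.

Record uaoperad (R : comPzRingType) := UAOperad {
  ua_op :> operad R;
  ua_aug : operad_hom ua_op (Com R);
  ua_aug0 : forall k, bijective (ua_aug 0%N k);
  ua_aug1 : forall k, bijective (ua_aug 1%N k) }.

(* Compatibility with the augmentations forces a morphism to be the identity of
   R in arities 0 and 1, where the augmentations are isomorphisms. *)
Record uaoperad_hom (R : comPzRingType) (P Q : uaoperad R) := UAOperadHom {
  uah_map :> operad_hom P Q;
  uah_aug : forall n k (a : P n k), ua_aug Q n k (uah_map n k a) = ua_aug P n k a }.

Lemma uaoperad_hom_eq (R : comPzRingType) (P Q : uaoperad R)
  (f g : uaoperad_hom P Q) :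
  (forall n k (a : P n k), f n k a = g n k a) -> f = g.
Proof.
case: f g => f f1 [g g1] /= fg.
have E : f = g by apply: operad_hom_eq.
by case: g / E g1 fg => *; congr UAOperadHom; apply: Prop_irrelevance.
Qed.

Section UAOperadCategory.
Variable R : comPzRingType.

Definition uaoperad_id (P : uaoperad R) : uaoperad_hom P P.
Proof.
exists (@OperadHom R P P (fun _ _ a => a) (fun=> conj (fun _ _ _ _ => erefl)
  (fun _ _ _ _ => erefl)) (fun _ _ _ _ => erefl) erefl
  (fun _ _ _ _ _ _ _ _ _ _ _ => erefl)).
by [].
Defined.

Definition uaoperad_comp (P Q S : uaoperad R)
  (g : uaoperad_hom Q S) (f : uaoperad_hom P Q) : uaoperad_hom P S.
Proof.
unshelve refine (@UAOperadHom R P S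
  (@OperadHom R P S (fun n k a => g n k (f n k a)) _ _ _ _) _).
- move=> n; split=> [k c x y|k l e x].
    by rewrite (oh_chain f n).1 (oh_chain g n).1.
  by rewrite (oh_chain f n).2 (oh_chain g n).2.
- by move=> *; rewrite !oh_act.
- by rewrite !oh_one.
- by move=> *; rewrite !oh_comp.
- by move=> n k a /=; rewrite !uah_aug.
Defined.

Definition UAOp : category.
Proof.
refine (@Category (uaoperad R) (@uaoperad_hom R) uaoperad_id uaoperad_comp
  _ _ _).
all: by move=> *; apply: uaoperad_hom_eq.
Defined.

(* [exists I] only names the initial object, which is unique up to
   isomorphism. *)
Definition cofibrant (O : UAOp) : Prop :=
  exists (I : UAOp) (i : hom I O), initial_object I /\
  forall (P Q : UAOp) (p : uaoperad_hom P Q),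
    (forall n, surjective_map (p n) /\ quasi_iso (p n)) ->
    has_lift i (p : @hom UAOp P Q).

Definition surjective_augmentation (O : uaoperad R) : Prop :=
  forall n, surjective_map (ua_aug O n).

Definition nonpositively_graded (O : uaoperad R) : Prop :=
  forall n k, 0 < k -> forall a : O n k, a = 0.

(* 1_0, the element of O(0) of augmentation 1 *)
Lemma ua_unit_exists (O : uaoperad R) :
  exists u : O 0%N 0, ua_aug O 0%N 0 u = com_elt 0 1.
Proof. by case: (ua_aug0 O 0) => g _ gK; exists (g (com_elt 0 1)). Qed.

Definition ua_unit (O : uaoperad R) : O 0%N 0 := sval (cid (ua_unit_exists O)).

End UAOperadCategory.

Section Algebras.
Variables (R : comPzRingType) (O : operad R).

(* a(x_0, ..., x_(n-1)), of degree m *)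
Definition action_on (A : dgmod R) :=
  forall n l, O n l -> forall (x : 'I_n -> hel A) m,
    m = l + \sum_(i < n) tag (x i) -> A m.

Record opalg_axioms (A : dgmod R) (act : action_on A) : Prop := OpalgAxioms {
  act_linl : forall n l (x : 'I_n -> hel A) m
    (e : m = l + \sum_(i < n) tag (x i)),
    linear (fun a : O n l => act n l a x m e);
  act_linr : forall n l (a : O n l) (x : 'I_n -> hel A) (i : 'I_n)
    k (c : R) (u v : A k) m
    (e : m = l + \sum_(j < n) tag (upd x i (mkhel (c *: u + v)) j))
    (eu : m = l + \sum_(j < n) tag (upd x i (mkhel u) j))
    (ev : m = l + \sum_(j < n) tag (upd x i (mkhel v) j)),
    act n l a _ m e = c *: act n l a _ m eu + act n l a _ m ev;
  act_d : forall n l (a : O n l) (x : 'I_n -> hel A) l' m m'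
    (e : m = l + \sum_(i < n) tag (x i)) (em : m' = m + 1) (el : l' = l + 1)
    (e0 : m' = l' + \sum_(i < n) tag (x i))
    (e1 : forall i, m' = l + \sum_(j < n) tag (upd x i (hd (x i)) j)),
    dgd A em (act n l a x m e) =
    act n l' (dgd (O n) el a) x m' e0 +
    \sum_(i < n) sgn (l + \sum_(j < n | (j < i)%N) tag (x j)) *:
       act n l a (upd x i (hd (x i))) m' (e1 i);
  act_perm : forall n l (a : O n l) (s : 'S_n) (x : 'I_n -> hel A) m
    (e : m = l + \sum_(i < n) tag (x i))
    (es : m = l + \sum_(i < n) tag (x (s i))),
    act n l (op_act O s a) x m e =
    sgn (\sum_(i < n) \sum_(j < n | (i < j)%N && (s j < s i)%N)
           tag (x (s i)) * tag (x (s j))) *: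
      act n l a (fun i => x (s i)) m es;
  act_one : forall k (u : A k) (e : k = 0 + \sum_(i < 1) tag (mkhel u)),
    act 1%N 0 (op_one O) (fun=> mkhel u) k e = u;
  (* z consists of the inputs fed to b, and y of the inputs fed to a *)
  act_comp : forall m n p (i : 'I_m) (h : arity m n i p) k l kl (ek : kl = k + l)
    (a : O m k) (b : O n l)
    (x : 'I_p -> hel A) (y : 'I_m -> hel A) (z : 'I_n -> hel A)
    w (ez : w = l + \sum_(j < n) tag (z j))
    q (ex : q = kl + \sum_(j < p) tag (x j))
    (ey : q = k + \sum_(j < m) tag (y j)),
    (forall (j : 'I_n) (u : 'I_p), u = (i + j)%N :> nat -> z j = x u) ->
    (forall (j : 'I_m) (u : 'I_p), j != i -> outer n i j u -> y j = x u) ->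
    y i = mkhel (act n l b z w ez) ->
    act p kl (op_comp O h ek a b) x q ex =
    sgn (l * \sum_(j < m | (j < i)%N) tag (y j)) *: act m k a y q ey }.

Lemma act_irr (A : dgmod R) (act : action_on A) n l (a : O n l)
  (x y : 'I_n -> hel A) m (e : m = l + \sum_(i < n) tag (x i))
  (e' : m = l + \sum_(i < n) tag (y i)) :
  x = y -> act n l a x m e = act n l a y m e'.
Proof. by move=> E; case: y / E e' => e'; congr act; apply: Prop_irrelevance. Qed.

Record opalg := Opalg {
  oa_mod :> dgmod R;
  oa_act : action_on oa_mod;
  oa_axioms : opalg_axioms oa_act }.
Arguments oa_act o {n l} a x {m} e.

Record opalg_hom (A B : opalg) := OpalgHom {
  ah_map :> forall k, A k -> B k;
  ah_chain : chain_map ah_map;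
  ah_act : forall n l (a : O n l) (x : 'I_n -> hel A) m
    (e : m = l + \sum_(i < n) tag (x i)),
    ah_map (oa_act A a x e) = oa_act B a (fun i => hmap ah_map (x i)) e }.

Lemma opalg_hom_eq (A B : opalg) (f g : opalg_hom A B) :
  (forall k (x : A k), f k x = g k x) -> f = g.
Proof.
case: f g => f f1 f2 [g g1 g2] /= fg.
have E : f = g.
  by apply: functional_extensionality_dep => k; apply: funext => x.
by case: g / E g1 g2 fg => *; congr OpalgHom; apply: Prop_irrelevance.
Qed.

Definition opalg_id (A : opalg) : opalg_hom A A.
Proof.
exists (fun _ x => x); first by split.
move=> n l a x m e; set y := fun i => _.
have E : x = y by apply: funext => i; rewrite /y /hmap /mkhel; case: (x i).
exact: act_irr.
Defined.

Definition opalg_comp (A B C : opalg) (g : opalg_hom B C) (f : opalg_hom A B) :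
  opalg_hom A C.
Proof.
exists (fun k x => g k (f k x)).
  split=> [k c x y|k l e x].
    by rewrite (ah_chain f).1 (ah_chain g).1.
  by rewrite (ah_chain f).2 (ah_chain g).2.
by move=> n l a x m e; rewrite !ah_act.
Defined.

Definition OAlg : category.
Proof.
refine (@Category opalg opalg_hom opalg_id opalg_comp _ _ _).
all: by move=> *; apply: opalg_hom_eq.
Defined.

Definition OAlg_model : model_classes OAlg :=
  @ModelClasses OAlg
    (fun A B (f : opalg_hom A B) => quasi_iso f)
    (fun A B f => forall (X Y : OAlg) (p : opalg_hom X Y),
       quasi_iso p -> surjective_map p -> has_lift f (p : @hom OAlg X Y))
    (fun A B (f : opalg_hom A B) => surjective_map f).

Lemma hmap_upd (A B : dgmod R) (f : forall k, A k -> B k) n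
  (x : 'I_n -> hel A) i u :
  (fun j => hmap f (upd x i u j)) = upd (fun j => hmap f (x j)) i (hmap f u).
Proof. by apply: funext => j; rewrite /upd; case: eqP. Qed.

Lemma hmap_hd (A B : dgmod R) (f : forall k, A k -> B k) (u : hel A) :
  chain_map f -> hmap f (hd u) = hd (hmap f u).
Proof. by case=> _ fd; rewrite /hmap /hd /= fd. Qed.

(* Structure maps satisfy the axioms as soon as they are preserved by a jointly
   injective family of maps to algebras. *)
Lemma joint_opalg_axioms (A : dgmod R) (act : action_on A)
  (J : forall B : opalg, (forall k, A k -> B k) -> Prop)
  (J_chain : forall B f, J B f -> chain_map f)
  (J_act : forall B f, J B f -> forall n l (a : O n l) (x : 'I_n -> hel A) m
    (e : m = l + \sum_(i < n) tag (x i)),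
    f m (act n l a x m e) = oa_act B a (fun i => hmap f (x i)) e)
  (J_inj : forall k (x y : A k), (forall B f, J B f -> f k x = f k y) -> x = y) :
  opalg_axioms act.
Proof.
have J0 B f k : J B f -> f k 0 = 0.
  move=> /J_chain[fl _]; have := fl k (-1) 0 0.
  by rewrite scaleN1r oppr0 addr0 scaleN1r addNr.
have JD B f k x y : J B f -> f k (x + y) = f k x + f k y.
  by move=> /J_chain[fl _]; rewrite -[x]scale1r fl !scale1r.
have JZ B f k c x : J B f -> f k (c *: x) = c *: f k x.
  move=> Jf; have [fl _] := J_chain _ _ Jf.
  by rewrite -[c *: x]addr0 fl J0 // addr0.
have Jsum B f k n (F : 'I_n -> A k) : J B f ->
    f k (\sum_(i < n) F i) = \sum_(i < n) f k (F i).
  by move=> Jf; apply: (big_morph (f k)) => [x y|]; rewrite ?JD ?J0.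
split.
- move=> n l x m e c a b; apply: J_inj => B f Jf.
  by rewrite JD // JZ // !(J_act _ _ Jf) (act_linl (oa_axioms B)).
- move=> n l a x i k c u v m e eu ev; apply: J_inj => B f Jf.
  rewrite JD // JZ // !(J_act _ _ Jf).
  have e1 : m = l + \sum_(j < n)
      tag (upd (fun j => hmap f (x j)) i (mkhel (c *: f k u + f k v)) j).
    by rewrite {1}e; congr (_ + _); apply: eq_bigr => j _; rewrite /upd; case: eqP.
  have eu1 : m = l + \sum_(j < n)
      tag (upd (fun j => hmap f (x j)) i (mkhel (f k u)) j).
    by rewrite {1}eu; congr (_ + _); apply: eq_bigr => j _; rewrite /upd; case: eqP.
  have ev1 : m = l + \sum_(j < n)
      tag (upd (fun j => hmap f (x j)) i (mkhel (f k v)) j).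
    by rewrite {1}ev; congr (_ + _); apply: eq_bigr => j _; rewrite /upd; case: eqP.
  have H w (u' : A k) (ew : m = l + \sum_(j < n) tag (upd x i (mkhel u') j))
      (ew' : m = l + \sum_(j < n)
         tag (upd (fun j => hmap f (x j)) i (mkhel w) j)) : f k u' = w ->
      oa_act B a (fun j => hmap f (upd x i (mkhel u') j)) ew =
      oa_act B a (upd (fun j => hmap f (x j)) i (mkhel w)) ew'.
    by move=> E; apply: act_irr; rewrite hmap_upd /hmap /= E.
  rewrite (H _ _ e e1) ?JD ?JZ // (H _ _ eu eu1) // (H _ _ ev ev1) //.
  exact: (act_linr (oa_axioms B) a e1 eu1 ev1).
- move=> n l a x l' m m' e em el e0 e1; apply: J_inj => B f Jf.
  have [_ fd] := J_chain _ _ Jf.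
  rewrite fd JD // Jsum // !(J_act _ _ Jf).
  have e1' i : m' = l + \sum_(j < n)
      tag (upd (fun j => hmap f (x j)) i (hd (hmap f (x i))) j).
    by rewrite {1}(e1 i); congr (_ + _); apply: eq_bigr => j _; rewrite /upd; case: eqP.
  rewrite (act_d (oa_axioms B) a (x := fun i => hmap f (x i)) e em el e0 e1').
  congr (_ + _); apply: eq_bigr => i _; rewrite JZ // (J_act _ _ Jf).
  congr (_ *: _); apply: act_irr; rewrite hmap_upd hmap_hd //; exact: J_chain.
- move=> n l a s x m e es; apply: J_inj => B f Jf.
  rewrite JZ // !(J_act _ _ Jf).
  refine (@act_perm _ _ (oa_axioms B) n l a s (fun i => hmap f (x i)) m e es).
- move=> k u e; apply: J_inj => B f Jf; rewrite (J_act _ _ Jf).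
  exact: (act_one (oa_axioms B) (u := f k u) e).
- move=> m n p i h k l kl ek a b x y z w ez q ex ey zx yx yi.
  apply: J_inj => B f Jf; rewrite JZ // !(J_act _ _ Jf).
  refine (@act_comp _ _ (oa_axioms B) m n p i h k l kl ek a b
    (fun i => hmap f (x i)) (fun i => hmap f (y i)) (fun i => hmap f (z i))
    w ez q ex ey _ _ _).
  + by move=> j u ju; rewrite (zx j u).
  + by move=> j u ji o; rewrite (yx j u).
  + by rewrite yi /hmap /= (J_act _ _ Jf).
Qed.

End Algebras.
Arguments oa_act {R O} o {n l} a x {m} e.
Arguments opalg {R} O.
Arguments OAlg {R} O.
Arguments OAlg_model {R} O.

Section HomLemmas.
Variables (R : comPzRingType) (O : operad R) (A B : opalg O) (f : opalg_hom A B).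

Lemma ah_zero k : f k 0 = 0.
Proof.
have := (ah_chain f).1 k (-1) 0 0.
by rewrite scaleN1r oppr0 addr0 scaleN1r addNr.
Qed.

Lemma ah_scale k c (x : A k) : f k (c *: x) = c *: f k x.
Proof. by rewrite -[c *: x]addr0 (ah_chain f).1 ah_zero addr0. Qed.

Lemma ah_add k (x y : A k) : f k (x + y) = f k x + f k y.
Proof. by rewrite -[x]scale1r (ah_chain f).1 !scale1r. Qed.

Lemma ah_sum k n (P : pred 'I_n) (F : 'I_n -> A k) :
  f k (\sum_(i < n | P i) F i) = \sum_(i < n | P i) f k (F i).
Proof. by apply: (big_morph (f k)) => [x y|]; rewrite ?ah_add ?ah_zero. Qed.

End HomLemmas.

Definition ua_alg_unit (R : comPzRingType) (O : uaoperad R) (B : opalg O) : B 0.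
Proof.
refine (oa_act B (ua_unit O) (fun=> mkhel (0 : B 0)) _).
by rewrite big_ord0.
Defined.

Lemma ua_alg_unit_morph (R : comPzRingType) (O : uaoperad R)
  (A B : opalg O) (f : forall k, A k -> B k) :
  (forall p l (a : O p l) (x : 'I_p -> hel A) m
    (e : m = l + \sum_(i < p) tag (x i)),
    f m (oa_act A a x e) = oa_act B a (fun i => hmap f (x i)) e) ->
  f 0 (ua_alg_unit A) = ua_alg_unit B.
Proof. by move=> fa; rewrite fa; apply: act_irr; apply: funext => -[]. Qed.

(* Elements x_i, dx_i of B satisfying the relations of Omega_n. *)
Record coords (R : comPzRingType) (O : uaoperad R) (n : nat) (B : opalg O) :=
  Coords {
  cx : 'I_n.+1 -> B 0;
  cdx : 'I_n.+1 -> B 1;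
  cx_d : forall i (e : 1 = 0 + 1), dgd B e (cx i) = cdx i;
  cx_sum : \sum_i cx i = ua_alg_unit B;
  cdx_sum : \sum_i cdx i = 0 }.
Arguments cx {R O n B} c i.
Arguments cdx {R O n B} c i.

Definition coords_map (R : comPzRingType) (O : uaoperad R) (n : nat)
  (A B : opalg O) (f : opalg_hom A B) (c : coords n A) : coords n B.
Proof.
exists (fun i => f 0 (cx c i)) (fun i => f 1 (cdx c i)).
- by move=> i e; rewrite -(ah_chain f).2 cx_d.
- by rewrite -ah_sum cx_sum; apply: ua_alg_unit_morph; apply: ah_act.
- by rewrite -ah_sum cdx_sum ah_zero.
Defined.

Section Omega.
Variables (R : comPzRingType) (O : uaoperad R) (n : nat).

(* Formal expressions of degree k in x_0, ..., x_n, dx_0, ..., dx_n. *)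
Inductive expr : int -> Type :=
| Ex of 'I_n.+1 : expr 0
| Edx of 'I_n.+1 : expr 1
| Ezero k : expr k
| Eadd k : expr k -> expr k -> expr k
| Escale k : R -> expr k -> expr k
| Ed k l : l = k + 1 -> expr k -> expr l
| Eact p l (a : O p l) (d : 'I_p -> int) (t : forall i, expr (d i)) m :
    m = l + \sum_(i < p) d i -> expr m.

Fixpoint eval (B : opalg O) (c : coords n B) k (t : expr k) : B k :=
  match t with
  | Ex i => cx c i
  | Edx i => cdx c i
  | Ezero _ => 0
  | Eadd _ t u => eval c t + eval c u
  | Escale _ r t => r *: eval c t
  | Ed _ _ e t => dgd B e (eval c t)
  | Eact _ _ a d t _ e => oa_act B a (fun i => mkhel (eval c (t i))) e
  end.

(* Omega_n = O(x_0, ..., x_n; dx_0, ..., dx_n) / I_n is the dg O-algebra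
   generated by the x_i and dx_i subject to d(x_i) = dx_i and to the two
   relations generating I_n. It is built as expressions modulo the identities
   which hold in every O-algebra for all elements satisfying the relations:
   these identities are exactly the consequences of the relations and of the
   axioms of O-algebras. [Omega_univ] is the universal property. *)
Definition expr_eq k (t u : expr k) : bool :=
  `[< forall (B : opalg O) (c : coords n B), eval c t = eval c u >].

HB.instance Definition _ k := gen_eqMixin (expr k).
HB.instance Definition _ k := gen_choiceMixin (expr k).

Lemma expr_eq_refl k : reflexive (@expr_eq k).
Proof. by move=> t; apply/asboolP. Qed.
Lemma expr_eq_sym k : symmetric (@expr_eq k).
Proof. by move=> t u; apply/asboolP/asboolP => E B c; rewrite E. Qed.
Lemma expr_eq_trans k : transitive (@expr_eq k).
Proof.
by move=> u t v /asboolP E /asboolP F; apply/asboolP => B c; rewrite E F.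
Qed.
Canonical expr_equiv k :=
  EquivRel (@expr_eq k) (@expr_eq_refl k) (@expr_eq_sym k) (@expr_eq_trans k).

Definition omega k := {eq_quot (expr_equiv k)}.
HB.instance Definition _ k := Choice.on (omega k).
HB.instance Definition _ k := EqQuotient.on (omega k).

Definition omega_ev (B : opalg O) (c : coords n B) k (w : omega k) : B k :=
  eval c (repr w).

Lemma omega_evE (B : opalg O) (c : coords n B) k (t : expr k) :
  omega_ev c (\pi_(omega k) t) = eval c t.
Proof.
have : (repr (\pi_(omega k) t)) = t %[mod omega k] by rewrite reprK.
by move=> /eqmodP /asboolP /(_ B c).
Qed.

Lemma omega_inj k (v w : omega k) :
  (forall (B : opalg O) (c : coords n B), omega_ev c v = omega_ev c w) -> v = w.
Proof.
by move=> E; rewrite -[v]reprK -[w]reprK; apply/eqmodP/asboolP.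
Qed.

Section Operations.
Variable k : int.
Definition omega_zero : omega k := \pi_(omega k) (Ezero k).
Definition omega_add (v w : omega k) : omega k := \pi_(omega k) (Eadd (repr v) (repr w)).
Definition omega_scale (r : R) (v : omega k) : omega k := \pi_(omega k) (Escale r (repr v)).
Definition omega_opp (v : omega k) : omega k := omega_scale (-1) v.

Lemma omega_ev_zero (B : opalg O) (c : coords n B) : omega_ev c omega_zero = 0.
Proof. exact: omega_evE. Qed.
Lemma omega_ev_add (B : opalg O) (c : coords n B) v w :
  omega_ev c (omega_add v w) = omega_ev c v + omega_ev c w.
Proof. exact: omega_evE. Qed.
Lemma omega_ev_scale (B : opalg O) (c : coords n B) r v :
  omega_ev c (omega_scale r v) = r *: omega_ev c v.
Proof. exact: omega_evE. Qed.

Fact omega_addA : associative omega_add.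
Proof. by move=> u v w; apply: omega_inj => B c; rewrite !omega_ev_add addrA. Qed.
Fact omega_addC : commutative omega_add.
Proof. by move=> u v; apply: omega_inj => B c; rewrite !omega_ev_add addrC. Qed.
Fact omega_add0 : left_id omega_zero omega_add.
Proof.
by move=> u; apply: omega_inj => B c; rewrite omega_ev_add omega_ev_zero add0r.
Qed.
Fact omega_addN : left_inverse omega_zero omega_opp omega_add.
Proof.
move=> u; apply: omega_inj => B c.
by rewrite omega_ev_add omega_ev_scale omega_ev_zero scaleN1r addNr.
Qed.
End Operations.

HB.instance Definition _ k := GRing.isZmodule.Build (omega k)
  (@omega_addA k) (@omega_addC k) (@omega_add0 k) (@omega_addN k).

Fact omega_scaleA k (r s : R) (v : omega k) :
  omega_scale r (omega_scale s v) = omega_scale (r * s) v.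
Proof. by apply: omega_inj => B c; rewrite !omega_ev_scale scalerA. Qed.
Fact omega_scale1 k : left_id 1 (@omega_scale k).
Proof. by move=> v; apply: omega_inj => B c; rewrite omega_ev_scale scale1r. Qed.
Fact omega_scaleDr k : right_distributive (@omega_scale k) +%R.
Proof.
by move=> r v w; apply: omega_inj => B c; rewrite !(omega_ev_scale, omega_ev_add) scalerDr.
Qed.
Fact omega_scaleDl k (v : omega k) :
  {morph (@omega_scale k)^~ v : r s / r + s}.
Proof.
by move=> r s; apply: omega_inj => B c; rewrite !(omega_ev_scale, omega_ev_add) scalerDl.
Qed.

HB.instance Definition _ k := GRing.Zmodule_isLmodule.Build R (omega k)
  (@omega_scaleA k) (@omega_scale1 k) (@omega_scaleDr k) (@omega_scaleDl k).

Definition omega_d k l (e : l = k + 1) (v : omega k) : omega l :=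
  \pi_(omega l) (Ed e (repr v)).

Lemma omega_ev_d (B : opalg O) (c : coords n B) k l (e : l = k + 1) (v : omega k) :
  omega_ev c (omega_d e v) = dgd B e (omega_ev c v).
Proof. exact: omega_evE. Qed.

Lemma omega_ev_linear (B : opalg O) (c : coords n B) k :
  linear (@omega_ev B c k).
Proof. by move=> r v w; rewrite omega_ev_add omega_ev_scale. Qed.

Fact omega_d_linear k l (e : l = k + 1) : linear (omega_d e).
Proof.
move=> r v w; apply: omega_inj => B c.
by rewrite omega_ev_d !omega_ev_linear !omega_ev_d dgd_linear.
Qed.

Fact omega_d_d k l m (e : l = k + 1) (e' : m = l + 1) (v : omega k) :
  omega_d e' (omega_d e v) = 0.
Proof.
apply: omega_inj => B c.
by rewrite !omega_ev_d dgd_dgd (_ : 0 = \pi_(omega m) (Ezero m)) // omega_evE.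
Qed.

Definition omega_dg : dgmod R :=
  @DGMod R (fun k => omega k : lmodType R) omega_d omega_d_linear omega_d_d.

Definition omega_act : action_on O omega_dg := fun p l a x m e =>
  \pi_(omega m) (@Eact p l a (fun i => tag (x i)) (fun i => repr (tagged (x i))) m e).

Fact omega_axioms : opalg_axioms omega_act.
Proof.
apply: (@joint_opalg_axioms R O omega_dg omega_act
  (fun B f => exists c : coords n B, f = @omega_ev B c)).
- by move=> B _ [c ->]; split=> *; [exact: omega_ev_linear | exact: omega_ev_d].
- by move=> B _ [c ->] p l a x m e; rewrite omega_evE.
- by move=> k v w E; apply: omega_inj => B c; apply: E; exists c.
Qed.

Definition Omega : opalg O := Opalg omega_axioms.

Definition Omega_x (i : 'I_n.+1) : Omega 0 := \pi_(omega 0) (Ex i).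
Definition Omega_dx (i : 'I_n.+1) : Omega 1 := \pi_(omega 1) (Edx i).

Lemma omega_ev_sum (B : opalg O) (c : coords n B) k (F : 'I_n.+1 -> omega k) :
  omega_ev c (\sum_i F i) = \sum_i omega_ev c (F i).
Proof.
apply: (big_morph (@omega_ev B c k)) => [v w|]; first exact: omega_ev_add.
exact: (omega_evE c (Ezero k)).
Qed.

Definition Omega_coords : coords n Omega.
Proof.
exists Omega_x Omega_dx.
- move=> i e; apply: omega_inj => B c.
  by rewrite omega_ev_d !omega_evE /= cx_d.
- apply: omega_inj => B c.
  rewrite omega_ev_sum (eq_bigr (cx c)) => [|i _]; last by rewrite omega_evE.
  rewrite cx_sum; symmetry; apply: (ua_alg_unit_morph (A := Omega)).
  by move=> p l a x m e; rewrite omega_evE.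
- apply: omega_inj => B c.
  rewrite omega_ev_sum (eq_bigr (cdx c)) => [|i _]; last by rewrite omega_evE.
  by rewrite cdx_sum (omega_evE c (Ezero 1)).
Defined.

Definition Omega_lift (B : opalg O) (c : coords n B) : opalg_hom Omega B.
Proof.
exists (@omega_ev B c).
- by split=> *; [exact: omega_ev_linear | exact: omega_ev_d].
- by move=> p l a x m e; rewrite omega_evE.
Defined.

Lemma Omega_lift_x (B : opalg O) (c : coords n B) i :
  Omega_lift c 0 (Omega_x i) = cx c i.
Proof. exact: omega_evE. Qed.

Lemma Omega_lift_dx (B : opalg O) (c : coords n B) i :
  Omega_lift c 1 (Omega_dx i) = cdx c i.
Proof. exact: omega_evE. Qed.

Lemma eval_hom (A B : opalg O) (f : opalg_hom A B) (c : coords n A)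
  (c' : coords n B) : (forall i, f 0 (cx c i) = cx c' i) ->
  (forall i, f 1 (cdx c i) = cdx c' i) ->
  forall k (t : expr k), f k (eval c t) = eval c' t.
Proof.
move=> fx fdx k; elim=> {k} //=.
- by move=> k; rewrite ah_zero.
- by move=> k t IHt u IHu; rewrite ah_add IHt IHu.
- by move=> k r t IHt; rewrite ah_scale IHt.
- by move=> k l e t IHt; rewrite (ah_chain f).2 IHt.
- move=> p l a d t IHt m e; rewrite ah_act; apply: act_irr.
  by apply: funext => i; rewrite /hmap /= IHt.
Qed.

Lemma eval_Omega_coords k (t : expr k) : eval Omega_coords t = \pi_(omega k) t.
Proof.
apply: omega_inj => B c; rewrite omega_evE.
by apply: (eval_hom (f := Omega_lift c)) => i; exact: omega_evE.
Qed.

Lemma Omega_hom_eq (B : opalg O) (f g : opalg_hom Omega B) :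
  (forall i, f 0 (Omega_x i) = g 0 (Omega_x i)) -> f = g.
Proof.
move=> fg; apply: opalg_hom_eq => k v.
have fgd i : f 1 (Omega_dx i) = g 1 (Omega_dx i).
  have e : 1 = 0 + 1 :> int by [].
  rewrite -[Omega_dx i](cx_d Omega_coords i e).
  by rewrite (ah_chain f).2 (ah_chain g).2 fg.
rewrite -[v]reprK -eval_Omega_coords.
rewrite (eval_hom (f := f) (c' := coords_map f Omega_coords)) //.
symmetry; apply: eval_hom => i; first exact/esym/fg.
exact/esym/fgd.
Qed.

Lemma Omega_univ (B : opalg O) (c : coords n B) :
  exists f : opalg_hom Omega B,
    [/\ forall i, f 0 (Omega_x i) = cx c i,
        forall i, f 1 (Omega_dx i) = cdx c i &
        forall g : opalg_hom Omega B,
          (forall i, g 0 (Omega_x i) = cx c i) -> g = f].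
Proof.
exists (Omega_lift c); split=> [i|i|g gx].
- exact: Omega_lift_x.
- exact: Omega_lift_dx.
- by apply: Omega_hom_eq => i; rewrite gx Omega_lift_x.
Qed.

End Omega.
Arguments Omega {R} O n.
Arguments Omega_x {R O n} i.
Arguments Omega_dx {R O n} i.

(* Monotone maps [m] -> [n], where [n] = {0, ..., n} *)
Record delta (m n : nat) := Delta {
  dmap :> 'I_m.+1 -> 'I_n.+1;
  dmap_mono : {homo dmap : i j / (i <= j)%N} }.

Lemma delta_eq m n (f g : delta m n) : f =1 g -> f = g.
Proof.
case: f g => f f1 [g g1] /= /funext E; case: g / E g1 => g1.
congr Delta; exact: Prop_irrelevance.
Qed.

Definition delta_id n : delta n n.
Proof. by exists id. Defined.

Definition delta_comp l m n (g : delta m n) (f : delta l m) : delta l n.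
Proof. by exists (fun i => g (f i)) => i j ij; do 2!apply: dmap_mono. Defined.

Definition delta_const m n (i : 'I_n.+1) : delta m n.
Proof. by exists (fun=> i). Defined.

Definition coface n (j : 'I_n.+2) : delta n n.+1.
Proof.
exists (lift j) => a b ab /=.
by rewrite leq_bump2.
Defined.

(* The surjection taking the value j twice *)
Definition codegeneracy n (j : 'I_n.+1) : delta n.+1 n.
Proof.
exists (fun i : 'I_n.+2 => inord (unbump j i)) => a b ab.
rewrite !inordK /unbump; move: (ltn_ord a) (ltn_ord b) (ltn_ord j); lia.
Defined.

Record sset := MkSSet {
  sx :> nat -> Type;
  sact : forall m n, delta m n -> sx n -> sx m;
  sact_id : forall n (s : sx n), sact (delta_id n) s = s;
  sact_comp : forall l m n (g : delta m n) (f : delta l m) (s : sx n),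
    sact (delta_comp g f) s = sact f (sact g s) }.
Arguments sact X {m n} f s : rename.

Record smap (X Y : sset) := SMap {
  sm :> forall n, X n -> Y n;
  sm_nat : forall m n (f : delta m n) (s : X n),
    sm (sact X f s) = sact Y f (sm s) }.
Arguments sm {X Y} f n s : rename.

Lemma smap_eq (X Y : sset) (f g : smap X Y) :
  (forall n (s : X n), f n s = g n s) -> f = g.
Proof.
case: f g => f f1 [g g1] /= fg.
have E : f = g.
  by apply: functional_extensionality_dep => n; apply: funext => s.
by case: g / E g1 fg => *; congr SMap; apply: Prop_irrelevance.
Qed.

Definition smap_id (X : sset) : smap X X.
Proof. by exists (fun _ s => s). Defined.

Definition smap_comp (X Y Z : sset) (g : smap Y Z) (f : smap X Y) : smap X Z.
Proof. by exists (fun n s => g n (f n s)) => *; rewrite !sm_nat. Defined.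

Definition SSet : category.
Proof.
refine (@Category sset smap smap_id smap_comp _ _ _).
all: by move=> *; apply: smap_eq.
Defined.

Definition simplex (n : nat) : sset.
Proof.
refine (@MkSSet (fun m => delta m n) (fun _ _ f s => delta_comp s f) _ _).
all: by move=> *; apply: delta_eq.
Defined.

Definition in_horn n (k : 'I_n.+1) m (s : delta m n) : Prop :=
  exists2 i : 'I_n.+1, i != k & forall j, s j != i.

Definition horn n (k : 'I_n.+1) : sset.
Proof.
refine (@MkSSet (fun m => {s : delta m n | in_horn k s})
  (fun _ _ f s => exist _ (delta_comp (sval s) f) _) _ _).
- by move=> m [s hs]; apply: eq_exist; apply: delta_eq.
- by move=> l m p g f [s hs]; apply: eq_exist; apply: delta_eq.
Unshelve.
by case: s => s [i ik hs]; exists i => //= j; apply: hs.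
Defined.

Definition horn_incl n (k : 'I_n.+1) : smap (horn k) (simplex n).
Proof. by exists (fun _ s => sval s). Defined.

Definition kan_fibration (X Y : sset) (p : smap X Y) : Prop :=
  forall n (k : 'I_n.+2), has_lift (horn_incl k : @hom SSet _ _) (p : @hom SSet X Y).

Definition kan_complex (K : sset) : Prop :=
  forall n (k : 'I_n.+2) (f : smap (horn k) K),
  exists g : smap (simplex n.+1) K, smap_comp g (horn_incl k) = f.

Definition sprod (X Y : sset) : sset.
Proof.
refine (@MkSSet (fun n => X n * Y n)%type
  (fun _ _ f s => (sact X f s.1, sact Y f s.2)) _ _).
- by move=> n [x y] /=; rewrite !sact_id.
- by move=> l m n g f [x y] /=; rewrite !sact_comp.
Defined.

Definition homotopic (X K : sset) (f g : smap X K) : Prop :=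
  exists H : smap (sprod X (simplex 1)) K,
    forall n (s : X n),
      H n (s, delta_const n ord0) = f n s /\ H n (s, delta_const n ord_max) = g n s.

(* w induces a bijection on homotopy classes of maps to every Kan complex;
   homotopy is an equivalence relation on maps to a Kan complex. *)
Definition weak_equivalence (X Y : sset) (w : smap X Y) : Prop :=
  forall K : sset, kan_complex K ->
  (forall f g : smap Y K,
     homotopic (smap_comp f w) (smap_comp g w) -> homotopic f g) /\
  (forall h : smap X K, exists f : smap Y K, homotopic (smap_comp f w) h).

Definition SSet_model : model_classes SSet :=
  @ModelClasses SSet
    (fun X Y (f : smap X Y) => weak_equivalence f)
    (fun X Y (f : smap X Y) => forall n, injective (f n))
    (fun X Y (f : smap X Y) => kan_fibration f).

Section Forms.
Variables (R : comPzRingType) (O : uaoperad R).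

(* x_i goes to the sum of the x_j with f j = i, and likewise for the dx_i *)
Definition delta_coords m n (f : delta m n) : coords n (Omega O m).
Proof.
exists (fun i => \sum_(j < m.+1 | f j == i) Omega_x j)
       (fun i => \sum_(j < m.+1 | f j == i) Omega_dx j).
- move=> i e; rewrite (big_morph (dgd (Omega O m) e)
    (id1 := 0) (op1 := +%R)) => [|u v|].
  + by apply: eq_bigr => j _; apply: (cx_d (Omega_coords O m)).
  + by have := dgd_linear e 1 u v; rewrite !scale1r.
  + by have := dgd_linear e (-1) (0 : Omega O m 0) 0; rewrite scaleN1r oppr0 addr0 scaleN1r addNr.
- by rewrite -(cx_sum (Omega_coords O m)) [RHS](partition_big f predT).
- by rewrite -[RHS](cdx_sum (Omega_coords O m)) [RHS](partition_big f predT).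
Defined.

Definition Omega_map m n (f : delta m n) : opalg_hom (Omega O n) (Omega O m) :=
  Omega_lift (delta_coords f).

Lemma Omega_map_x m n (f : delta m n) i :
  Omega_map f 0 (Omega_x i) = \sum_(j < m.+1 | f j == i) Omega_x j.
Proof. exact: Omega_lift_x. Qed.

Lemma Omega_map_dx m n (f : delta m n) i :
  Omega_map f 1 (Omega_dx i) = \sum_(j < m.+1 | f j == i) Omega_dx j.
Proof. exact: Omega_lift_dx. Qed.

Lemma Omega_map_id n k (v : Omega O n k) : Omega_map (delta_id n) k v = v.
Proof.
suff -> : Omega_map (delta_id n) = opalg_id (Omega O n) by [].
by apply: Omega_hom_eq => i; rewrite Omega_map_x big_pred1_eq.
Qed.

Lemma Omega_map_comp l m n (g : delta m n) (f : delta l m) k (v : Omega O n k) :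
  Omega_map (delta_comp g f) k v = Omega_map f k (Omega_map g k v).
Proof.
suff -> : Omega_map (delta_comp g f) = opalg_comp (Omega_map f) (Omega_map g) by [].
apply: Omega_hom_eq => i; rewrite Omega_map_x.
rewrite [RHS](_ : _ = Omega_map f 0 (Omega_map g 0 (Omega_x i))) // Omega_map_x.
rewrite ah_sum [LHS](partition_big f (fun j => g j == i)) //.
apply: eq_bigr => j gj; rewrite Omega_map_x; apply: eq_bigl => q.
by rewrite andbC; case: eqP => //= ->; rewrite (eqP gj) eqxx.
Qed.

(* The faces delta_j and degeneracies sigma_j; for i : 'I_n.+1 and j : 'I_n.+2,
   [lift j i] is i if i < j and i + 1 otherwise. *)
Lemma Omega_face_j n (j : 'I_n.+2) : Omega_map (coface j) 0 (Omega_x j) = 0.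
Proof.
by rewrite Omega_map_x big_pred0 // => i; rewrite eq_sym (negbTE (neq_lift j i)).
Qed.

Lemma Omega_face n (j : 'I_n.+2) (i : 'I_n.+1) :
  Omega_map (coface j) 0 (Omega_x (lift j i)) = Omega_x i.
Proof.
rewrite Omega_map_x (big_pred1 i) // => q /=.
by rewrite (inj_eq (@lift_inj _ j)).
Qed.

Lemma Omega_degeneracy n (i j : 'I_n.+1) :
  Omega_map (codegeneracy j) 0 (Omega_x i) =
  (if i == j then Omega_x (widen_ord (leqnSn _) j) else 0) +
  Omega_x (lift (widen_ord (leqnSn _) j) i).
Proof.
set j' := widen_ord _ j; rewrite Omega_map_x.
have D (q : 'I_n.+2) : (codegeneracy j q == i) = (unbump j q == i).
  rewrite -val_eqE /= inordK // /unbump.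
  by move: (ltn_ord q) (ltn_ord j); lia.
rewrite (eq_bigl (fun q : 'I_n.+2 => unbump j q == i)) => [|q]; last exact: D.
rewrite [LHS](bigD1 (lift j' i)) /=; last by rewrite /bump /unbump; lia.
rewrite addrC; congr (_ + _); case: eqP => [->|ij].
  rewrite (big_pred1 j') // => q /=.
  by rewrite -!val_eqE /= /bump /unbump; lia.
rewrite big_pred0 // => q; apply/negP.
rewrite -!val_eqE /= /bump /unbump.
have {}ij : i != j :> nat by apply/eqP => /val_inj.
lia.
Qed.

(* Simplicial maps from X to the degree k part of the simplicial algebra Omega *)
Record form (X : sset) (k : int) := Form {
  fval :> forall n, X n -> Omega O n k;
  fval_nat : forall m n (f : delta m n) (s : X n),
    fval (sact X f s) = Omega_map f k (fval s) }.

Section FormModule.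
Variable X : sset.

Lemma form_eq k (v w : form X k) :
  (forall n (s : X n), v n s = w n s) -> v = w.
Proof.
case: v w => v v1 [w w1] /= vw.
have E : v = w.
  by apply: functional_extensionality_dep => n; apply: funext => s; exact: vw.
by case: w / E w1 vw => *; congr Form; apply: Prop_irrelevance.
Qed.

HB.instance Definition _ k := gen_eqMixin (form X k).
HB.instance Definition _ k := gen_choiceMixin (form X k).

Section Operations.
Variable k : int.

Definition form_zero : form X k.
Proof. by exists (fun _ _ => 0) => *; rewrite ah_zero. Defined.

Definition form_add (v w : form X k) : form X k.
Proof.
by exists (fun n s => v n s + w n s) => *; rewrite !fval_nat ah_add.
Defined.

Definition form_scale (r : R) (v : form X k) : form X k.
Proof. by exists (fun n s => r *: v n s) => *; rewrite fval_nat ah_scale. Defined.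

Definition form_opp (v : form X k) : form X k := form_scale (-1) v.

Fact form_addA : associative form_add.
Proof. by move=> u v w; apply: form_eq => n s /=; rewrite addrA. Qed.
Fact form_addC : commutative form_add.
Proof. by move=> u v; apply: form_eq => n s /=; rewrite addrC. Qed.
Fact form_add0 : left_id form_zero form_add.
Proof. by move=> u; apply: form_eq => n s /=; rewrite add0r. Qed.
Fact form_addN : left_inverse form_zero form_opp form_add.
Proof. by move=> u; apply: form_eq => n s /=; rewrite scaleN1r addNr. Qed.
End Operations.

HB.instance Definition _ k := GRing.isZmodule.Build (form X k)
  (@form_addA k) (@form_addC k) (@form_add0 k) (@form_addN k).

Fact form_scaleA k (r q : R) (v : form X k) :
  form_scale r (form_scale q v) = form_scale (r * q) v.
Proof. by apply: form_eq => n s /=; rewrite scalerA. Qed.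
Fact form_scale1 k : left_id 1 (@form_scale k).
Proof. by move=> v; apply: form_eq => n s /=; rewrite scale1r. Qed.
Fact form_scaleDr k : right_distributive (@form_scale k) +%R.
Proof. by move=> r v w; apply: form_eq => n s /=; rewrite scalerDr. Qed.
Fact form_scaleDl k (v : form X k) : {morph (@form_scale k)^~ v : r q / r + q}.
Proof. by move=> r q; apply: form_eq => n s /=; rewrite scalerDl. Qed.

HB.instance Definition _ k := GRing.Zmodule_isLmodule.Build R (form X k)
  (@form_scaleA k) (@form_scale1 k) (@form_scaleDr k) (@form_scaleDl k).

Definition form_d k l (e : l = k + 1) (v : form X k) : form X l.
Proof.
exists (fun n s => dgd (Omega O n) e (v n s)) => m n f s.
by rewrite fval_nat (ah_chain (Omega_map f)).2.
Defined.

Fact form_d_linear k l (e : l = k + 1) : linear (form_d e).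
Proof. by move=> r v w; apply: form_eq => n s; apply: (dgd_linear e). Qed.

Fact form_d_d k l m (e : l = k + 1) (e' : m = l + 1) (v : form X k) :
  form_d e' (form_d e v) = 0.
Proof. by apply: form_eq => n s; apply: dgd_dgd. Qed.

Definition form_dg : dgmod R :=
  @DGMod R (fun k => form X k : lmodType R) form_d form_d_linear form_d_d.

Definition form_ev n (s : X n) k (v : form_dg k) : Omega O n k := fval v s.

Definition form_act : action_on O form_dg.
Proof.
move=> p l a x m e.
exists (fun n s => oa_act (Omega O n) a (fun i => hmap (form_ev s) (x i)) e).
move=> q n f s; rewrite ah_act; apply: act_irr.
by apply: funext => i; rewrite /hmap /form_ev /= fval_nat.
Defined.

Fact form_ev_chain n (s : X n) : chain_map (form_ev s).
Proof. by []. Qed.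

Fact form_axioms : opalg_axioms form_act.
Proof.
apply: (@joint_opalg_axioms R O form_dg form_act
  (fun B h => exists n (s : X n) (g : opalg_hom (Omega O n) B),
     h = fun k v => g k (form_ev s v))).
- move=> B _ [n [s [g ->]]]; split=> [k c v w|k l e v].
    by rewrite -(ah_chain g).1.
  by rewrite -(ah_chain g).2.
- by move=> B _ [n [s [g ->]]] p l a x m e; rewrite /form_ev /= ah_act.
- move=> k v w E; apply: form_eq => n s.
  apply: (E (Omega O n) (fun k v => form_ev s v)).
  by exists n, s, (opalg_id (Omega O n)).
Qed.

Definition Form_alg : opalg O := Opalg form_axioms.

End FormModule.

Definition Form_map (X Y : sset) (f : smap X Y) :
  opalg_hom (Form_alg Y) (Form_alg X).
Proof.
unshelve refine (@OpalgHom R O (Form_alg Y) (Form_alg X)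
  (fun k (v : form Y k) => @Form X k (fun n s => v n (f n s)) _) _ _).
- by move=> m n g s; rewrite sm_nat fval_nat.
- by split=> [k c v w|k l e v]; apply: form_eq.
- by move=> p l a x m e; apply: form_eq.
Defined.

Definition Omega_functor : functor SSet (op_category (OAlg O)).
Proof.
refine (@Functor SSet (op_category (OAlg O)) Form_alg Form_map _ _).
- by move=> X; apply: opalg_hom_eq => k v; apply: form_eq.
- by move=> X Y Z g f; apply: opalg_hom_eq => k v; apply: form_eq.
Defined.

Definition M_sset (A : opalg O) : sset.
Proof.
refine (@MkSSet (fun n => opalg_hom A (Omega O n))
  (fun m n f h => opalg_comp (Omega_map f) h) _ _).
- by move=> n h; apply: opalg_hom_eq => k v; apply: Omega_map_id.
- by move=> l m n g f h; apply: opalg_hom_eq => k v; apply: Omega_map_comp.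
Defined.

Definition M_map (A B : opalg O) (g : opalg_hom A B) : smap (M_sset B) (M_sset A).
Proof.
exists (fun n h => opalg_comp h g) => m n f h.
by apply: opalg_hom_eq.
Defined.

Definition M_functor : functor (op_category (OAlg O)) SSet.
Proof.
refine (@Functor (op_category (OAlg O)) SSet M_sset
  (fun A B (g : opalg_hom B A) => M_map g) _ _).
- by move=> A; apply: smap_eq => n h; apply: opalg_hom_eq.
- by move=> A B C g f; apply: smap_eq => n h; apply: opalg_hom_eq.
Defined.

End Forms.

(* Main.v *)
Require Import Defs.
From HB Require Import structures.
From mathcomp Require Import all_boot all_algebra perm zify ring boolp.
Set Implicit Arguments.
Unset Strict Implicit.
Unset Printing Implicit Defensive.
Import GRing.Theory.
Local Open Scope ring_scope.

(* Let N be the cochain complex of the interval, with basis 1, t, dt. Among the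
   operations of O with values in O (x) End(N), those acting in arities 0 and 1
   and on evaluations at the ends of the interval as O itself form an operad Q,
   and Q -> O is a surjective quasi-isomorphism. Since O is cofibrant, it has a
   section, through which N (x) A becomes a path object of an O-algebra A,
   functorial in A. The morphism Omega_n -> N (x) Omega_n sending x_j to
   d_0j + t (x_j - d_0j) then gives a homotopy s from v to its value at the
   vertex 0, on cocycles, natural for the maps fixing the vertex 0.

   A form given on a family of faces of a simplex extends along the maps which
   collapse faces to a vertex i, and the extension is natural for the maps
   respecting i. For i the vertex of a horn this shows that the simplicial set
   Z^k of cocycles of degree k is a Kan complex. Averaging the extensions over i
   with weights x_i, for a product on O-algebras lifting the one of Com, gives
   an extension natural for all maps, hence Omega takes monomorphisms to
   surjections.

   Cohomologous cocycles are homotopic maps to Z^k. Conversely a homotopy G from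
   0 to v gives an alternating sum of forms G(a, b) on the cone over each
   simplex, natural, equal to v on the base and to 0 at the apex; applying s
   yields a primitive of v. So a weak equivalence, tested on Z^k, induces an
   isomorphism in cohomology. *)

(** An operad need not have a diagonal, so N (x) A carries no evident action of O; a morphism from O
    to Q is a way to let O act on N (x) A compatibly with the two ends. Cofibrancy only gives lifts
    among unital augmented operads. This forces the conditions on Q in arities 0 and 1, where Q -> O
    has to be an isomorphism and not merely a quasi-isomorphism.

    Since Omega_n is given by generators and relations, a homotopy on it costs only the images of
    the x_j, whose sum must be the unit; hence the unit of N (x) A must be the constant 1 (x) 1. The
    same universal property lets maps of vertices that are not monotone act on Omega_n, which the
    collapse onto a face requires.

    No integration of forms occurs: weak equivalences are defined by homotopy classes of maps into
    Kan complexes, and Z^k is such a complex. A homotopy lives on prisms, whereas the contraction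
    needs cones natural in the simplex. The maps from the cone to the prism depend on a set S of
    vertices and are not natural one by one; their alternating sum over S is. *)

(* Equality of two sums up to the order of the terms. *)
Ltac zac :=
  rewrite -?addrA;
  repeat (first [ reflexivity |
   match goal with
   | |- ?a + _ = ?a + _ => apply: (congr1 (+%R a))
   | |- ?a + _ = _ => first [rewrite [in RHS](addrCA _ a) | rewrite [in RHS](addrC _ a)]
   end]).

(** * Signs modulo 2 and modules of dependent functions *)

Section Sign.
Variable R : comPzRingType.

Lemma sgnD (a b : int) : sgn (a + b) = sgn a * sgn b :> R.
Proof.
rewrite /sgn -exprD -signr_odd -[RHS]signr_odd; congr (_ ^+ (nat_of_bool _)).
by rewrite oddD; lia.
Qed.

Lemma sgnN (a : int) : sgn (- a) = sgn a :> R.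
Proof. by rewrite /sgn abszN. Qed.

Lemma sgn0 : sgn 0 = 1 :> R.
Proof. by []. Qed.

Lemma sgn1 : sgn 1 = -1 :> R.
Proof. by rewrite /sgn expr1. Qed.

(** Signs depend on exponents modulo 2, and [c] is half the difference. The harder sign checks below
    supply [c] by hand and leave an identity of integers to [ring]. *)
Lemma sgn_mod2 (a b c : int) : a = b + c *+ 2 -> sgn a = sgn b :> R.
Proof.
move=> ->; rewrite mulr2n !sgnD -expr2 /sgn sqrr_sign mulr1 //.
Qed.

Lemma sgnS (a b c : int) : a = b + 1 + c *+ 2 -> sgn a = - sgn b :> R.
Proof. by move/sgn_mod2->; rewrite sgnD sgn1 mulrN1. Qed.

End Sign.

Section DepFun.
Variables (R : comPzRingType) (T : Type) (V : T -> lmodType R).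

(** Coefficients of operations live in modules that depend on the degree; the product of all of them
    is one ambient module, from which Q inherits its linear structure. *)
Definition dfun := forall x, V x.

HB.instance Definition _ := gen_eqMixin dfun.
HB.instance Definition _ := gen_choiceMixin dfun.

Definition dfun0 : dfun := fun=> 0.
Definition dfunD (f g : dfun) : dfun := fun x => f x + g x.
Definition dfunN (f : dfun) : dfun := fun x => - f x.
Definition dfunZ (c : R) (f : dfun) : dfun := fun x => c *: f x.

Lemma dfunP (f g : dfun) : (forall x, f x = g x) -> f = g.
Proof. exact: functional_extensionality_dep. Qed.

Fact dfun_addA : associative dfunD.
Proof. by move=> f g h; apply: dfunP => x; apply: addrA. Qed.
Fact dfun_addC : commutative dfunD.
Proof. by move=> f g; apply: dfunP => x; apply: addrC. Qed.
Fact dfun_add0 : left_id dfun0 dfunD.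
Proof. by move=> f; apply: dfunP => x; apply: add0r. Qed.
Fact dfun_addN : left_inverse dfun0 dfunN dfunD.
Proof. by move=> f; apply: dfunP => x; apply: addNr. Qed.
HB.instance Definition _ := GRing.isZmodule.Build dfun
  dfun_addA dfun_addC dfun_add0 dfun_addN.

Fact dfun_scaleA a b f : dfunZ a (dfunZ b f) = dfunZ (a * b) f.
Proof. by apply: dfunP => x; apply: scalerA. Qed.
Fact dfun_scale1 : left_id 1 dfunZ.
Proof. by move=> f; apply: dfunP => x; apply: scale1r. Qed.
Fact dfun_scaleDr : right_distributive dfunZ +%R.
Proof. by move=> a f g; apply: dfunP => x; apply: scalerDr. Qed.
Fact dfun_scaleDl f : {morph dfunZ^~ f : a b / a + b}.
Proof. by move=> a b; apply: dfunP => x; apply: scalerDl. Qed.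
HB.instance Definition _ := GRing.Zmodule_isLmodule.Build R dfun
  dfun_scaleA dfun_scale1 dfun_scaleDr dfun_scaleDl.

End DepFun.

(** * Words in the basis of the interval *)

(* The cochain complex of the interval has the basis 1, t, h = dt, written None,
   Some false and Some true. *)
Notation letter := (option bool).
Notation L1 := (None : letter).
Notation Lt := (Some false : letter).
Notation Lh := (Some true : letter).

Definition ldeg (u : letter) : int := if u is Some true then 1 else 0.

Lemma sum_letter (V : nmodType) (F : letter -> V) :
  \sum_u F u = F L1 + F Lt + F Lh.
Proof.
rewrite (bigD1 L1) // (bigD1 Lt) // (bigD1 Lh) //= big1 ?addr0 ?addrA //.
by case=> [[]|].
Qed.

(* A basis element of N^(x)n is given by the first n letters of a word. *)
Definition word := nat -> letter.

Definition pre (w : nat -> int) (i : nat) : int := \sum_(0 <= j < i) w j.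

Definition wdeg (w : word) (n : nat) : int := \sum_(0 <= j < n) ldeg (w j).

(** Since words are infinite, cutting out the block of inputs of [b] in a o_i b ([inw]) and
    contracting that block to one letter ([outw]) are total operations whose types carry no
    arity. *)
Definition inw (i : nat) (w : word) : word := fun j => w (i + j)%N.

Definition outw (n i : nat) (w : word) (u : letter) : word :=
  fun j => if (j < i)%N then w j else if j == i then u else w (j + n).-1.

Definition updw (w : word) (i : nat) (u : letter) : word :=
  fun j => if j == i then u else w j.

Definition eqw (n : nat) (v w : word) := forall j, (j < n)%N -> v j = w j.

Lemma wdeg_eq n v w : eqw n v w -> wdeg v n = wdeg w n.
Proof.
by move=> vw; apply: eq_big_nat => j /andP[_ jn]; rewrite vw.
Qed.

Lemma sum_shift (V : nmodType) (F : nat -> V) i n :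
  \sum_(i <= j < i + n) F j = \sum_(0 <= j < n) F (i + j)%N.
Proof.
rewrite -{1}[i]add0n big_addn addKn.
by apply: eq_bigr => j _; rewrite addnC.
Qed.

Lemma sum_block (V : nmodType) (F : nat -> V) m n i p : arity m n i p ->
  \sum_(0 <= j < p) F j =
  \sum_(0 <= j < i) F j + \sum_(0 <= j < n) F (i + j)%N +
  \sum_(i.+1 <= j < m) F (j + n).-1.
Proof.
case/andP=> im /eqP pmn.
rewrite (@big_cat_nat _ _ _ i) //=; last lia.
rewrite (@big_cat_nat _ _ _ (i + n)%N i) //=; [|lia|lia].
rewrite (sum_shift F i n) addrA; congr (_ + _).
have [n0|n0] := posnP n.
  subst n; rewrite addn0; have -> : p = m.-1 by lia.
  by rewrite -(prednK (leq_ltn_trans (leq0n i) im)) big_add1 /=; apply: eq_bigr => j _; congr F; lia.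
have -> : (i + n = i.+1 + n.-1)%N by lia.
rewrite big_addn; have -> : (p - n.-1 = m)%N by lia.
by apply: eq_bigr => j _; congr F; lia.
Qed.

Lemma sum_pluck (V : nmodType) (F : nat -> V) m i : (i < m)%N ->
  \sum_(0 <= j < m) F j =
  \sum_(0 <= j < i) F j + F i + \sum_(i.+1 <= j < m) F j.
Proof.
move=> im; rewrite (@big_cat_nat _ _ _ i) //=; last lia.
by rewrite [\sum_(i <= j < m) _]big_ltn // addrA.
Qed.

Lemma wdeg_outw w u m n i p : arity m n i p ->
  wdeg (outw n i w u) m = wdeg w p - wdeg (inw i w) n + ldeg u.
Proof.
move=> h; have im : (i < m)%N by case/andP: h.
rewrite /wdeg (sum_block _ h) (sum_pluck _ im).
rewrite {2}/outw ltnn eqxx.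
rewrite (@eq_big_nat _ _ _ _ _ _ (fun j => ldeg (w j))); last first.
  by move=> j /andP[_ ji]; rewrite /outw ji.
rewrite (@eq_big_nat _ _ _ i.+1 _ _ (fun j => ldeg (w (j + n).-1))); last first.
  move=> j /andP[ij _]; rewrite /outw; have -> : (j < i)%N = false by lia.
  by have -> : (j == i) = false by lia.
rewrite /inw; ring.
Qed.

Lemma wdeg_outw_pre w u n i : wdeg (outw n i w u) i = wdeg w i.
Proof. by apply: wdeg_eq => j ji; rewrite /outw ji. Qed.

Lemma wdeg_inw i w n : wdeg w (i + n) = wdeg w i + wdeg (inw i w) n.
Proof. by rewrite /wdeg (@big_cat_nat _ _ _ i) ?(sum_shift _ i n) //= leq_addr. Qed.

Lemma wdeg_updw w i u n : (i < n)%N ->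
  wdeg (updw w i u) n = wdeg w n - ldeg (w i) + ldeg u.
Proof.
move=> ni; rewrite /wdeg !(sum_pluck _ ni) {2}/updw eqxx.
rewrite (@eq_big_nat _ _ _ _ _ _ (fun j => ldeg (w j))); last first.
  by move=> j ?; rewrite /updw; have -> : (j == i) = false by lia.
rewrite (@eq_big_nat _ _ _ i.+1 _ _ (fun j => ldeg (w j))); last first.
  by move=> j ?; rewrite /updw; have -> : (j == i) = false by lia.
ring.
Qed.

Lemma wdeg_updw_pre w i u n : (n <= i)%N -> wdeg (updw w i u) n = wdeg w n.
Proof.
by move=> ni; apply: wdeg_eq => j ?; rewrite /updw; have -> : (j == i) = false by lia.
Qed.

(** * The operad of operations on the path object *)

Section Linear.
Variables (R : comPzRingType) (U V : lmodType R) (f : U -> V).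
Hypothesis f_linear : linear f.

Lemma linear_fun0 : f 0 = 0.
Proof. by have := f_linear (-1) 0 0; rewrite scaleN1r oppr0 addr0 scaleN1r addNr. Qed.

Lemma linear_funD x y : f (x + y) = f x + f y.
Proof. by rewrite -[x in LHS]scale1r f_linear scale1r. Qed.

Lemma linear_funZ c x : f (c *: x) = c *: f x.
Proof. by rewrite -[c *: x]addr0 f_linear linear_fun0 addr0. Qed.

Lemma linear_funN x : f (- x) = - f x.
Proof. by rewrite -scaleN1r linear_funZ scaleN1r. Qed.

Lemma linear_fun_sum (I : Type) (r : seq I) (P : pred I) (F : I -> U) :
  f (\sum_(i <- r | P i) F i) = \sum_(i <- r | P i) f (F i).
Proof. by apply: (big_morph f); [exact: linear_funD | exact: linear_fun0]. Qed.

End Linear.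

Section Cast.
Variables (R : comPzRingType) (A : dgmod R).

(* Zero unless k = l; likewise [tcomp] and [tact] below are the structure maps
   extended by zero to all degrees. *)
Definition dcast k l (x : A k) : A l :=
  match eq_comparable k l with
  | left e => eq_rect k (fun j => A j) x l e
  | right _ => 0
  end.

Lemma dcast_id k (x : A k) : dcast k x = x.
Proof.
rewrite /dcast; case: (eq_comparable _ _) => // e.
by rewrite (Prop_irrelevance e erefl).
Qed.

Lemma dcast_ne k l (x : A k) : k != l -> dcast l x = 0.
Proof. by rewrite /dcast; case: (eq_comparable _ _) => // e; rewrite {1}e eqxx. Qed.

Lemma dcast_linear k l : linear (@dcast k l).
Proof.
move=> c x y; have [e|e] := eqVneq k l; last by rewrite !dcast_ne // scaler0 addr0.
by case: l / e; rewrite !dcast_id.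
Qed.

Lemma mkhel_dcast k l (x : A k) : k = l -> mkhel (dcast l x) = mkhel x.
Proof. by move=> e; case: l / e; rewrite dcast_id. Qed.

End Cast.

Section Raw.
Variables (R : comPzRingType) (O : operad R).

Lemma op_d_linear n k l (e : l = k + 1) : linear (dgd (O n) e).
Proof. exact: dgd_linear. Qed.

Definition tcomp m n i p (h : arity m n i p) k l q (a : O m k) (b : O n l) :
  O p q := match eq_comparable q (k + l) with
           | left e => op_comp O h e a b
           | right _ => 0
           end.

Lemma tcompE m n i p (h : arity m n i p) k l q (e : q = k + l)
  (a : O m k) (b : O n l) : tcomp h q a b = op_comp O h e a b.
Proof.
rewrite /tcomp; case: (eq_comparable _ _) => // e'; congr op_comp.
exact: Prop_irrelevance.
Qed.

Lemma tcomp_ne m n i p (h : arity m n i p) k l q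
  (a : O m k) (b : O n l) : q != k + l -> tcomp h q a b = 0.
Proof. by rewrite /tcomp; case: (eq_comparable _ _) => // e /eqP. Qed.

Lemma tcomp_linl m n i p (h : arity m n i p) k l q (b : O n l) :
  linear (fun a : O m k => tcomp h q a b).
Proof.
move=> c x y; have [e|e] := eqVneq q (k + l).
  by rewrite !tcompE (op_comp_linl h e b).
by rewrite !tcomp_ne // scaler0 addr0.
Qed.

Lemma tcomp_linr m n i p (h : arity m n i p) k l q (a : O m k) :
  linear (fun b : O n l => tcomp h q a b).
Proof.
move=> c x y; have [e|e] := eqVneq q (k + l).
  by rewrite !tcompE (op_comp_linr h e a).
by rewrite !tcomp_ne // scaler0 addr0.
Qed.

Lemma tcomp0l m n i p (h : arity m n i p) k l q (b : O n l) :
  tcomp h q (0 : O m k) b = 0.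
Proof. exact: (linear_fun0 (tcomp_linl h q b)). Qed.

Lemma tcomp0r m n i p (h : arity m n i p) k l q (a : O m k) :
  tcomp h q a (0 : O n l) = 0.
Proof. exact: (linear_fun0 (tcomp_linr h q a)). Qed.

Lemma tcompZl m n i p (h : arity m n i p) k l q c (a : O m k) (b : O n l) :
  tcomp h q (c *: a) b = c *: tcomp h q a b.
Proof. exact: (linear_funZ (tcomp_linl h q b)). Qed.

Lemma tcompZr m n i p (h : arity m n i p) k l q c (a : O m k) (b : O n l) :
  tcomp h q a (c *: b) = c *: tcomp h q a b.
Proof. exact: (linear_funZ (tcomp_linr h q a)). Qed.

Lemma tcompDl m n i p (h : arity m n i p) k l q (a a' : O m k) (b : O n l) :
  tcomp h q (a + a') b = tcomp h q a b + tcomp h q a' b.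
Proof. exact: (linear_funD (tcomp_linl h q b)). Qed.

Lemma tcompDr m n i p (h : arity m n i p) k l q (a : O m k) (b b' : O n l) :
  tcomp h q a (b + b') = tcomp h q a b + tcomp h q a b'.
Proof. exact: (linear_funD (tcomp_linr h q a)). Qed.

Lemma tcomp_suml m n i p (h : arity m n i p) k l q (I : Type) (r : seq I)
  (P : pred I) (F : I -> O m k) (b : O n l) :
  tcomp h q (\sum_(i <- r | P i) F i) b = \sum_(i <- r | P i) tcomp h q (F i) b.
Proof. exact: (linear_fun_sum (tcomp_linl h q b)). Qed.

Lemma tcomp_sumr m n i p (h : arity m n i p) k l q (I : Type) (r : seq I)
  (P : pred I) (a : O m k) (F : I -> O n l) :
  tcomp h q a (\sum_(i <- r | P i) F i) = \sum_(i <- r | P i) tcomp h q a (F i).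
Proof. exact: (linear_fun_sum (tcomp_linr h q a)). Qed.

Lemma tcomp_seq m n r i j mn nr p
    (h1 : arity m n i mn) (h2 : arity mn r (i + j) p)
    (h3 : arity n r j nr) (h4 : arity m nr i p) k l w kl lw q
    (a : O m k) (b : O n l) (c : O r w) : kl = k + l -> lw = l + w ->
  tcomp h2 q (tcomp h1 kl a b) c = tcomp h4 q a (tcomp h3 lw b c).
Proof.
move=> e1 e3; rewrite (tcompE h1 e1) (tcompE h3 e3).
have [e|e] := eqVneq q (kl + w); last first.
  by rewrite !tcomp_ne // -?e1; apply: contraNneq e => ->; rewrite e1 e3; apply/eqP; ring.
have e4 : q = k + lw by rewrite e e1 e3; ring.
by rewrite (tcompE h2 e) (tcompE h4 e4) (op_comp_seq h1 h2 h3 h4 e1 e e3 e4).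
Qed.

Lemma tcomp_par m n r i j mn mr p (ij : (i < j)%N)
    (h1 : arity m n i mn) (h2 : arity mn r (j + n).-1 p)
    (h3 : arity m r j mr) (h4 : arity mr n i p) k l w kl kw q
    (a : O m k) (b : O n l) (c : O r w) : kl = k + l -> kw = k + w ->
  tcomp h2 q (tcomp h1 kl a b) c =
  sgn (l * w) *: tcomp h4 q (tcomp h3 kw a c) b.
Proof.
move=> e1 e3; rewrite (tcompE h1 e1) (tcompE h3 e3).
have [e|e] := eqVneq q (kl + w); last first.
  rewrite !tcomp_ne // ?scaler0 // -?e1; apply: contraNneq e => ->.
  by rewrite e1 e3; apply/eqP; ring.
have e4 : q = kw + l by rewrite e e1 e3; ring.
by rewrite (tcompE h2 e) (tcompE h4 e4) (op_comp_par ij h1 h2 h3 h4 e1 e e3 e4).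
Qed.

Lemma tcomp_d m n i p (h : arity m n i p) k l q k' l' q' (ek : k' = k + 1)
    (el : l' = l + 1) (eq : q' = q + 1) (a : O m k) (b : O n l) :
  dgd _ eq (tcomp h q a b) =
  tcomp h q' (dgd _ ek a) b + sgn k *: tcomp h q' a (dgd _ el b).
Proof.
have [e|e] := eqVneq q (k + l); last first.
  rewrite !tcomp_ne ?(linear_fun0 (op_d_linear eq)) ?scaler0 ?addr0 //.
  - by apply: contraNneq e; rewrite eq el => E; apply/eqP/(addIr 1); rewrite E; ring.
  - by apply: contraNneq e; rewrite eq ek => E; apply/eqP/(addIr 1); rewrite E; ring.
have e1 : q' = k' + l by rewrite eq e ek; ring.
have e2 : q' = k + l' by rewrite eq e el; ring.
by rewrite (tcompE h e) (tcompE h e1) (tcompE h e2) (op_comp_d h e ek el eq e1 e2).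
Qed.

Lemma tcomp_act m n p (i : 'I_m) (s : 'S_m) (t : 'S_n) (r : 'S_p)
    (h : arity m n i p) (h' : arity m n (s i) p) k l q (a : O m k) (b : O n l) :
  (forall (j : 'I_n) (u : 'I_p), u = (i + j)%N :> nat ->
     r u = (s i + t j)%N :> nat) ->
  (forall (j : 'I_m) (u : 'I_p), j != i -> outer n i j u ->
     outer n (s i) (s j) (r u)) ->
  tcomp h' q (op_act O s a) (op_act O t b) = op_act O r (tcomp h q a b).
Proof.
move=> H1 H2; have [e|e] := eqVneq q (k + l); last first.
  by rewrite !tcomp_ne // (linear_fun0 ((@op_act_chain _ O _ r).1 q)).
by rewrite !tcompE (op_comp_act h h' e a b H1 H2).
Qed.

(* The component of degree j of the coefficient f(w; u) in O(n) of the map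
   N^(x)n -> N sending the word w to the letter u. *)
Definition raw n := @dfun R (word * letter * int) (fun x => O n x.2).

Definition rco n (f : raw n) (w : word) (u : letter) (j : int) : O n j :=
  f (w, u, j).

Lemma rawP n (f g : raw n) : (forall w u j, rco f w u j = rco g w u j) -> f = g.
Proof. by move=> fg; apply: dfunP => -[[w u] j]; apply: fg. Qed.

Lemma rcoD n (f g : raw n) w u j : rco (f + g) w u j = rco f w u j + rco g w u j.
Proof. by []. Qed.

Lemma rcoZ n c (f : raw n) w u j : rco (c *: f) w u j = c *: rco f w u j.
Proof. by []. Qed.

Lemma rco0 n w u j : rco (0 : raw n) w u j = 0.
Proof. by []. Qed.

(** The Koszul sign of (E (x) a) o_i (E' (x) b) for matrix units E with output u and E' from
    [inw i w] to v. The second factor is the degree of E', which moves past the coefficient a, of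
    degree k + |outw n i w v| - |u|, and past the first i letters of w. *)
Definition cexp (k : int) (m n i : nat) (w : word) (u v : letter) : int :=
  (k + wdeg (outw n i w v) m - ldeg u + wdeg w i) *
  (ldeg v - wdeg (inw i w) n).

(* The coefficient of a o_i b from the word w to the letter u is the sum over
   the letters v of the ways to factor through v. *)
Definition rcomp m n i p (h : arity m n i p) k l (f : raw m) (g : raw n) :
  raw p := fun x => let: (w, u, j) := x in
  \sum_v sgn (cexp k m n i w u v) *:
    tcomp h j (rco f (outw n i w v) u (k + wdeg (outw n i w v) m - ldeg u))
              (rco g (inw i w) v (l + wdeg (inw i w) n - ldeg v)).

Lemma rcoC m n i p (h : arity m n i p) k l (f : raw m) (g : raw n) w u j :
  rco (rcomp h k l f g) w u j = \sum_v sgn (cexp k m n i w u v) *: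
    tcomp h j (rco f (outw n i w v) u (k + wdeg (outw n i w v) m - ldeg u))
              (rco g (inw i w) v (l + wdeg (inw i w) n - ldeg v)).
Proof. by []. Qed.

Lemma rcomp_linl m n i p (h : arity m n i p) k l (g : raw n) :
  linear (fun f : raw m => rcomp h k l f g).
Proof.
move=> c x y; apply: rawP => w u j; rewrite rcoD rcoZ !rcoC scaler_sumr -big_split.
apply: eq_bigr => v _ /=; rewrite !rcoD !rcoZ tcompDl tcompZl scalerDr.
by rewrite !scalerA mulrC.
Qed.

Lemma rcomp_linr m n i p (h : arity m n i p) k l (f : raw m) :
  linear (fun g : raw n => rcomp h k l f g).
Proof.
move=> c x y; apply: rawP => w u j; rewrite rcoD rcoZ !rcoC scaler_sumr -big_split.
apply: eq_bigr => v _ /=; rewrite !rcoD !rcoZ tcompDr tcompZr scalerDr.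
by rewrite !scalerA mulrC.
Qed.

Lemma inw_inw i j w : inw j (inw i w) = inw (i + j) w.
Proof. by apply: funext => x; rewrite /inw addnA. Qed.

(** Both sides sum over the letters produced by [b] and by [c]. Contracting nested blocks in either
    order gives the same words, and the exponents are equal, not only congruent. *)
Lemma rcomp_seq m n r i j mn nr p
    (h1 : arity m n i mn) (h2 : arity mn r (i + j) p)
    (h3 : arity n r j nr) (h4 : arity m nr i p) k l z kl lz
    (a : raw m) (b : raw n) (c : raw r) : kl = k + l -> lz = l + z ->
  rcomp h2 kl z (rcomp h1 k l a b) c = rcomp h4 k lz a (rcomp h3 l z b c).
Proof.
move=> e1 e3; apply: rawP => w u q; rewrite !rcoC.
under eq_bigr => v _ do rewrite rcoC tcomp_suml scaler_sumr.
under [RHS]eq_bigr => v _ do rewrite rcoC tcomp_sumr scaler_sumr.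
rewrite [RHS]exchange_big; apply: eq_bigr => v2 _; apply: eq_bigr => v1 _ /=.
rewrite tcompZl tcompZr !scalerA -!sgnD.
have E1 : outw n i (outw r (i + j) w v2) v1 = outw nr i w v1.
  apply: funext => x; rewrite /outw.
  have [xi|xi] := ltnP x i; first by rewrite ltn_addr.
  have [_|xi'] := eqVneq x i => //.
  by rewrite !ifF; first (congr w); move: h1 h2 h3 h4; rewrite /arity; lia.
have E2 : inw i (outw r (i + j) w v2) = outw r j (inw i w) v2.
  apply: funext => x; rewrite /outw /inw ltn_add2l eqn_add2l.
  case: ltnP => // jx; case: eqP => // xj; congr w; lia.
have E3 : inw j (inw i w) = inw (i + j) w by exact: inw_inw.
have D1 := wdeg_outw w v1 h4.
have D2 := wdeg_outw w v2 h2.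
have D3 := wdeg_outw (inw i w) v2 h3.
have D4 := wdeg_outw (outw r (i + j) w v2) v1 h1.
have P1 : wdeg (outw r (i + j) w v2) i = wdeg w i.
  by apply: wdeg_eq => x xi; rewrite /outw ltn_addr.
have P2 := wdeg_inw i w j.
rewrite E1 E2 E3 in D1 D2 D3 D4 *.
rewrite (tcomp_seq h1 h2 h3 h4 (lw := lz + wdeg (inw i w) nr - ldeg v1)); first last.
- rewrite e3 D3; ring.
- rewrite e1 D4 D2 D3; ring.
congr (sgn _ *: _).
rewrite /cexp E1 E2 E3 P1 P2 D2 D1 D3 e1; ring.
Qed.

Definition local n (f : raw n) : Prop :=
  forall v w u j, eqw n v w -> rco f v u j = rco f w u j.

(** Contracting the later block changes letters beyond the inputs of [b], so the words fed to [b] on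
    the two sides agree only on their first n letters; hence the locality of [b]. *)
Lemma rcomp_par m n r i j mn mr p (ij : (i < j)%N)
    (h1 : arity m n i mn) (h2 : arity mn r (j + n).-1 p)
    (h3 : arity m r j mr) (h4 : arity mr n i p) k l z kl kz
    (a : raw m) (b : raw n) (c : raw r) : kl = k + l -> kz = k + z -> local b ->
  rcomp h2 kl z (rcomp h1 k l a b) c =
  sgn (l * z) *: rcomp h4 kz l (rcomp h3 k z a c) b.
Proof.
move=> e1 e3 lb; apply: rawP => w u q; rewrite rcoZ !rcoC.
under eq_bigr => v _ do rewrite rcoC tcomp_suml scaler_sumr.
under [in RHS]eq_bigr => v _ do rewrite rcoC tcomp_suml scaler_sumr.
rewrite scaler_sumr [RHS](eq_bigr _ (fun _ _ => scaler_sumr _ _ _ _)).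
rewrite [RHS]exchange_big; apply: eq_bigr => v2 _; apply: eq_bigr => v1 _ /=.
set j' := (j + n).-1.
rewrite !tcompZl !scalerA -!sgnD.
have hj : (i + n <= j')%N by rewrite /j'; lia.
have E1 : outw n i (outw r j' w v2) v1 = outw r j (outw n i w v1) v2.
  apply: funext => x; rewrite /outw.
  have [xi|xi] := ltnP x i; first by rewrite !ifT //; lia.
  have [xi'|xi'] := eqVneq x i; first by rewrite ifT //; lia.
  have [xj|xj] := ltnP x j; first by rewrite ifT //; lia.
  have [xj'|xj'] := eqVneq x j.
    by rewrite ifF ?ifT //; lia.
  rewrite !ifF; try lia.
  by congr w; lia.
have E2 : eqw n (inw i (outw r j' w v2)) (inw i w).
  by move=> x xn; rewrite /inw /outw ifT //; lia.
have E3 : inw j (outw n i w v1) = inw j' w.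
  by apply: funext => x; rewrite /inw /outw !ifF; [congr w| |]; lia.
have D1 := wdeg_outw w v1 h4.
have D2 := wdeg_outw w v2 h2.
have D3 := wdeg_outw (outw n i w v1) v2 h3.
have P1 : wdeg (outw r j' w v2) i = wdeg w i.
  by apply: wdeg_eq => x xi; rewrite /outw ifT //; lia.
have P2 : wdeg w j' = wdeg (outw n i w v1) j + wdeg (inw i w) n - ldeg v1.
  have ha : arity j n i j' by rewrite /arity ij /j' prednK ?eqxx //; lia.
  rewrite (wdeg_outw w v1 ha); ring.
rewrite (lb _ _ _ _ E2) !(wdeg_eq E2) E1 E3 -/j' in D1 D2 D3 *.
rewrite (tcomp_par ij h1 h2 h3 h4
  (kw := kz + wdeg (outw n i w v1) mr - ldeg u)); first last.
- rewrite e3 D1 D3 D1; ring.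
- rewrite e1 D2 D3 D1; ring.
rewrite scalerA -sgnD; congr (_ *: _).
apply: (@sgn_mod2 _ _ _ (- (ldeg v1 - wdeg (inw i w) n) * z)).
rewrite /cexp -/j' E1 E3 P1 P2 (wdeg_eq E2) D2 D3 D1 e1 e3; ring.
Qed.

(** The differential d(E (x) c) = dE (x) c + (-1)^|E| E (x) dc of End(N) (x) O. The first summand is
    t -> h applied after E, the sum over i is E precomposed with t -> h at the i-th input. The sign
    -(-1)^|E| of the latter becomes the common sign, because changing that letter shifts |E| by
    one. *)
Definition rd n (f : raw n) : raw n := fun x => let: (w, u, j) := x in
  (if u == Lh then rco f w Lt j else 0) +
  sgn (ldeg u - wdeg w n) *:
    (\sum_(0 <= i < n)
       (if w i == Lt then sgn (wdeg w i) *: rco f (updw w i Lh) u j else 0) +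
     dgd (O n) (esym (subrK 1 j)) (rco f w u (j - 1))).

Lemma rcod n (f : raw n) w u j : rco (rd f) w u j =
  (if u == Lh then rco f w Lt j else 0) +
  sgn (ldeg u - wdeg w n) *:
    (\sum_(0 <= i < n)
       (if w i == Lt then sgn (wdeg w i) *: rco f (updw w i Lh) u j else 0) +
     dgd (O n) (esym (subrK 1 j)) (rco f w u (j - 1))).
Proof. by []. Qed.

Lemma rco_d n (f : raw n) w u j l (e : l = j + 1) :
  dgd (O n) (esym (subrK 1 l)) (rco f w u (l - 1)) = dgd (O n) e (rco f w u j).
Proof.
have E : l - 1 = j by rewrite e addrK.
move: (esym _); rewrite E => e'; congr dgd; exact: Prop_irrelevance.
Qed.

Lemma rd_linear n : linear (@rd n).
Proof.
move=> c x y; apply: rawP => w u j; rewrite rcoD rcoZ !rcod.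
set e := esym _; rewrite rcoD rcoZ (op_d_linear e) !scalerDr !scalerA.
rewrite [in X in _ = X](mulrC c) -!scalerA.
have -> : (if u == Lh then rco (c *: x + y) w Lt j else 0) =
   c *: (if u == Lh then rco x w Lt j else 0) + (if u == Lh then rco y w Lt j else 0).
  by case: ifP => _; rewrite ?scaler0 ?addr0 // rcoD rcoZ.
have -> : \sum_(0 <= i < n) (if w i == Lt then
       sgn (wdeg w i) *: rco (c *: x + y) (updw w i Lh) u j else 0) =
  c *: \sum_(0 <= i < n) (if w i == Lt then
       sgn (wdeg w i) *: rco x (updw w i Lh) u j else 0) +
  \sum_(0 <= i < n) (if w i == Lt then
       sgn (wdeg w i) *: rco y (updw w i Lh) u j else 0).
  rewrite scaler_sumr -big_split; apply: eq_bigr => a _ /=.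
  case: ifP => _; rewrite ?scaler0 ?addr0 //.
  by rewrite rcoD rcoZ scalerDr !scalerA mulrC.
rewrite (scalerDr (sgn _) (c *: _)) [X in _ + X = _]addrACA.
by rewrite [LHS]addrACA.
Qed.

Lemma rcomp_d m n i p (h : arity m n i p) k l (f : raw m) (g : raw n) :
  local g ->
  rd (rcomp h k l f g) =
  rcomp h (k + 1) l (rd f) g + sgn k *: rcomp h k (l + 1) f (rd g).
Proof.
move=> lg; apply: rawP => w u j; rewrite rcoD rcoZ !rcoC rcod.
have im : (i < m)%N by case/andP: h.
pose al v := k + wdeg (outw n i w v) m - ldeg u.
pose be v := l + wdeg (inw i w) n - ldeg v.
pose s0 := ldeg u - wdeg w p.
(* [A] has the differential of N at the output, [P] at an input outside the block (place I in [w],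
   place I' in the contracted word), [Q] at an input inside the block; [D] has the differential of
   O. *)
pose A v := if u == Lh then sgn (cexp k m n i w Lt v) *:
   tcomp h j (rco f (outw n i w v) Lt (k + wdeg (outw n i w v) m - 0))
             (rco g (inw i w) v (be v)) else 0.
pose P v I I' := if w I == Lt then
   sgn (s0 + wdeg w I + cexp k m n i (updw w I Lh) u v) *:
   tcomp h j (rco f (updw (outw n i w v) I' Lh) u (al v + 1))
             (rco g (inw i w) v (be v)) else 0.
pose Q v J := if w (i + J)%N == Lt then
   sgn (s0 + wdeg w (i + J)%N + cexp k m n i (updw w (i + J)%N Lh) u v) *:
   tcomp h j (rco f (outw n i w v) u (al v))
             (rco g (updw (inw i w) J Lh) v (be v + 1)) else 0.
pose D v := sgn (s0 + cexp k m n i w u v) *: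
   (tcomp h j (dgd (O m) (erefl _) (rco f (outw n i w v) u (al v)))
              (rco g (inw i w) v (be v)) +
    sgn (al v) *: tcomp h j (rco f (outw n i w v) u (al v))
              (dgd (O n) (erefl _) (rco g (inw i w) v (be v)))).
transitivity (\sum_v (A v + (\sum_(0 <= I < i) P v I I +
   \sum_(0 <= J < n) Q v J + \sum_(i.+1 <= I < m) P v (I + n).-1 I + D v))).
  rewrite big_split /= big_split /=; congr (_ + _).
    by rewrite /A; case: eqP => // _; rewrite big1.
  rewrite scalerDr; congr (_ + _); last first.
    rewrite (linear_fun_sum (op_d_linear _)) scaler_sumr; apply: eq_bigr => v _.
    rewrite (linear_funZ (op_d_linear _)) scalerA -sgnD -/(al v) -/(be v).
    by rewrite (tcomp_d _ (erefl (al v + 1)) (erefl (be v + 1))).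
  rewrite (sum_block _ h) 2!big_split /= !scalerDr.
  congr (_ + _ + _); rewrite scaler_sumr exchange_big /=; apply: eq_big_nat => I HI.
  - rewrite /P; case: eqP => wI; last by rewrite scaler0 big1.
    rewrite scaler_sumr scaler_sumr; apply: eq_bigr => v _.
    rewrite !scalerA -!sgnD; congr (_ *: _).
    have E1 : outw n i (updw w I Lh) v = updw (outw n i w v) I Lh.
      by apply: funext => x; rewrite /updw /outw; do !case: ifP => //; lia.
    have E2 : inw i (updw w I Lh) = inw i w.
      by apply: funext => x; rewrite /updw /inw; do !case: ifP => //; lia.
    rewrite E1 E2 wdeg_updw; last lia.
    have -> : outw n i w v I = Lt by rewrite /outw ifT //; lia.
    have -> // : k + (wdeg (outw n i w v) m - ldeg Lt + ldeg Lh) - ldeg u = al v + 1.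
    by rewrite /al /ldeg; ring.
  - rewrite /Q; case: eqP => wI; last by rewrite scaler0 big1.
    rewrite scaler_sumr scaler_sumr; apply: eq_bigr => v _.
    rewrite !scalerA -!sgnD; congr (_ *: _).
    have E1 : outw n i (updw w (i + I) Lh) v = outw n i w v.
      by apply: funext => x; rewrite /updw /outw; do !case: ifP => //; lia.
    have E2 : inw i (updw w (i + I) Lh) = updw (inw i w) I Lh.
      by apply: funext => x; rewrite /updw /inw eqn_add2l.
    rewrite E1 E2 wdeg_updw; last lia.
    have -> : inw i w I = Lt by [].
    have -> // : l + (wdeg (inw i w) n - ldeg Lt + ldeg Lh) - ldeg v = be v + 1.
    by rewrite /be /ldeg; ring.
  - rewrite /P; case: eqP => wI; last by rewrite scaler0 big1.
    rewrite scaler_sumr scaler_sumr; apply: eq_bigr => v _.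
    rewrite !scalerA -!sgnD; congr (_ *: _).
    have E1 : outw n i (updw w (I + n).-1 Lh) v = updw (outw n i w v) I Lh.
      by apply: funext => x; rewrite /updw /outw; do !case: ifP => //; lia.
    have E2 : eqw n (inw i (updw w (I + n).-1 Lh)) (inw i w).
      by move=> x xn; rewrite /updw /inw; do !case: ifP => //; lia.
    rewrite E1 (lg _ _ _ _ E2) (wdeg_eq E2) wdeg_updw; last lia.
    have -> : outw n i w v I = Lt by rewrite /outw !ifF //; lia.
    have -> // : k + (wdeg (outw n i w v) m - ldeg Lt + ldeg Lh) - ldeg u = al v + 1.
    by rewrite /al /ldeg; ring.
(* The letter joining [f] and [g] is hit from both sides: as an input of [f] when v = t ([X]), and
   as the output of [g] when v = h ([Y]). Both pair [f] with the joining letter h and [g] with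
   output t, with opposite signs, so together they may be added to the left side. *)
pose X v := if v == Lt then
   sgn (cexp (k + 1) m n i w u v + (ldeg u - wdeg (outw n i w v) m) + wdeg w i) *:
   tcomp h j (rco f (updw (outw n i w v) i Lh) u (al v + 1))
             (rco g (inw i w) v (be v)) else 0.
pose Y v := if v == Lh then
   sgn (k + cexp k m n i w u v) *:
   tcomp h j (rco f (outw n i w v) u (al v))
             (rco g (inw i w) Lt (l + 1 + wdeg (inw i w) n - ldeg v)) else 0.
have XY : \sum_v X v + \sum_v Y v = 0.
  rewrite !sum_letter /X /Y /= !addr0 !add0r /al /be.
  have -> : updw (outw n i w Lt) i Lh = outw n i w Lh.
    by apply: funext => x; rewrite /updw /outw; do !case: ifP => //; lia.
  rewrite !(wdeg_outw w _ h) /=.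
  have -> : k + (wdeg w p - wdeg (inw i w) n + 0) - ldeg u + 1 =
    k + (wdeg w p - wdeg (inw i w) n + 1) - ldeg u by ring.
  have -> : l + 1 + wdeg (inw i w) n - 1 = l + wdeg (inw i w) n - 0 by ring.
  apply/eqP; rewrite addr_eq0 -scaleNr; apply/eqP; congr (_ *: _).
  apply: (@sgnS _ _ _ (ldeg u - (wdeg w p - wdeg (inw i w) n) - k - 1)).
  rewrite /cexp !(wdeg_outw w _ h) /=; ring.
transitivity (\sum_v (A v + (\sum_(0 <= I < i) P v I I +
   X v + \sum_(i.+1 <= I < m) P v (I + n).-1 I) +
   sgn (s0 + cexp k m n i w u v) *:
   (tcomp h j (dgd (O m) (erefl _) (rco f (outw n i w v) u (al v)))
              (rco g (inw i w) v (be v)))) +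
  \sum_v (Y v + (\sum_(0 <= J < n) Q v J +
    sgn (s0 + cexp k m n i w u v) *:
    (sgn (al v) *: tcomp h j (rco f (outw n i w v) u (al v))
              (dgd (O n) (erefl _) (rco g (inw i w) v (be v))))))).
  rewrite !big_split /=.
  have -> : \sum_v D v = \sum_v sgn (s0 + cexp k m n i w u v) *:
       tcomp h j (dgd (O m) (erefl _) (rco f (outw n i w v) u (al v)))
              (rco g (inw i w) v (be v)) +
    \sum_v sgn (s0 + cexp k m n i w u v) *:
    (sgn (al v) *: tcomp h j (rco f (outw n i w v) u (al v))
              (dgd (O n) (erefl _) (rco g (inw i w) v (be v)))).
    by rewrite -big_split; apply: eq_bigr => v _; rewrite /D /= scalerDr.
  by rewrite -[LHS]add0r -[X in X + _ = _]XY; zac.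
congr (_ + _).
  apply: eq_bigr => v _; rewrite rcod.
  rewrite tcompDl tcompZl tcompDl (sum_pluck _ im) !tcompDl !scalerDr !addrA.
  have EL : k + 1 + wdeg (outw n i w v) m - ldeg u = al v + 1 by rewrite /al; ring.
  have Dw := wdeg_outw w v h.
  rewrite EL (rco_d _ _ _ (erefl (al v + 1))) -/(be v) !scalerA -!sgnD.
  congr (_ + _ + _ + _ + _).
  - rewrite /A /al; case: eqP => [->|_]; last by rewrite tcomp0l scaler0.
    have -> : k + wdeg (outw n i w v) m - ldeg Lh + 1 =
      k + wdeg (outw n i w v) m - 0 by rewrite /=; ring.
    congr (sgn _ *: _); rewrite /cexp /=; ring.
  - rewrite tcomp_suml scaler_sumr; apply: eq_big_nat => I HI.
    have -> : outw n i w v I = w I by rewrite /outw ifT //; lia.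
    rewrite /P; case: eqP => wI; last by rewrite tcomp0l scaler0.
    rewrite tcompZl scalerA -sgnD; congr (_ *: _).  
    have E1 : outw n i (updw w I Lh) v = updw (outw n i w v) I Lh.
      by apply: funext => x; rewrite /updw /outw; do !case: ifP => //; lia.
    have E2 : inw i (updw w I Lh) = inw i w.
      by apply: funext => x; rewrite /updw /inw; do !case: ifP => //; lia.
    have E3 : outw n i w v I = Lt by rewrite /outw ifT //; lia.
    have E4 : wdeg (outw n i w v) I = wdeg w I.
      by apply: wdeg_eq => x xI; rewrite /outw ifT //; lia.
    apply: (@sgn_mod2 _ _ _ (ldeg v - wdeg (inw i w) n)).
    rewrite /cexp /s0 E1 E2 E4 (wdeg_updw (outw n i w v)); last lia.
    rewrite (wdeg_updw w); last lia.
    rewrite E3 wI Dw /=; ring.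
  - rewrite /X /outw ltnn eqxx; case: eqP => vt; last by rewrite tcomp0l scaler0.
    rewrite tcompZl scalerA -sgnD; congr (sgn (_ + _) *: _).
    by apply: wdeg_eq => x xi; rewrite ifT.
  - rewrite tcomp_suml scaler_sumr; apply: eq_big_nat => I HI.
    have E3 : outw n i w v I = w (I + n).-1 by rewrite /outw !ifF //; lia.
    rewrite E3 /P; case: eqP => wI; last by rewrite tcomp0l scaler0.
    rewrite tcompZl scalerA -sgnD; congr (sgn _ *: _).
    have E1 : outw n i (updw w (I + n).-1 Lh) v = updw (outw n i w v) I Lh.
      by apply: funext => x; rewrite /updw /outw; do !case: ifP => //; lia.
    have E2 : eqw n (inw i (updw w (I + n).-1 Lh)) (inw i w).
      by move=> x xn; rewrite /updw /inw; do !case: ifP => //; lia.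
    have ha : arity I n i (I + n).-1 by rewrite /arity; lia.
    have E4 := wdeg_outw w v ha.
    rewrite /cexp /s0 E1 (wdeg_eq E2) E4 (wdeg_updw (outw n i w v)); last lia.
    rewrite wdeg_updw_pre; last lia.
    rewrite E3 wI Dw /=; ring.
  - congr (sgn _ *: _).
    rewrite /cexp /s0 Dw; ring.
rewrite scaler_sumr; apply: eq_bigr => v _; rewrite rcod.
have Dw := wdeg_outw w v h.
have EL : l + 1 + wdeg (inw i w) n - ldeg v = be v + 1 by rewrite /be; ring.
rewrite EL (rco_d _ _ _ (erefl (be v + 1))) -/(al v).
rewrite tcompDr tcompZr tcompDr !scalerDr !scalerA -!sgnD.
congr (_ + (_ + _)).
- rewrite /Y; case: eqP => [vh|_]; last by rewrite tcomp0r scaler0.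
  by rewrite EL.
- rewrite tcomp_sumr scaler_sumr; apply: eq_big_nat => J HJ.
  rewrite /Q /inw; case: eqP => wI; last by rewrite tcomp0r scaler0.
  rewrite tcompZr scalerA -sgnD; congr (_ *: _).
  have E1 : outw n i (updw w (i + J) Lh) v = outw n i w v.
    by apply: funext => x; rewrite /updw /outw; do !case: ifP => //; lia.
  have E2 : inw i (updw w (i + J) Lh) = updw (inw i w) J Lh.
    by apply: funext => x; rewrite /updw /inw eqn_add2l.
  apply: (@sgn_mod2 _ _ _ (ldeg u - k - wdeg (outw n i w v) m)).
  rewrite /cexp /s0 E1 E2 (wdeg_inw i w J) (wdeg_updw (inw i w)); last lia.
  rewrite wdeg_updw_pre ?leq_addr // Dw.
  have -> : inw i w J = Lt by [].
  rewrite -/(inw i w) /=; ring.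
- congr (sgn _ *: _); rewrite /cexp /s0 /al Dw; ring.
Qed.

End Raw.

(** * Koszul signs of permutations *)

Section Koszul.

Definition pn n (s : 'S_n) (x : nat) : nat :=
  if insub x is Some i then s i : nat else x.

Lemma pn_ord n (s : 'S_n) (i : 'I_n) : pn s i = s i.
Proof. by rewrite /pn valK. Qed.

Lemma pn_lt n (s : 'S_n) x : (x < n)%N -> (pn s x < n)%N.
Proof. by move=> xn; rewrite /pn insubT. Qed.

Lemma pn_ge n (s : 'S_n) x : (n <= x)%N -> pn s x = x.
Proof. by move=> xn; rewrite /pn insubN // -leqNgt. Qed.

Lemma pn_inj n (s : 'S_n) x y : (x < n)%N -> (y < n)%N ->
  pn s x = pn s y -> x = y.
Proof.
move=> xn yn; rewrite -[x]/(val (Ordinal xn)) -[y]/(val (Ordinal yn)) !pn_ord.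
by move=> /val_inj /perm_inj ->.
Qed.

Lemma pn1 n x : pn (1%g : 'S_n) x = x.
Proof. by rewrite /pn; case: insubP => // i _ <-; rewrite perm1. Qed.

Lemma pnM n (s t : 'S_n) x : pn (s * t)%g x = pn t (pn s x).
Proof.
rewrite /pn; case: insubP => [i _ _|xn]; first by rewrite permM valK.
by rewrite insubN.
Qed.

Lemma sum_pn (V : nmodType) n (s : 'S_n) (F : nat -> V) :
  \sum_(0 <= x < n) F (pn s x) = \sum_(0 <= x < n) F x.
Proof.
rewrite !big_mkord [RHS](reindex_inj (@perm_inj _ s)) /=.
by apply: eq_bigr => i _; rewrite pn_ord.
Qed.

Lemma sum_neq (V : nmodType) m i (F : nat -> V) : (i < m)%N ->
  \sum_(0 <= j < m) F j = F i + \sum_(0 <= j < m | j != i) F j.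
Proof. by move=> im; rewrite (bigD1_seq i) ?mem_index_iota ?iota_uniq. Qed.

Definition outi (n i j : nat) : nat := if (j < i)%N then j else (j + n).-1.

Lemma sum_block_neq (V : nmodType) (F : nat -> V) m n i p : arity m n i p ->
  \sum_(0 <= j < p) F j =
  \sum_(0 <= j < n) F (i + j)%N + \sum_(0 <= j < m | j != i) F (outi n i j).
Proof.
move=> h; have im : (i < m)%N by case/andP: h.
rewrite (sum_block _ h) [X in _ = _ + X]big_mkcond /= (sum_pluck _ im) eqxx /= addr0.
rewrite [X in X + _ = _]addrC -addrA; congr (_ + (_ + _)); apply: eq_big_nat => j Hj.
  by rewrite /outi; have -> : (j < i)%N by []; have -> : j != i by lia.
have -> : j != i by lia.
by rewrite /outi ifF //; lia.
Qed.

(* The exponent of the Koszul sign of [act_perm]. *)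
Definition kos n (s : 'S_n) (a : nat -> int) : int :=
  \sum_(0 <= x < n) \sum_(0 <= y < n)
    (if (x < y)%N && (pn s y < pn s x)%N then a (pn s x) * a (pn s y) else 0).

Lemma kos_eq n (s : 'S_n) a b : (forall x, (x < n)%N -> a x = b x) ->
  kos s a = kos s b.
Proof.
move=> ab; apply: eq_big_nat => x /andP[_ xn]; apply: eq_big_nat => y /andP[_ yn].
by rewrite !ab ?pn_lt.
Qed.

Lemma kos1 n a : kos (1%g : 'S_n) a = 0.
Proof.
rewrite /kos big1 // => x _; rewrite big1 // => y _; rewrite !pn1.
by case: ifP => //; lia.
Qed.

Variable R : comPzRingType.

(** The inversions of s * t are those of [s] together with those of [t] transported along [s],
    except that a pair inverted by [s] and put back by [t] is counted twice on the right, an even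
    contribution. *)
Lemma kosM n (s t : 'S_n) a :
  sgn (kos (s * t)%g a) = sgn (kos t a + kos s (fun x => a (pn t x))) :> R.
Proof.
pose c x y := a (pn t (pn s x)) * a (pn t (pn s y)).
pose p x y := (pn s y < pn s x)%N.
pose q x y := (pn t (pn s y) < pn t (pn s x))%N.
have E1 : kos (s * t)%g a = \sum_(0 <= x < n) \sum_(0 <= y < n)
    (if (x < y)%N && q x y then c x y else 0).
  by apply: eq_big_nat => x _; apply: eq_big_nat => y _; rewrite !pnM.
have E2 : kos t a = \sum_(0 <= x < n) \sum_(0 <= y < n)
    (if (x < y)%N && ~~ p x y && q x y then c x y else 0) +
   \sum_(0 <= x < n) \sum_(0 <= y < n)
    (if (x < y)%N && p x y && ~~ q x y then c x y else 0).
  rewrite /kos -(sum_pn s).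
  rewrite (eq_big_nat _ _ (F2 := fun x => \sum_(0 <= y < n)
     (if p y x && q x y then c x y else 0))); last first.
    by move=> x _; rewrite -(sum_pn s).
  transitivity (\sum_(0 <= x < n) \sum_(0 <= y < n)
    (if (x < y)%N && ~~ p x y && q x y then c x y else 0) +
   \sum_(0 <= x < n) \sum_(0 <= y < n)
    (if (y < x)%N && p y x && ~~ q y x then c y x else 0)); last first.
    by congr (_ + _); rewrite exchange_big.
  rewrite -big_split /=; apply: eq_big_nat => x /andP[_ xn].
  rewrite -big_split /=; apply: eq_big_nat => y /andP[_ yn].
  have [xy|xy|xy] := ltngtP x y.
  - rewrite addr0 /p /q /=; have : pn s x <> pn s y by move/(pn_inj xn yn); lia.
    by move=> ne; rewrite -leqNgt ltn_neqAle; move/eqP: ne => ->.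
  - have ne : pn s x <> pn s y by move/(pn_inj xn yn); lia.
    have ne' : pn t (pn s x) <> pn t (pn s y).
      by move=> E; apply: ne; apply: (pn_inj _ _ E); apply: pn_lt.
    rewrite add0r /p /q /= -leqNgt (leq_eqVlt (pn t (pn s y))).
    by move/eqP: ne'; rewrite eq_sym => /negbTE ->; rewrite /c mulrC.
  - by rewrite /p xy ltnn addr0.
have E3 : kos s (fun x => a (pn t x)) = \sum_(0 <= x < n) \sum_(0 <= y < n)
    (if (x < y)%N && p x y then c x y else 0) by [].
symmetry; apply: (@sgn_mod2 _ _ _ (\sum_(0 <= x < n) \sum_(0 <= y < n)
    (if (x < y)%N && p x y && ~~ q x y then c x y else 0))).
rewrite E1 E2 E3 mulr2n -!big_split /=.
apply: eq_big_nat => x _; rewrite -!big_split /=; apply: eq_big_nat => y _.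
by case: (x < y)%N; case: (p x y); case: (q x y) => /=; ring.
Qed.

Definition updi (a : nat -> int) (i : nat) (v : int) : nat -> int :=
  fun j => if j == i then v else a j.

(** The exponent is affine in the degree at one place. The slope adds the degrees of the letters
    crossing that place from either side; modulo 2 this is the difference of the two prefix sums. *)
Lemma kos_upd n (s : 'S_n) a i v v' : (i < n)%N ->
  sgn (kos s (updi a (pn s i) v)) =
  sgn (kos s (updi a (pn s i) v') +
       (v - v') * (pre a (pn s i) - pre (fun x => a (pn s x)) i)) :> R.
Proof.
move=> ni.
pose X1 := \sum_(0 <= j < n | j != i)
  (if (i < j)%N && (pn s j < pn s i)%N then a (pn s j) else 0).
pose X2 := \sum_(0 <= j < n | j != i)
  (if (j < i)%N && (pn s i < pn s j)%N then a (pn s j) else 0).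
pose C := \sum_(0 <= x < n | x != i) \sum_(0 <= y < n | y != i)
    (if (x < y)%N && (pn s y < pn s x)%N then a (pn s x) * a (pn s y) else 0).
have ne j : (j < n)%N -> j != i -> (pn s j == pn s i) = false.
  by move=> jn; apply: contraNF => /eqP /(pn_inj jn ni) ->.
have E z : kos s (updi a (pn s i) z) = C + z * (X1 + X2).
  rewrite /kos (sum_neq _ ni) (sum_neq _ ni) ltnn /= add0r.
  rewrite mulrDr [RHS]addrCA; congr (_ + _).
    rewrite /X1 mulr_sumr [LHS]big_nat_cond [RHS]big_nat_cond.
    apply: eq_bigr => y /andP[/andP[_ yn] yi].
    by rewrite /updi eqxx ne //; case: ifP => _; ring.
  rewrite /X2 /C mulr_sumr -big_split /= [LHS]big_nat_cond [RHS]big_nat_cond.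
  apply: eq_bigr => x /andP[/andP[_ xn] xi].
  rewrite (sum_neq _ ni) addrC; congr (_ + _); last first.
    by rewrite /updi eqxx ne //; case: ifP => _; ring.
  rewrite [LHS]big_nat_cond [RHS]big_nat_cond.
  apply: eq_bigr => y /andP[/andP[_ yn] yi].
  by rewrite /updi !ne.
have P1 : pre a (pn s i) = \sum_(0 <= j < n | j != i)
    (if (pn s j < pn s i)%N then a (pn s j) else 0).
  rewrite /pre; have le : (pn s i <= n)%N by exact/ltnW/pn_lt.
  transitivity (\sum_(0 <= y < n) (if (y < pn s i)%N then a y else 0)).
    rewrite (@big_cat_nat _ _ _ (pn s i) 0 n) //= [X in _ = _ + X]big_nat_cond.
    rewrite [X in _ = _ + X]big1 ?addr0; last by move=> y; case: ifP => //; lia.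
    by apply: eq_big_nat => y /andP[_ ->].
  by rewrite -(sum_pn s) (sum_neq _ ni) ltnn add0r.
have P2 : pre (fun x => a (pn s x)) i = \sum_(0 <= j < n | j != i)
    (if (j < i)%N then a (pn s j) else 0).
  rewrite /pre; transitivity (\sum_(0 <= y < n) (if (y < i)%N then a (pn s y) else 0)).
    rewrite (@big_cat_nat _ _ _ i 0 n) //=; last exact: ltnW.
    rewrite [X in _ = _ + X]big_nat_cond.
    rewrite [X in _ = _ + X]big1 ?addr0; last by move=> y; case: ifP => //; lia.
    by apply: eq_big_nat => y /andP[_ ->].
  by rewrite (sum_neq _ ni) ltnn add0r.
have P : pre a (pn s i) = pre (fun x => a (pn s x)) i + X1 - X2.
  apply/eqP; rewrite eq_sym subr_eq eq_sym; apply/eqP.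
  rewrite P1 P2 /X1 /X2 -!big_split /= [LHS]big_nat_cond [RHS]big_nat_cond.
  apply: eq_bigr => j /andP[/andP[_ jn] ji].
  have := ne _ jn ji.
  by have [ij|ij|ij] := ltngtP i j; have [pp|pp|pp] := ltngtP (pn s i) (pn s j) => //= _;
     rewrite ?addr0 ?add0r //; lia.
apply: (@sgn_mod2 _ _ _ ((v - v') * X2)).
rewrite !E P; ring.
Qed.

Definition inwt (i : nat) (a : nat -> int) : nat -> int := fun j => a (i + j)%N.

Definition outwt (n i : nat) (a : nat -> int) (v : int) : nat -> int :=
  fun j => if (j < i)%N then a j else if j == i then v else a (j + n).-1.

(** The inner block is reordered by [t], and [s] moves it as a single letter whose degree is the
    total degree of the block. *)
Lemma kos_block m n p i (s : 'S_m) (t : 'S_n) (r : 'S_p) a :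
  arity m n i p ->
  (forall j, (j < n)%N -> pn r (i + j) = (pn s i + pn t j)%N) ->
  (forall j, (j < m)%N -> j != i -> pn r (outi n i j) = outi n (pn s i) (pn s j)) ->
  kos r a = kos t (inwt (pn s i) a) +
            kos s (outwt n (pn s i) a (pre (inwt (pn s i) a) n)).
Proof.
move=> h r1 r2; have im : (i < m)%N by case/andP: h.
set b := pre _ n; set a' := outwt _ _ _ _; set a1 := inwt _ _.
have ne j : (j < m)%N -> j != i -> (pn s j == pn s i) = false.
  by move=> jn; apply: contraNF => /eqP /(pn_inj jn im) ->.
have a'E j : (j < m)%N -> j != i -> a' (pn s j) = a (outi n (pn s i) (pn s j)).
  by move=> jm ji; rewrite /a' /outwt /outi ne //; case: ifP.
have ooE j x : (j != i) -> (x < n)%N -> ((outi n i j < i + x)%N = (j < i)%N) *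
    ((i + x < outi n i j)%N = (i < j)%N).
  by move=> ji xn; rewrite /outi; split; case: ifP; lia.
have ooE' j x : (j < m)%N -> (j != i) -> (x < n)%N ->
    ((outi n (pn s i) (pn s j) < pn s i + x)%N = (pn s j < pn s i)%N) *
    ((pn s i + x < outi n (pn s i) (pn s j))%N = (pn s i < pn s j)%N).
  by move=> jm ji xn; have := ne _ jm ji; rewrite /outi; split; case: ifP; lia.
rewrite /kos (sum_block_neq _ h).
rewrite (eq_big_nat _ _ (F2 := fun x => \sum_(0 <= y < n)
   (if (x < y)%N && (pn t y < pn t x)%N then a1 (pn t x) * a1 (pn t y) else 0) +
   \sum_(0 <= y < m | y != i) (if (i < y)%N && (pn s y < pn s i)%N
     then a1 (pn t x) * a' (pn s y) else 0))); last first.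
  move=> x /andP[_ xn]; rewrite (sum_block_neq _ h); congr (_ + _).
    by apply: eq_big_nat => y /andP[_ yn]; rewrite !r1 // !ltn_add2l.
  rewrite [LHS]big_nat_cond [RHS]big_nat_cond.
  apply: eq_bigr => y /andP[/andP[_ yn] yi].
  by rewrite r1 // r2 // ooE // ooE' ?pn_lt // a'E.
rewrite big_split /= -addrA; congr (_ + _).
rewrite (sum_neq _ im) (sum_neq _ im) ltnn /= add0r; congr (_ + _).
  rewrite exchange_big /=; apply: eq_bigr => y yi.
  case: ifP => _; last by rewrite big1.
  rewrite -mulr_suml; congr (_ * _).
  by rewrite /a' /outwt ltnn eqxx /b /pre -[RHS](sum_pn t).
rewrite [LHS]big_nat_cond [RHS]big_nat_cond.
apply: eq_bigr => x /andP[/andP[_ xn] xi].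
rewrite (sum_block_neq _ h) (sum_neq _ im); congr (_ + _).
  rewrite (eq_big_nat _ _ (F2 := fun y => if (x < i)%N && (pn s i < pn s x)%N
    then a' (pn s x) * a1 (pn t y) else 0)); last first.
    move=> y /andP[_ yn]; rewrite r1 // r2 // ooE // ooE' ?pn_lt // -a'E //.
  case: ifP => _; last by rewrite big1.
  rewrite -mulr_sumr; congr (_ * _).
  by rewrite /a' /outwt ltnn eqxx /b /pre -[RHS](sum_pn t).
rewrite [LHS]big_nat_cond [RHS]big_nat_cond.
apply: eq_bigr => y /andP[/andP[_ yn] yi].
rewrite !r2 // -!a'E //.
have -> : (outi n i x < outi n i y)%N = (x < y)%N.
  by rewrite /outi; do !case: ifP; lia.
have -> // : (outi n (pn s i) (pn s y) < outi n (pn s i) (pn s x))%N = (pn s y < pn s x)%N.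
by have := ne _ xn xi; have := ne _ yn yi; rewrite /outi; do !case: ifP; lia.
Qed.

End Koszul.

(** * Symmetric group action, unit and d d = 0 for raw operations *)

Section RawAct.
Variables (R : comPzRingType) (O : operad R).

Definition pw n (s : 'S_n) (w : word) : word := fun x => w (pn s x).
Definition ldegw (w : word) : nat -> int := fun x => ldeg (w x).

Definition ract n (s : 'S_n) (f : raw O n) : raw O n := fun x =>
  let: (w, u, j) := x in
  sgn (kos s (ldegw w)) *: op_act O s (rco f (pw s w) u j).

Lemma rcoA n (s : 'S_n) (f : raw O n) w u j :
  rco (ract s f) w u j = sgn (kos s (ldegw w)) *: op_act O s (rco f (pw s w) u j).
Proof. by []. Qed.

Lemma op_act_linear n (s : 'S_n) k : linear (@op_act _ O n s k).
Proof. exact: (@op_act_chain _ O _ s).1. Qed.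

Arguments op_act_linear {n} s {k}.

Lemma wdeg_pw n (s : 'S_n) w : wdeg (pw s w) n = wdeg w n.
Proof. exact: (sum_pn s (ldegw w)). Qed.

Lemma ract_linear n (s : 'S_n) : linear (ract s).
Proof.
move=> c x y; apply: rawP => w u j; rewrite rcoD rcoZ !rcoA rcoD rcoZ.
by rewrite (op_act_linear s) scalerDr !scalerA mulrC.
Qed.

Lemma ract1 n (f : raw O n) : ract 1%g f = f.
Proof.
apply: rawP => w u j; rewrite rcoA kos1 sgn0 scale1r op_act1.
have -> // : pw (1%g : 'S_n) w = w by apply: funext => x; rewrite /pw pn1.
Qed.

Lemma ractM n (s t : 'S_n) (f : raw O n) : ract (s * t)%g f = ract t (ract s f).
Proof.
apply: rawP => w u j; rewrite !rcoA (linear_funZ (op_act_linear _)) scalerA -sgnD.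
rewrite kosM op_actM.
have -> // : pw (s * t)%g w = pw s (pw t w).
by apply: funext => x; rewrite /pw pnM.
Qed.

Lemma ract_d n (s : 'S_n) (f : raw O n) : ract s (rd f) = rd (ract s f).
Proof.
apply: rawP => w u j; rewrite rcod !rcoA rcod.
rewrite (linear_funD (op_act_linear s)) (linear_funZ (op_act_linear s)).
rewrite (linear_funD (op_act_linear s)) (linear_fun_sum (op_act_linear s)).
rewrite (@op_act_chain _ O _ s).2 scalerDr wdeg_pw; congr (_ + _).
  by case: ifP => _ //; rewrite (linear_fun0 (op_act_linear s)) scaler0.
rewrite scalerA mulrC -scalerA; congr (_ *: _).
rewrite scalerDr (linear_funZ (op_d_linear _)); congr (_ + _).
rewrite -[RHS](sum_pn s) scaler_sumr; apply: eq_big_nat => i /andP[_ ni].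
rewrite /pw; case: eqP => wi; last by rewrite (linear_fun0 (op_act_linear s)) scaler0.
rewrite (linear_funZ (op_act_linear s)) rcoA !scalerA -!sgnD.
have E : pw s (updw w (pn s i) Lh) = updw (pw s w) i Lh.
  apply: funext => x; rewrite /pw /updw.
  have [->|xi] := eqVneq x i; first by rewrite eqxx.
  have [xn|xn] := ltnP x n.
    by rewrite ifF //; apply: contra_neqF xi => /eqP /(pn_inj xn ni).
  by rewrite pn_ge // !ifF //; have := pn_lt s ni; lia.
rewrite E; congr (_ *: _).
have E1 : ldegw (updw w (pn s i) Lh) = updi (ldegw w) (pn s i) 1.
  by apply: funext => x; rewrite /ldegw /updw /updi; case: eqP.
have E2 : ldegw w = updi (ldegw w) (pn s i) 0.
  by apply: funext => x; rewrite /ldegw /updi; case: eqP => // ->; rewrite wi.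
rewrite E1 [in LHS]E2 [RHS]sgnD (kos_upd _ s _ 1 0 ni) -sgnD.
apply: (@sgn_mod2 _ _ _ (wdeg (pw s w) i - wdeg w (pn s i))).
rewrite /pre /wdeg /ldegw /pw; ring.
Qed.

(** [kos_block] treats the block as a letter of degree |inw|, whereas the left side permutes the
    letter v to which it is contracted. [kos_upd] converts one into the other, and the difference of
    prefix sums it produces is the change of [cexp] under the permutation. *)
Lemma rcomp_act m n p (i : 'I_m) (s : 'S_m) (t : 'S_n) (r : 'S_p)
    (h : arity m n i p) (h' : arity m n (s i) p) k l (a : raw O m) (b : raw O n) :
  local a -> local b ->
  (forall (j : 'I_n) (u : 'I_p), u = (i + j)%N :> nat ->
     r u = (s i + t j)%N :> nat) ->
  (forall (j : 'I_m) (u : 'I_p), j != i -> outer n i j u ->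
     outer n (s i) (s j) (r u)) ->
  rcomp h' k l (ract s a) (ract t b) = ract r (rcomp h k l a b).
Proof.
move=> la lb H1 H2; apply: rawP => w u j; rewrite rcoC rcoA rcoC.
rewrite (linear_fun_sum (op_act_linear r)) scaler_sumr; apply: eq_bigr => v _.
rewrite (linear_funZ (op_act_linear r)) !rcoA tcompZl tcompZr !scalerA -!sgnD.
have [im pmn] := andP h; move/eqP: pmn => pmn.
have r1 x : (x < n)%N -> pn r (i + x) = (pn s i + pn t x)%N.
  move=> xn; have ixp : (i + x < p)%N by lia.
  rewrite -[x]/(val (Ordinal xn)) -[(i + _)%N]/(val (Ordinal ixp)) !pn_ord.
  exact: H1.
have r2 x : (x < m)%N -> x != i -> pn r (outi n i x) = outi n (pn s i) (pn s x).
  move=> xm xi; have op : (outi n i x < p)%N.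
    by move: (ltn_ord i); rewrite /outi; case: ifP; lia.
  have := H2 (Ordinal xm) (Ordinal op) xi.
  rewrite -[x]/(val (Ordinal xm)) -[outi n i _]/(val (Ordinal op)) !pn_ord.
  have nsi : s (Ordinal xm) != s i.
    by apply: contra_neq xi => /perm_inj <-.
  have {}nsi : s (Ordinal xm) != s i :> nat by [].
  move: (r (Ordinal op)) (s (Ordinal xm)) nsi => A B nsi /=.
  have -> : outer n i x (outi n i x).
    by rewrite /outer /outi; case: (ltnP x i) => /= ?; lia.
  by move/(_ isT); rewrite /outer /outi; case: ifP => /= ?; lia.
have E1 : eqw n (inw i (pw r w)) (pw t (inw (s i) w)).
  by move=> x xn; rewrite /inw /pw r1 // pn_ord.
have E2 : eqw m (outw n i (pw r w) v) (pw s (outw n (s i) w v)).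
  move=> x xm; rewrite /pw; have [->|xi] := eqVneq x i.
    by rewrite /outw pn_ord !ltnn !eqxx.
  have ne : (pn s x == s i) = false.
    by rewrite -pn_ord; apply: contraNF xi => /eqP /(pn_inj xm im) ->.
  have {}r2 := r2 _ xm xi; move: r2; rewrite /outi /outw (negbTE xi) ne pn_ord.
  by case: ifP => _ ->; case: ifP.
rewrite (la _ _ _ _ E2) (lb _ _ _ _ E1) (wdeg_eq E1) (wdeg_eq E2) !wdeg_pw.
rewrite (@tcomp_act _ _ _ _ _ i s t r h h' _ _ _ _ _ H1 H2); congr (_ *: _).
have hs : (pn s i < m)%N by apply: pn_lt.
have K := kos_block (ldegw w) h r1 r2.
rewrite K {K} pn_ord.
have -> : kos t (ldegw (inw (s i) w)) = kos t (inwt (s i) (ldegw w)) by [].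
set b' := pre _ n.
have bE : b' = wdeg (inw (s i) w) n by [].
pose aa := ldegw (outw n (s i) w v).
have K1 : ldegw (outw n (s i) w v) = updi aa (pn s i) (ldeg v).
  apply: funext => x; rewrite /aa /updi pn_ord /ldegw; case: eqP => // ->.
  by rewrite /outw ltnn eqxx.
have K2 : outwt n (s i) (ldegw w) b' = updi aa (pn s i) b'.
  apply: funext => x; rewrite /aa /updi pn_ord /ldegw /outwt /outw.
  by case: eqP => [->|_]; rewrite ?ltnn //; case: ifP.
rewrite K1 K2 !sgnD (kos_upd R s aa (ldeg v) b' im) -!sgnD.
have P1 : pre aa (pn s i) = wdeg w (s i).
  rewrite pn_ord -(wdeg_outw_pre w v n (s i)) //.
have P2 : pre (fun x => aa (pn s x)) i = wdeg (pw r w) i.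
  apply: eq_big_nat => x /andP[_ xi].
  have xm : (x < m)%N by apply: ltn_trans im.
  rewrite /aa /ldegw; have := E2 _ xm; rewrite /pw => <-.
  by rewrite /outw xi.
rewrite P1 P2 /cexp (wdeg_eq E1) (wdeg_eq E2) !wdeg_pw bE.
set A := k + _ - _; set V := ldeg v - _; set W := wdeg w _; set P := wdeg (pw _ _) _.
apply: (@sgn_mod2 _ _ _ ((W - P) * V)); ring.
Qed.

Definition tone (j : int) : O 1%N j := dcast j (op_one O).

Lemma tone0 : tone 0 = op_one O.
Proof. exact: dcast_id. Qed.

Lemma tone_ne j : j != 0 -> tone j = 0.
Proof. by rewrite eq_sym; apply: dcast_ne. Qed.

Lemma tone_d j l (e : l = j + 1) : dgd (O 1%N) e (tone j) = 0.
Proof.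
have [j0|j0] := eqVneq j 0; last by rewrite tone_ne // (linear_fun0 (op_d_linear e)).
by move: e; rewrite j0 => e; rewrite tone0 op_one_d.
Qed.

Definition rone : raw O 1 := fun x => let: (w, u, j) := x in
  if w 0%N == u then tone j else 0.

Lemma rco1 w u j : rco rone w u j = if w 0%N == u then tone j else 0.
Proof. by []. Qed.

Lemma rone_d : rd rone = 0.
Proof.
apply: rawP => w u j; rewrite rcod big_nat1 /wdeg big_nat1 big_nil !rco1 rco0.
have -> : updw w 0 Lh 0%N = Lh by [].
have -> : dgd (O 1%N) (esym (subrK 1 j)) (if w 0%N == u then tone (j - 1) else 0) = 0.
  by case: ifP => _; rewrite ?tone_d // (linear_fun0 (op_d_linear _)).
rewrite addr0; case: (w 0%N) => [[]|]; case: u => [[]|] //=;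
  rewrite ?add0r ?scaler0 ?addr0 // sgn0 ?scale1r ?subr0 ?sgn1 ?scaleN1r ?addrN //.
Qed.

(** A raw operation has coefficients in all degrees; being of total degree k singles out one degree
    for each pair w, u. *)
Definition supp n k (f : raw O n) : Prop :=
  forall w u j, j != k + wdeg w n - ldeg u -> rco f w u j = 0.

Lemma rcomp1l n (h : arity 1 n 0 n) k (b : raw O n) :
  supp k b -> rcomp h 0 k rone b = b.
Proof.
move=> sb; apply: rawP => w u j; rewrite rcoC (bigD1 u) //= big1 ?addr0; last first.
  by move=> v vu; rewrite rco1 /outw /= (negbTE vu) tcomp0l scaler0.
have -> : inw 0 w = w by apply: funext.
rewrite rco1 /outw /= eqxx /cexp /wdeg big_nat1 big_nil /=.
have E : 0 + ldeg u - ldeg u = 0 :> int by ring.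
rewrite E addr0 mul0r sgn0 scale1r tone0 -/(wdeg w n).
have [jE|jE] := eqVneq j (k + wdeg w n - ldeg u); last first.
  by rewrite (sb _ _ _ jE) tcomp_ne // add0r.
rewrite -jE tcompE ?add0r // => e; exact: op_comp1l.
Qed.

Lemma rcomp1r m i (h : arity m 1 i m) k (a : raw O m) :
  supp k a -> rcomp h k 0 a rone = a.
Proof.
move=> sa; apply: rawP => w u j; rewrite rcoC (bigD1 (w i)) //= big1 ?addr0; last first.
  by move=> v vu; rewrite rco1 /inw addn0 eq_sym (negbTE vu) tcomp0r scaler0.
have -> : outw 1 i w (w i) = w.
  apply: funext => x; rewrite /outw addn1 /=.
  by case: ifP => // _; case: eqP => // ->.
have i0 : inw i w 0 = w i by rewrite /inw addn0.
have D : wdeg (inw i w) 1 = ldeg (w i) by rewrite /wdeg big_nat1 i0.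
rewrite rco1 i0 eqxx /cexp D subrr mulr0 sgn0 scale1r.
have E : 0 + ldeg (w i) - ldeg (w i) = 0 :> int by ring.
rewrite E tone0.
have [jE|jE] := eqVneq j (k + wdeg w m - ldeg u); last first.
  by rewrite (sa _ _ _ jE) tcomp_ne // addr0.
rewrite -jE tcompE ?addr0 // => e; exact: op_comp1r.
Qed.

Lemma sum_antisym (V : zmodType) n (F : nat -> nat -> V) :
  (forall i, F i i = 0) -> (forall i j, (i < j)%N -> F i j + F j i = 0) ->
  \sum_(0 <= i < n) \sum_(0 <= j < n) F i j = 0.
Proof.
move=> F0 FN; elim: n => [|n IH]; first by rewrite big_nil.
rewrite big_nat_recr //= big_nat_recr //= F0 addr0.
under eq_bigr => i _ do rewrite big_nat_recr //=.
rewrite big_split /= IH add0r -big_split /= big_nat_cond big1 //.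
by move=> i /andP[/andP[_ ni] _]; apply: FN.
Qed.

Lemma rd_rd n (f : raw O n) : rd (rd f) = 0.
Proof.
apply: rawP => w u j; rewrite rcod rco0.
pose T i := if w i == Lt then sgn (wdeg w i) *: rco f (updw w i Lh) u j else 0.
pose S i := if w i == Lt then sgn (wdeg w i) *: rco f (updw w i Lh) Lt j else 0.
have S1 : (if u == Lh then rco (rd f) w Lt j else 0) =
   if u == Lh then sgn (wdeg w n) *: (\sum_(0 <= i < n) S i +
       dgd (O n) (esym (subrK 1 j)) (rco f w Lt (j - 1))) else 0.
  by case: ifP => // _; rewrite rcod /= add0r sub0r sgnN.
have S3 : dgd (O n) (esym (subrK 1 j)) (rco (rd f) w u (j - 1)) =
   (if u == Lh then dgd (O n) (esym (subrK 1 j)) (rco f w Lt (j - 1)) else 0) +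
   sgn (ldeg u - wdeg w n) *: \sum_(0 <= i < n) (if w i == Lt then
      sgn (wdeg w i) *: dgd (O n) (esym (subrK 1 j)) (rco f (updw w i Lh) u (j - 1)) else 0).
  rewrite rcod (linear_funD (op_d_linear _)); congr (_ + _).
    by case: ifP => // _; rewrite (linear_fun0 (op_d_linear _)).
  rewrite (linear_funZ (op_d_linear _)) (linear_funD (op_d_linear _)) dgd_dgd addr0.
  congr (_ *: _); rewrite (linear_fun_sum (op_d_linear _)); apply: eq_bigr => i _.
  case: ifP => _; last by rewrite (linear_fun0 (op_d_linear _)).
  by rewrite (linear_funZ (op_d_linear _)).
have S2 : \sum_(0 <= i < n) (if w i == Lt then
       sgn (wdeg w i) *: rco (rd f) (updw w i Lh) u j else 0) =
   (if u == Lh then \sum_(0 <= i < n) S i else 0) -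
   sgn (ldeg u - wdeg w n) *: \sum_(0 <= i < n) (if w i == Lt then
      sgn (wdeg w i) *: dgd (O n) (esym (subrK 1 j)) (rco f (updw w i Lh) u (j - 1)) else 0).
  (* Turning two letters t into h in either order gives the same word with opposite signs. *)
  pose F i i' := if (w i == Lt) && (w i' == Lt) && (i != i') then
     sgn (wdeg w i) *: (sgn (wdeg (updw w i Lh) i') *:
       rco f (updw (updw w i Lh) i' Lh) u j) else 0.
  have F0 : \sum_(0 <= i < n) \sum_(0 <= i' < n) F i i' = 0.
    apply: sum_antisym => [i|i i' ii']; first by rewrite /F eqxx andbF.
    rewrite /F (eq_sym i') (andbC (w i' == _)) (neq_ltn i i') ii' andbT.
    case: ifP => [/andP[/eqP wi /eqP wi']|_]; last by rewrite addr0.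
    have -> : updw (updw w i' Lh) i Lh = updw (updw w i Lh) i' Lh.
      apply: funext => x; rewrite /updw; do !case: eqP => //; lia.
    rewrite !scalerA -!sgnD -scalerDl wdeg_updw // wdeg_updw_pre ?(ltnW ii') // wi.
    rewrite (@sgnS _ _ (wdeg w i' + wdeg w i) 0) ?addNr ?scale0r //=; ring.
  pose G i := if w i == Lt then
    sgn (wdeg w i) *: dgd (O n) (esym (subrK 1 j)) (rco f (updw w i Lh) u (j - 1)) else 0.
  transitivity (\sum_(0 <= i < n) ((if u == Lh then S i else 0) +
    - sgn (ldeg u - wdeg w n) *: (\sum_(0 <= i' < n) F i i' + G i))); last first.
    rewrite big_split /= -scaler_sumr big_split /= F0 add0r scaleNr; congr (_ + _).
    by case: ifP => // _; rewrite big1.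
  apply: eq_big_nat => i /andP[_ ni].
  case: ifP => wi; last first.
    rewrite /S /G wi big1 ?addr0 ?scaler0 ?if_same ?addr0 //.
    by move=> i' _; rewrite /F wi.
  rewrite rcod /S /G wi scalerDr; congr (_ + _).
    by case: ifP; rewrite ?scaler0.
  have -> : sgn (ldeg u - wdeg (updw w i Lh) n) = - sgn (ldeg u - wdeg w n) :> R.
    apply: (@sgnS _ _ _ (- 1)); rewrite wdeg_updw // (eqP wi) /=; ring.
  rewrite scalerA mulrC -scalerA scalerDr; congr (_ *: (_ + _)).
  rewrite scaler_sumr; apply: eq_big_nat => i' /andP[_ ni'].
  rewrite /F wi /=; have [->|ii'] := eqVneq i i'.
    by rewrite andbF {1}/updw eqxx /= scaler0.
  have -> : updw w i Lh i' = w i' by rewrite /updw eq_sym (negbTE ii').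
  by rewrite andbT; case: ifP => // _; rewrite scaler0.
rewrite S1 S2 S3 !scalerDr.
case: ifP => [/eqP ->|_] /=.
  have -> : sgn (1 - wdeg w n) = - sgn (wdeg w n) :> R.
    apply: (@sgnS _ _ _ (- wdeg w n)); ring.
  rewrite !scaleNr !scalerN; set a := sgn _ *: _; set b := sgn _ *: _.
  set c := sgn _ *: _; rewrite ?opprK.
  by rewrite [X in _ + X]addrACA addNr addr0 -opprD subrr.
by rewrite ?scaler0 ?add0r ?sub0r ?scalerN ?addNr ?addrN.
Qed.
End RawAct.
Arguments op_act_linear {R O n} s {k}.

(** * Strictly unital operations *)

Definition cw : word := fun=> L1.

Definition hasw (l : letter) (w : word) (n : nat) : bool :=
  has (fun x => w x == l) (iota 0 n).

Lemma haswP l w n : reflect (exists2 x, (x < n)%N & w x = l) (hasw l w n).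
Proof.
apply: (iffP hasP) => [[x]|[x xn <-]].
  by rewrite mem_iota add0n => xn /eqP <-; exists x.
by exists x; rewrite ?mem_iota.
Qed.

Lemma hasw_eq l v w n : eqw n v w -> hasw l v n = hasw l w n.
Proof.
by move=> vw; apply/haswP/haswP => -[x xn <-]; exists x => //; rewrite vw.
Qed.

Lemma hasw_cw l n : l != L1 -> hasw l cw n = false.
Proof. by move=> l1; apply/haswP => -[x _ E]; rewrite -E in l1. Qed.

Lemma hasw_pw l n (s : 'S_n) w : hasw l (pw s w) n = hasw l w n.
Proof.
apply/haswP/haswP => -[x xn <-]; first by exists (pn s x); rewrite ?pn_lt.
exists (pn (s^-1)%g x); rewrite ?pn_lt //.
by rewrite /pw -pnM mulVg pn1.
Qed.

Lemma hasw_outw l w v m n i : l != L1 -> (i < m)%N ->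
  hasw l (outw n i w v) m = (v == l) || hasw l (outw n i w L1) m.
Proof.
move=> l1 im; apply/haswP/orP => [[x xm]|[/eqP <-|/haswP[x xm E]]].
- have [->|xi] := eqVneq x i; first by rewrite /outw ltnn eqxx => ->; left.
  by move=> E; right; apply/haswP; exists x => //; move: E; rewrite /outw (negbTE xi).
- by exists i => //; rewrite /outw ltnn eqxx.
- exists x => //; move: E; rewrite /outw; case: ifP => // _; case: eqP => // _ E.
  by rewrite -E in l1.
Qed.

Lemma hasw_block l w m n i p : l != L1 -> arity m n i p ->
  hasw l w p = hasw l (inw i w) n || hasw l (outw n i w L1) m.
Proof.
move=> l1 /andP[im /eqP pmn].
apply/haswP/orP => [[x xp E]|[/haswP[x xn E]|/haswP[x xm]]].
- have [xi|xi] := ltnP x i.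
    by right; apply/haswP; exists x; [lia|rewrite /outw xi].
  have [xin|xin] := ltnP x (i + n).
    by left; apply/haswP; exists (x - i)%N; [lia|rewrite /inw -E; congr w; lia].
  right; apply/haswP; exists (x - n).+1; first lia.
  by rewrite /outw !ifF -?E; [congr w| |]; lia.
- by exists (i + x)%N; [lia|].
- rewrite /outw; case: ifP => [xi E|xi]; first by exists x; [lia|].
  case: eqP => [_ E|xi' E]; first by rewrite -E in l1.
  by exists (x + n).-1; [lia|].
Qed.

Lemma wdeg_nohasw w n : ~~ hasw Lh w n -> wdeg w n = 0.
Proof.
move=> Hh; rewrite /wdeg big_nat_cond big1 // => x /andP[/andP[_ xn] _].
case E: (w x) => [[]|] //; case/negP: Hh; apply/haswP; by exists x.
Qed.

Section Normal.
Variables (R : comPzRingType) (O : operad R).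

(* An operation c of O acts on the cochains of the interval through the
   products of evaluations at the two ends of the interval. The last condition
   makes the operations of Q strictly unital. *)
Record normal n (k : int) (f : raw O n) : Prop := Normal {
  normal_supp : supp k f;
  normal_local : local f;
  normal_1 : forall w j, rco f w L1 j =
    if ~~ hasw Lh w n && ~~ hasw Lt w n then rco f cw L1 j else 0;
  normal_t : forall w j, rco f w Lt j =
    if ~~ hasw Lh w n && hasw Lt w n then rco f cw L1 j else 0;
  normal_c : forall j, rco f cw Lh j = 0;
  normal_h : forall i l j, (i < n)%N ->
    rco f (updw cw i l) Lh j = if l == Lh then rco f cw L1 j else 0 }.

Lemma normal_lin n k c (f g : raw O n) :
  normal k f -> normal k g -> normal k (c *: f + g).
Proof.
case=> s l n1 nt nc nh [s' l' n1' nt' nc' nh']; split.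
- by move=> w u j e; rewrite rcoD rcoZ s // s' // scaler0 addr0.
- by move=> v w u j vw; rewrite !rcoD !rcoZ (l _ _ _ _ vw) (l' _ _ _ _ vw).
- by move=> w j; rewrite !rcoD !rcoZ n1 n1'; case: ifP => // _; rewrite scaler0 addr0.
- by move=> w j; rewrite !rcoD !rcoZ nt nt'; case: ifP => // _; rewrite scaler0 addr0.
- by move=> j; rewrite !rcoD !rcoZ nc nc' scaler0 addr0.
- move=> i u j ni; rewrite !rcoD !rcoZ nh // nh' //.
  by case: ifP => // _; rewrite scaler0 addr0.
Qed.

Lemma normal_0 n k : normal k (0 : raw O n).
Proof. by split; rewrite /supp /local => *; rewrite !rco0 ?if_same. Qed.

Lemma wdeg_cw n : wdeg cw n = 0.
Proof. by rewrite /wdeg big1. Qed.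

Lemma wdeg_updcw n i l : (i < n)%N -> wdeg (updw cw i l) n = ldeg l.
Proof. by move=> ni; rewrite wdeg_updw // wdeg_cw /=; ring. Qed.

Lemma cexp0 k m n i w u v : wdeg (inw i w) n = ldeg v -> cexp k m n i w u v = 0.
Proof. by move=> E; rewrite /cexp E subrr mulr0. Qed.

Lemma outw_cw n i : outw n i cw L1 = cw.
Proof. by apply: funext => x; rewrite /outw; do !case: ifP. Qed.

Lemma outw_n1 m n i k (f : raw O m) w v j : normal k f -> (i < m)%N -> v != L1 ->
  rco f (outw n i w v) L1 j = 0.
Proof.
move=> nf im v1; rewrite (normal_1 nf) !(hasw_outw w v n _ im) //.
by case: v v1 => [[]|]; rewrite ?eqxx /= ?andbF.
Qed.

Lemma rcomp_cw m n i p (h : arity m n i p) k l (f : raw O m) (g : raw O n) j :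
  normal k f -> normal l g ->
  rco (rcomp h k l f g) cw L1 j = tcomp h j (rco f cw L1 k) (rco g cw L1 l).
Proof.
move=> nf ng; have im : (i < m)%N by case/andP: h.
rewrite rcoC (bigD1 L1) //= big1 => [|v v1]; last first.
  by rewrite (outw_n1 _ _ _ nf im v1) tcomp0l scaler0.
by rewrite cexp0 ?outw_cw !wdeg_cw // sgn0 scale1r !addr0 ?subr0.
Qed.

(** With 1 and t read as the functions (1, 1) and (0, 1) on the two ends, the conditions on the
    outputs 1 and t say that the operation acts pointwise, which composition preserves. For output h
    the exceptional letter lies inside or outside the block, and only the joining letter h,
    respectively 1, contributes. *)
Lemma rcomp_normal m n i p (h : arity m n i p) k l q (f : raw O m) (g : raw O n) :
  q = k + l -> normal k f -> normal l g -> normal q (rcomp h k l f g).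
Proof.
move=> e nf ng; have im : (i < m)%N by case/andP: h.
have H := hasw_block; split.
- move=> w u j ne; rewrite rcoC big1 // => v _; rewrite tcomp_ne ?scaler0 //.
  by apply: contraNneq ne => ->; rewrite e (wdeg_outw _ _ h); apply/eqP; ring.
- move=> v w u j vw; rewrite !rcoC; apply: eq_bigr => a _.
  have [_ /eqP pmn] := andP h.
  have E1 : eqw n (inw i v) (inw i w) by move=> x xn; apply: vw; lia.
  have E2 : eqw m (outw n i v a) (outw n i w a).
    move=> x xm; rewrite /outw; case: ifP => xi; first by apply: vw; lia.
    by case: eqP => // xi'; apply: vw; lia.
  rewrite /cexp (wdeg_eq E1) (wdeg_eq E2).
  have -> : wdeg v i = wdeg w i by apply: wdeg_eq => x xi; apply: vw; lia.
  by rewrite (normal_local nf _ _ E2) (normal_local ng _ _ E1).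
- move=> w j; rewrite rcomp_cw // rcoC (bigD1 L1) //= big1 => [|v v1]; last first.
    by rewrite (outw_n1 _ _ _ nf im v1) tcomp0l scaler0.
  rewrite addr0 (normal_1 nf) (normal_1 ng) !(H _ w _ _ _ _ _ h) //.
  case Hi: (hasw Lh (inw i w) n) => /=; first by rewrite tcomp0r scaler0.
  case Ho: (hasw Lh (outw n i w L1) m) => /=; first by rewrite tcomp0l scaler0.
  case Ti: (hasw Lt (inw i w) n) => /=; first by rewrite tcomp0r scaler0.
  case To: (hasw Lt (outw n i w L1) m) => /=; first by rewrite tcomp0l scaler0.
  have Di : wdeg (inw i w) n = 0 by rewrite wdeg_nohasw ?Hi.
  have Do : wdeg (outw n i w L1) m = 0 by rewrite wdeg_nohasw ?Ho.
  by rewrite cexp0 // Di Do sgn0 scale1r !addr0 ?subr0.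
- move=> w j; rewrite rcomp_cw // rcoC sum_letter.
  rewrite !(normal_t nf) (normal_t ng) (normal_1 ng) !(H _ w _ _ _ _ _ h) //.
  rewrite !(hasw_outw _ Lt) // !(hasw_outw _ Lh) //= tcomp0l scaler0 addr0.
  case Hi: (hasw Lh (inw i w) n) => /=; first by rewrite !tcomp0r !scaler0 addr0.
  case Ho: (hasw Lh (outw n i w L1) m) => /=; first by rewrite !tcomp0l !scaler0 addr0.
  have Ho' : ~~ hasw Lh (outw n i w Lt) m by rewrite hasw_outw // Ho.
  have Di : wdeg (inw i w) n = 0 by rewrite wdeg_nohasw ?Hi.
  have Do : wdeg (outw n i w L1) m = 0 by rewrite wdeg_nohasw ?Ho.
  rewrite !cexp0 // (wdeg_nohasw Ho') Di Do sgn0 !scale1r !addr0 ?subr0.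
  case Ti: (hasw Lt (inw i w) n) => /=; first by rewrite tcomp0r add0r.
  by case To: (hasw Lt (outw n i w L1) m) => /=; rewrite ?tcomp0l ?tcomp0r ?addr0.
- move=> j; rewrite rcoC big1 // => v _.
  have -> : inw i cw = cw by [].
  case: v => [[]|].
  + by rewrite (normal_c ng) tcomp0r scaler0.
  + by rewrite (normal_t ng) hasw_cw //= hasw_cw // tcomp0r scaler0.
  + by rewrite outw_cw (normal_c nf) tcomp0l scaler0.
- move=> I u j Ip; rewrite rcomp_cw //.
  have [_ /eqP pmn] := andP h.
  have [Hin|Hout] := boolP ((i <= I) && (I < i + n))%N.
    pose J := (I - i)%N.
    have -> : updw cw I u = updw cw (i + J) u by congr updw; rewrite /J; lia.
    rewrite rcoC (bigD1 Lh) //= big1 => [|v vh]; last first.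
      have -> : outw n i (updw cw (i + J) u) v = updw cw i v.
        by apply: funext => x; rewrite /updw /outw /cw /J; do !case: ifP => //; lia.
      by rewrite (normal_h nf) // (negbTE vh) tcomp0l scaler0.
    have E1 : outw n i (updw cw (i + J) u) Lh = updw cw i Lh.
      by apply: funext => x; rewrite /updw /outw /cw /J; do !case: ifP => //; lia.
    have E2 : inw i (updw cw (i + J) u) = updw cw J u.
      by apply: funext => x; rewrite /updw /inw eqn_add2l.
    have Jn : (J < n)%N by rewrite /J; lia.
    rewrite E1 E2 (normal_h nf) // (normal_h ng) // eqxx addr0.
    case: eqP => [ul|_]; last by rewrite tcomp0r scaler0.
    rewrite cexp0 ?E2 ul wdeg_updcw // sgn0 scale1r wdeg_updcw //=.
    have -> : k + 1 - 1 = k by ring.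
    by have -> : l + 1 - 1 = l by ring.
  pose I' := if (I < i)%N then I else (I - n).+1.
  have I'm : (I' < m)%N by rewrite /I'; case: ifP; lia.
  have E2 : eqw n (inw i (updw cw I u)) cw.
    by move=> x xn; rewrite /inw /updw; case: eqP => //; lia.
  have E1 : outw n i (updw cw I u) L1 = updw cw I' u.
    apply: funext => x; rewrite /updw /outw /cw /I'.
    by have [?|?] := ltnP I i; do !case: ifP => //; lia.
  rewrite rcoC (bigD1 L1) //= big1 => [|v v1]; last first.
    rewrite (normal_local ng _ _ E2); case: v v1 => [[]|] // _.
      by rewrite (normal_c ng) tcomp0r scaler0.
    by rewrite (normal_t ng) hasw_cw //= hasw_cw // tcomp0r scaler0.
  rewrite addr0 (normal_local ng _ _ E2) E1 (normal_h nf) //.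
  rewrite cexp0 (wdeg_eq E2) wdeg_cw // sgn0 scale1r.
  case: eqP => [->|_]; last by rewrite tcomp0l.
  rewrite wdeg_updcw //.
  have -> : k + ldeg Lh - 1 = k by rewrite /=; ring.
  by have -> : l + 0 - 0 = l by ring.
Qed.

Lemma rd_cw n k (f : raw O n) j : normal k f ->
  rco (rd f) cw L1 j = dgd (O n) (esym (subrK 1 j)) (rco f cw L1 (j - 1)).
Proof.
move=> nf; rewrite rcod /= wdeg_cw sub0r oppr0 sgn0 scale1r add0r.
by rewrite big1 ?add0r.
Qed.

Lemma rd_normal n k l (f : raw O n) : l = k + 1 -> normal k f -> normal l (rd f).
Proof.
move=> e nf; split.
- move=> w u j ne; rewrite rcod.
  rewrite (@normal_supp _ _ _ nf w u (j - 1)); last first.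
    by apply: contraNneq ne => E; rewrite e -(subrK 1 j) E; apply/eqP; ring.
  rewrite (linear_fun0 (op_d_linear _)) addr0 big_nat_cond big1 ?scaler0 ?addr0; last first.
    move=> i /andP[/andP[_ ni] _]; case: eqP => // wi.
    rewrite (normal_supp nf) ?scaler0 // wdeg_updw // wi.
    by apply: contraNneq ne => ->; rewrite e; apply/eqP => /=; ring.
  case: eqP => // uh; rewrite (normal_supp nf) //.
  by apply: contraNneq ne => ->; rewrite e uh; apply/eqP => /=; ring.
- move=> v w u j vw; rewrite !rcod (wdeg_eq vw) !(normal_local nf _ _ vw).
  congr (_ + _ *: (_ + _)); apply: eq_big_nat => i /andP[_ ni].
  rewrite vw //; case: eqP => // _.
  have -> : wdeg v i = wdeg w i by apply: wdeg_eq => x xi; apply: vw; lia.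
  rewrite (normal_local nf (w := updw w i Lh)) // => x xn.
  by rewrite /updw; case: eqP => // _; apply: vw.
- move=> w j; rewrite (rd_cw _ nf) rcod /= add0r big_nat_cond big1 ?add0r; last first.
    move=> i /andP[/andP[_ ni] _]; case: eqP => // wi.
    rewrite (normal_1 nf); have -> : hasw Lh (updw w i Lh) n.
      by apply/haswP; exists i => //; rewrite /updw eqxx.
    by rewrite scaler0.
  rewrite (normal_1 nf); case Hh: (hasw Lh w n) => /=.
    by rewrite (linear_fun0 (op_d_linear _)) scaler0.
  case: ifP => _; last by rewrite (linear_fun0 (op_d_linear _)) scaler0.
  by rewrite wdeg_nohasw ?Hh // [sgn _](_ : _ = 1) // scale1r.
- move=> w j; rewrite (rd_cw _ nf) rcod /= add0r big_nat_cond big1 ?add0r; last first.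
    move=> i /andP[/andP[_ ni] _]; case: eqP => // wi.
    rewrite (normal_t nf); have -> : hasw Lh (updw w i Lh) n.
      by apply/haswP; exists i => //; rewrite /updw eqxx.
    by rewrite scaler0.
  rewrite (normal_t nf); case Hh: (hasw Lh w n) => /=.
    by rewrite (linear_fun0 (op_d_linear _)) scaler0.
  case: ifP => _; last by rewrite (linear_fun0 (op_d_linear _)) scaler0.
  by rewrite wdeg_nohasw ?Hh // [sgn _](_ : _ = 1) // scale1r.
- move=> j; rewrite rcod /= (normal_t nf) !hasw_cw //= add0r.
  rewrite (normal_c nf) (linear_fun0 (op_d_linear _)) addr0 big1 ?scaler0 //.
- move=> i u j ni; rewrite (rd_cw _ nf) rcod (normal_h nf) // wdeg_updcw //.
  rewrite (normal_t nf).
  have hh v : v != L1 -> hasw v (updw cw i u) n = (u == v).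
    move=> v1; apply/haswP/eqP => [[x xn]|->].
      by rewrite /updw; case: eqP => // _ E; rewrite -E in v1.
    by exists i => //; rewrite /updw eqxx.
  rewrite !hh // big_nat_cond.
  rewrite (eq_bigr (fun x => if (x == i) && (u == Lt) then rco f cw L1 j else 0)); last first.
    move=> x /andP[/andP[_ xn] _]; rewrite {1}/updw; have [->|xi] //= := eqVneq x i.
    case: ifP => // /eqP ->; rewrite wdeg_updw_pre // wdeg_cw sgn0 scale1r.
    have -> : updw (updw cw i Lt) i Lh = updw cw i Lh.
      by apply: funext => y; rewrite /updw; case: eqP.
    by rewrite (normal_h nf).
  rewrite -big_nat_cond.
  have -> : \sum_(0 <= x < n) (if (x == i) && (u == Lt) then rco f cw L1 j else 0) =
     if u == Lt then rco f cw L1 j else 0.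
    rewrite (bigD1_seq i) ?mem_index_iota ?iota_uniq //= eqxx /= big1 ?addr0 //.
    by move=> x /negbTE ->.
  case: u {hh} => [[]|] /=.
  + by rewrite !add0r subrr sgn0 scale1r.
  (* The letter is t: the differential at the output and the one at the input both yield the
     coefficient at [cw], with opposite signs. *)
  + rewrite (linear_fun0 (op_d_linear _)) addr0 ?subr0 ?sgn1.
    by rewrite scaleN1r addr0 addrN.
  + by rewrite (linear_fun0 (op_d_linear _)) !add0r scaler0.
Qed.

Lemma kos_nohasw n (s : 'S_n) w : ~~ hasw Lh w n -> kos s (ldegw w) = 0.
Proof.
move=> Hh; rewrite /kos big_nat_cond big1 // => x /andP[/andP[_ xn] _].
rewrite big1 // => y _; case: ifP => // _.
suff -> : ldegw w (pn s x) = 0 by rewrite mul0r.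
rewrite /ldegw; case E: (w (pn s x)) => [[]|] //; case/negP: Hh.
by apply/haswP; exists (pn s x); rewrite ?pn_lt.
Qed.

Lemma ract_cw n (s : 'S_n) (f : raw O n) u j :
  rco (ract s f) cw u j = op_act O s (rco f cw u j).
Proof. by rewrite rcoA kos_nohasw ?hasw_cw // sgn0 scale1r. Qed.

Lemma ract_normal n k (s : 'S_n) (f : raw O n) : normal k f -> normal k (ract s f).
Proof.
move=> nf; split.
- move=> w u j ne; rewrite rcoA (normal_supp nf) ?wdeg_pw //.
  by rewrite (linear_fun0 (op_act_linear _)) scaler0.
- move=> v w u j vw; rewrite !rcoA (@kos_eq _ s _ (ldegw w)); last first.
    by move=> x xn; rewrite /ldegw vw.
  rewrite (normal_local nf (w := pw s w)) // => x xn.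
  by rewrite /pw vw // pn_lt.
- move=> w j; rewrite ract_cw rcoA (normal_1 nf) !hasw_pw.
  case Hh: (hasw Lh w n) => /=; first by rewrite (linear_fun0 (op_act_linear _)) scaler0.
  case: ifP => _; last by rewrite (linear_fun0 (op_act_linear _)) scaler0.
  by rewrite kos_nohasw ?Hh // sgn0 scale1r.
- move=> w j; rewrite ract_cw rcoA (normal_t nf) !hasw_pw.
  case Hh: (hasw Lh w n) => /=; first by rewrite (linear_fun0 (op_act_linear _)) scaler0.
  case: ifP => _; last by rewrite (linear_fun0 (op_act_linear _)) scaler0.
  by rewrite kos_nohasw ?Hh // sgn0 scale1r.
- by move=> j; rewrite ract_cw (normal_c nf) (linear_fun0 (op_act_linear _)).
- move=> i l j ni; rewrite ract_cw rcoA.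
  pose i' := pn (s^-1)%g i.
  have Ei : i = pn s i' by rewrite /i' -pnM mulVg pn1.
  have i'n : (i' < n)%N by rewrite pn_lt.
  have E : eqw n (pw s (updw cw i l)) (updw cw i' l).
    move=> x xn; rewrite /pw /updw Ei; have [->|xi] := eqVneq x i'; first by rewrite eqxx.
    by rewrite ifF //; apply: contra_neqF xi => /eqP /(pn_inj xn i'n).
  rewrite (normal_local nf _ _ E) (normal_h nf) //.
  case: ifP => _; last by rewrite (linear_fun0 (op_act_linear _)) scaler0.
  rewrite /kos big_nat_cond big1 ?sgn0 ?scale1r // => x /andP[/andP[_ xn] _].
  rewrite big_nat_cond big1 // => y /andP[/andP[_ yn] _]; case: ifP => // /andP[xy _].
  rewrite /ldegw /updw; case: eqP => [E1|_]; last by rewrite mul0r.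
  case: eqP => [E2|_]; last by rewrite mulr0.
  have : x = y by apply: (@pn_inj _ s _ _ xn yn); rewrite E1 E2.
  by move=> E'; rewrite E' ltnn in xy.
Qed.

Lemma rone_normal : normal 0 (rone O).
Proof.
have h1 l w : hasw l w 1 = (w 0%N == l).
  by apply/haswP/eqP => [[[|x]]|]//; exists 0%N.
split.
- move=> w u j ne; rewrite rco1; case: eqP => // E; apply: tone_ne; move: ne.
  by rewrite /wdeg big_nat1 E add0r subrr.
- by move=> v w u j vw; rewrite !rco1 vw.
- by move=> w j; rewrite !rco1 !h1 /=; case: (w 0%N) => [[]|].
- by move=> w j; rewrite !rco1 !h1 /=; case: (w 0%N) => [[]|].
- by move=> j; rewrite rco1.
- by move=> [|i] l j // _; rewrite !rco1 /updw eqxx.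
Qed.

End Normal.

(** * The operad Q and its projection to O *)

Section PathOperad.
Variables (R : comPzRingType) (O : operad R).

Definition qpred n k : {pred raw O n} := fun f => `[< normal k f >].

Arguments qpred : clear implicits.

Fact qpred_submod n k : submod_closed (qpred n k).
Proof.
split=> [|c f g /asboolP nf /asboolP ng]; apply/asboolP; first exact: normal_0.
exact: normal_lin.
Qed.

HB.instance Definition _ n k :=
  GRing.isSubmodClosed.Build R (raw O n) (qpred n k) (qpred_submod n k).

Record qmod n k := QMod { qval : raw O n; qvalP : qval \in qpred n k }.

HB.instance Definition _ n k := [isSub for @qval n k].
HB.instance Definition _ n k := [Choice of qmod n k by <:].
HB.instance Definition _ n k := [SubChoice_isSubLmodule of qmod n k by <:].

Definition mkq n k (f : raw O n) (nf : normal k f) : qmod n k :=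
  QMod (introT (asboolP (normal k f)) nf).

Lemma qvalN n k (f : qmod n k) : normal k (qval f).
Proof. exact/asboolP/qvalP. Qed.

Lemma qval_inj n k (f g : qmod n k) : qval f = qval g -> f = g.
Proof. exact: val_inj. Qed.

Lemma qval_lin n k c (f g : qmod n k) : qval (c *: f + g) = c *: qval f + qval g.
Proof. by []. Qed.

Definition qd n k l (e : l = k + 1) (f : qmod n k) : qmod n l :=
  mkq (rd_normal e (qvalN f)).

Definition Qdg (n : nat) : dgmod R.
Proof.
refine (@DGMod R (fun k => qmod n k : lmodType R) (@qd n) _ _).
- by move=> k l e c f g; apply: qval_inj; rewrite qval_lin; apply: rd_linear.
- by move=> k l m e e' f; apply: qval_inj; apply: rd_rd.
Defined.

Definition qact n (s : 'S_n) k (f : qmod n k) : qmod n k :=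
  mkq (ract_normal s (qvalN f)).

Definition qone : qmod 1 0 := mkq (rone_normal O).

Definition qcomp m n i p (h : arity m n i p) k l q (e : q = k + l)
  (f : qmod m k) (g : qmod n l) : qmod p q :=
  mkq (rcomp_normal h e (qvalN f) (qvalN g)).

Definition Qop : operad R.
Proof.
refine (@Operad R Qdg qact qone qcomp _ _ _ _ _ _ _ _ _ _ _ _).
- move=> n s; split=> [k c f g|k l e f]; apply: qval_inj.
    by rewrite qval_lin; apply: ract_linear.
  exact: ract_d.
- by move=> n k f; apply: qval_inj; apply: ract1.
- by move=> n s t k f; apply: qval_inj; apply: ractM.
- move=> m n i p h k l q e b c x y; apply: qval_inj; rewrite qval_lin.
  exact: (rcomp_linl h k l (qval b)).
- move=> m n i p h k l q e b c x y; apply: qval_inj; rewrite qval_lin.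
  exact: (rcomp_linr h k l (qval b)).
- by move=> l e; apply: qval_inj; apply: rone_d.
- move=> m n i p h k l q k' l' q' e ek el eq e1 e2 a b; apply: qval_inj.
  rewrite addrC qval_lin addrC /= ek el.
  exact: (rcomp_d h k l (qval a) (normal_local (qvalN b))).
- move=> n h k e b; apply: qval_inj; exact: (rcomp1l h (normal_supp (qvalN b))).
- move=> m i h k e a; apply: qval_inj; exact: (rcomp1r h (normal_supp (qvalN a))).
- move=> m n r i j mn nr p h1 h2 h3 h4 k l w kl lw q e1 e2 e3 e4 a b c.
  apply: qval_inj; exact: (rcomp_seq h1 h2 h3 h4).
- move=> m n r i j mn mr p ij h1 h2 h3 h4 k l w kl kw q e1 e2 e3 e4 a b c.
  apply: qval_inj; rewrite -[sgn _ *: _]addr0 qval_lin addr0.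
  exact: (rcomp_par ij h1 h2 h3 h4 _ _ e1 e3 (normal_local (qvalN b))).
- move=> m n p i s t r h h' k l q e a b H1 H2; apply: qval_inj.
  exact: (rcomp_act h h' k l (normal_local (qvalN a)) (normal_local (qvalN b)) H1 H2).
Defined.

Definition qproj n k (f : Qop n k) : O n k := rco (qval f) cw L1 k.

Lemma qproj_ne n k (f : Qop n k) j : j != k -> rco (qval f) cw L1 j = 0.
Proof.
move=> jk; apply: (normal_supp (qvalN f)).
by rewrite wdeg_cw /= addr0 subr0.
Qed.

Definition Qproj : operad_hom Qop O.
Proof.
refine (@OperadHom R Qop O qproj _ _ _ _).
- move=> n; split=> [k c x y|k l e f]; first by [].
  rewrite /qproj (rd_cw _ (qvalN f)); exact: rco_d.
- by move=> n s k f; apply: ract_cw.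
- exact: tone0.
- move=> m n i p h k l q e f g; rewrite /qproj (rcomp_cw h _ (qvalN f) (qvalN g)).
  exact: tcompE.
Defined.

(* The product of N in which t t = t and t h = h t = h h = 0; it is not a chain
   map, but it is associative and strictly unital. *)
Definition isprod n (w : word) (u : letter) : bool :=
  match u with
  | None => ~~ hasw Lh w n && ~~ hasw Lt w n
  | Some false => ~~ hasw Lh w n && hasw Lt w n
  | Some true => [exists i : 'I_n, (w i == Lh) &&
                     [forall i' : 'I_n, (i' != i) ==> (w i' == L1)]]
  end.

Lemma isprod_eq n v w u : eqw n v w -> isprod n v u = isprod n w u.
Proof.
move=> vw; case: u => [[]|] /=; rewrite ?(hasw_eq _ vw) //.
apply: eq_existsb => i; rewrite vw //; congr (_ && _); apply: eq_forallb => i'.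
by rewrite vw.
Qed.

Lemma isprod_deg n w u : isprod n w u -> wdeg w n = ldeg u.
Proof.
case: u => [[]|] /=; try by case/andP=> Hh _; rewrite wdeg_nohasw.
case/existsP=> i /andP[/eqP wi /forallP Hi].
rewrite (@wdeg_eq n w (updw cw i Lh)) ?wdeg_updcw // => x xn.
rewrite /updw; case: eqP => [->//|/eqP xi].
by apply/eqP; have := Hi (Ordinal xn); rewrite -val_eqE /= xi.
Qed.

Lemma isprod_h n i l : (i < n)%N -> isprod n (updw cw i l) Lh = (l == Lh).
Proof.
move=> ni; apply/existsP/eqP => [[x /andP[]]|->].
  by rewrite /updw; case: (eqP (x := nat_of_ord x)) => // _ /eqP.
exists (Ordinal ni); rewrite /updw eqxx /=; apply/forallP => x.
by rewrite -val_eqE /=; apply/implyP => /negbTE ->.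
Qed.

Definition rconst n k (c : O n k) : raw O n := fun x => let: (w, u, j) := x in
  if isprod n w u then dcast j c else 0.

Lemma rcoK n k (c : O n k) w u j :
  rco (rconst c) w u j = if isprod n w u then dcast j c else 0.
Proof. by []. Qed.

Lemma rconst_cw n k (c : O n k) j : rco (rconst c) cw L1 j = dcast j c.
Proof. by rewrite rcoK /= !hasw_cw. Qed.

Lemma rconst_normal n k (c : O n k) : normal k (rconst c).
Proof.
split.
- move=> w u j ne; rewrite rcoK; case: ifP => // iw; rewrite dcast_ne //.
  apply: contraNneq ne => <-; rewrite (isprod_deg iw); apply/eqP; ring.
- by move=> v w u j vw; rewrite !rcoK (isprod_eq _ vw).
- by move=> w j; rewrite rconst_cw.
- by move=> w j; rewrite rconst_cw.
- move=> j; rewrite rcoK; case: ifP => // /existsP[i].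
  by rewrite /cw andbC; case: [forall _, _].
- by move=> i l j ni; rewrite rconst_cw rcoK isprod_h.
Qed.

(** A degreewise splitting of [Qproj]. It gives surjectivity, and in arities 0 and 1 it is the
    inverse. *)
Definition qconst n k (c : O n k) : Qop n k := mkq (rconst_normal c).

Lemma qconstK n k (c : O n k) : Qproj n k (qconst c) = c.
Proof. exact: (etrans (rconst_cw c k) (dcast_id c)). Qed.

Definition hfirst n (w : word) : nat := find (fun x => w x != L1) (iota 0 n).

Lemma hfirst_lt n w : (hfirst n w < n)%N = has (fun x => w x != L1) (iota 0 n).
Proof. by rewrite has_find size_iota. Qed.

Lemma hfirstP n w : (hfirst n w < n)%N -> w (hfirst n w) != L1.
Proof.
move=> hn; have := hn; rewrite hfirst_lt => /(nth_find 0%N).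
by rewrite nth_iota.
Qed.

Lemma hfirst_before n w x : (x < hfirst n w)%N -> w x = L1.
Proof.
move=> xh; have := before_find 0%N xh.
have xn : (x < n)%N.
  by apply: leq_trans xh _; rewrite -[X in (_ <= X)%N](size_iota 0 n) find_size.
by rewrite nth_iota // add0n => /negbFE/eqP.
Qed.

Lemma hfirst_eq n w i : (i < n)%N -> w i != L1 ->
  (forall x, (x < i)%N -> w x = L1) -> hfirst n w = i.
Proof.
move=> ni wi H; have hn : (hfirst n w < n)%N.
  by rewrite hfirst_lt; apply/hasP; exists i; rewrite ?mem_iota.
have [lt|gt|//] := ltngtP (hfirst n w) i.
  by have := hfirstP hn; rewrite H.
by rewrite (hfirst_before gt) in wi.
Qed.

Lemma wdeg_hfirst n w : wdeg w (hfirst n w) = 0.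
Proof.
rewrite /wdeg big_nat_cond big1 // => x /andP[/andP[_ xh] _].
by rewrite (hfirst_before xh).
Qed.

(* A contracting homotopy of the kernel of Q -> O. *)
Definition rh n (f : raw O n) : raw O n := fun x => let: (w, u, j) := x in
  if (u == Lh) && (hfirst n w < n)%N && (w (hfirst n w) == Lh)
  then sgn (wdeg w n) *: rco f (updw w (hfirst n w) Lt) Lh j else 0.

Lemma rcoh n (f : raw O n) w u j : rco (rh f) w u j =
  if (u == Lh) && (hfirst n w < n)%N && (w (hfirst n w) == Lh)
  then sgn (wdeg w n) *: rco f (updw w (hfirst n w) Lt) Lh j else 0.
Proof. by []. Qed.

Lemma rh_normal n k l (f : raw O n) : k = l + 1 -> normal k f ->
  (forall j, rco f cw L1 j = 0) -> normal l (rh f).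
Proof.
move=> e nf f0.
have E0 j : rco (rh f) cw L1 j = 0 by [].
split.
- move=> w u j ne; rewrite rcoh; case: ifP => // /andP[/andP[/eqP uh hn] /eqP wh].
  rewrite (normal_supp nf) ?scaler0 // wdeg_updw // wh.
  by apply: contraNneq ne => ->; rewrite e uh; apply/eqP => /=; ring.
- move=> v w u j vw; rewrite !rcoh.
  have E : hfirst n v = hfirst n w.
    apply: eq_in_find => x; rewrite mem_iota add0n => /andP[_ xn].
    by rewrite vw.
  rewrite E; have [hn|hn] := ltnP (hfirst n w) n; last by rewrite andbF.
  rewrite vw // (wdeg_eq vw); case: ifP => // _.
  rewrite (normal_local nf (w := updw w (hfirst n w) Lt)) // => x xn.
  by rewrite /updw vw.
- by move=> w j; rewrite E0 if_same rcoh.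
- by move=> w j; rewrite E0 if_same rcoh.
- by move=> j; rewrite rcoh /= andbF.
- move=> i l' j ni; rewrite E0 if_same rcoh eqxx /=.
  case: ifP => // /andP[hn /eqP wh].
  have hi : hfirst n (updw cw i l') = i.
    by move: wh; rewrite {1}/updw; case: eqP.
  have -> : updw (updw cw i l') (hfirst n (updw cw i l')) Lt = updw cw i Lt.
    by apply: funext => x; rewrite hi /updw; case: eqP.
  by rewrite (normal_h nf) // scaler0.
Qed.

(** An element of the kernel has coefficients of output h only. The letters t and h span a
    contractible complex, which [rh] contracts at the first letter other than 1: the differential at
    later letters anticommutes with [rh], and the one at that letter returns [f]. On words without
    such a letter [f] vanishes by [normal_c]. *)
Lemma rh_contract n k (f : raw O n) : normal k f ->
  (forall j, rco f cw L1 j = 0) -> rd (rh f) + rh (rd f) = f.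
Proof.
move=> nf f0; apply: rawP => w u j; rewrite rcoD.
have fLh v l j' : l != Lh -> rco f v l j' = 0.
  case: l => [[]|] lh; [by [] | rewrite (normal_t nf) | rewrite (normal_1 nf)].
    by rewrite f0; case: ifP.
  by rewrite f0; case: ifP.
have [uh|uh] := eqVneq u Lh; last first.
  rewrite fLh // [X in _ + X](_ : _ = 0); last by rewrite rcoh (negbTE uh).
  rewrite addr0 rcod (negbTE uh) add0r rcoh (negbTE uh) (linear_fun0 (op_d_linear _)).
  rewrite big1 ?add0r ?scaler0 // => i _; case: ifP => // _.
  by rewrite rcoh (negbTE uh) scaler0.
subst u; set i := hfirst n w.
have [hn|hn] := ltnP i n; last first.
  have wc : eqw n w cw by move=> x xn; apply: (@hfirst_before n); apply: leq_trans hn.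
  rewrite rcoh ltnNge hn /= addr0 rcod /= (normal_local nf _ _ wc) (normal_c nf).
  rewrite !rcoh !ltnNge !hn /= (linear_fun0 (op_d_linear _)) add0r addr0.
  rewrite big_nat_cond big1 ?scaler0 // => x /andP[/andP[_ xn] _].
  by rewrite wc.
have Hw : w i = Lt \/ w i = Lh.
  by have := hfirstP hn; rewrite -/i; case: (w i) => [[]|] //; [right|left].
have hu l x : (i <= x)%N -> l != L1 -> hfirst n (updw w x l) = i.
  move=> ix l1; apply: hfirst_eq => //.
    by rewrite /updw; case: ifP => // _; exact: (hfirstP hn).
  by move=> y yi; rewrite /updw ifF; [exact: (@hfirst_before n)|lia].
have ui l x : (i < x)%N -> updw w x l i = w i.
  by move=> ix; rewrite /updw ifF //; lia.
have wb x : (x < i)%N -> (w x == Lt) = false.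
  by move=> xi; rewrite (@hfirst_before n).
(* If the letter is t, [rd (rh f)] alone returns [f]; if it is h, [f] comes from [rh (rd f)] and all
   other terms of the two summands cancel. *)
case: Hw => wi.
  rewrite [X in _ + X](_ : _ = 0) ?addr0; last by rewrite rcoh -/i wi andbF.
  rewrite rcod /= !rcoh /= -/i wi /= andbF (linear_fun0 (op_d_linear _)) addr0 add0r.
  rewrite (sum_pluck _ hn) wi eqxx /= big_nat_cond big1 ?add0r; last first.
    by move=> x /andP[/andP[_ xi] _]; rewrite wb.
  rewrite [X in _ *: (_ + X)](_ : _ = 0) ?addr0; last first.
    rewrite big_nat_cond big1 // => x /andP[/andP[ix xn] _].
    case: ifP => // _; rewrite rcoh hu // ?(ltnW ix) //.
    by rewrite ui // wi andbF scaler0.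
  rewrite rcoh hu // hn [updw _ _ _ i]/updw eqxx /= wdeg_hfirst sgn0 scale1r.
  rewrite wdeg_updw // wi.
  have -> : updw (updw w i Lh) i Lt = w.
    by apply: funext => x; rewrite /updw; case: eqP => // ->.
  rewrite !eqxx scalerA -sgnD (@sgn_mod2 _ _ 0 1) ?sgn0 ?scale1r //=; ring.
rewrite [X in _ + X]rcoh -/i hn wi eqxx /= !rcod /= !rcoh /= -/i hn wi eqxx /=.
rewrite wdeg_updw // wi /= add0r (linear_funZ (op_d_linear _)).
have wti : updw w i Lt i = Lt by rewrite /updw eqxx.
have S1 : \sum_(0 <= x < n) (if w x == Lt then
     sgn (wdeg w x) *: rco (rh f) (updw w x Lh) Lh j else 0) =
   \sum_(i.+1 <= x < n) (if w x == Lt then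
     sgn (wdeg w x + (wdeg w n + 1)) *: rco f (updw (updw w i Lt) x Lh) Lh j else 0).
  rewrite (sum_pluck _ hn) wi /= addr0 big_nat_cond big1 ?add0r; last first.
    by move=> x /andP[/andP[_ xi] _]; rewrite wb.
  apply: eq_big_nat => x /andP[ix xn]; case: eqP => // wx.
  rewrite rcoh hu // ?(ltnW ix) // hn ui // wi eqxx /=.
  rewrite scalerA -sgnD wdeg_updw // wx /=.
  have -> : updw (updw w x Lh) i Lt = updw (updw w i Lt) x Lh.
    by apply: funext => y; rewrite /updw; do !case: eqP => //; lia.
  by congr (sgn _ *: _); ring.
have S2 : \sum_(0 <= x < n) (if updw w i Lt x == Lt then
     sgn (wdeg (updw w i Lt) x) *: rco f (updw (updw w i Lt) x Lh) Lh j else 0) =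
   rco f w Lh j + \sum_(i.+1 <= x < n) (if w x == Lt then
     sgn (wdeg w x - 1) *: rco f (updw (updw w i Lt) x Lh) Lh j else 0).
  rewrite (sum_pluck _ hn) wti eqxx big_nat_cond big1 ?add0r; last first.
    move=> x /andP[/andP[_ xi] _]; have -> : updw w i Lt x = w x.
      by rewrite /updw ifF //; lia.
    by rewrite wb.
  congr (_ + _).
    rewrite wdeg_updw_pre // wdeg_hfirst sgn0 scale1r.
    have -> // : updw (updw w i Lt) i Lh = w.
    by apply: funext => x; rewrite /updw; case: eqP => // ->.
  apply: eq_big_nat => x /andP[ix xn].
  have -> : updw w i Lt x = w x by rewrite /updw ifF //; lia.
  case: ifP => // _; congr (sgn _ *: _).
  by rewrite wdeg_updw // wi /=; ring.
rewrite S1 S2 (fLh _ Lt) // add0r.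
have X1 : sgn (wdeg w n) * sgn (1 - (wdeg w n - 1 + 0)) = 1 :> R.
  rewrite -sgnD (@sgn_mod2 _ _ 0 1) ?sgn0 //; ring.
have X2 : sgn (1 - wdeg w n) * sgn (wdeg w n) = - 1 :> R.
  rewrite -sgnD (@sgnS _ _ 0 0) ?sgn0 //; ring.
rewrite scalerDr !scalerA X1 X2 scale1r scaleN1r.
set a := dgd _ _ _; set b := \sum_(i.+1 <= _ < n) _; set c := \sum_(i.+1 <= _ < n) _.
suff E : sgn (1 - wdeg w n) *: b + c = 0.
  transitivity (rco f w Lh j + (sgn (1 - wdeg w n) *: b + c) + (- a + a)).
    by zac.
  by rewrite E addNr !addr0.
rewrite /b /c [X in X + _]scaler_sumr. apply: etrans (esym (big_split _ _ _ _ _)) _ => /=.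
rewrite big1 // => x _.
case: ifP => _; last by rewrite scaler0 addr0.
rewrite scalerA -sgnD -scalerDl (@sgnS _ _ (wdeg w x - 1) 1) ?addNr ?scale0r //; ring.
Qed.

Lemma Qproj_surjective n : surjective_map (Qproj n).
Proof. by move=> k c; exists (qconst c); apply: qconstK. Qed.

Lemma qproj_ker n k (f : Qop n k) j : Qproj n k f = 0 -> rco (qval f) cw L1 j = 0.
Proof. by move=> f0; have [->//|jk] := eqVneq j k; apply: qproj_ne. Qed.

Lemma Qproj_ker_acyclic n k l (e : k = l + 1) (f : Qop n k) :
  Qproj n k f = 0 -> cocycle f ->
  exists2 g : Qop n l, Qproj n l g = 0 & f = dgd (Qop n) e g.
Proof.
move=> f0 df; have fj j := qproj_ker j f0.
exists (mkq (rh_normal e (qvalN f) fj)); first by [].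
apply: qval_inj; rewrite /= -[LHS](rh_contract (qvalN f) fj).
have /(congr1 (@qval n _)) /= -> := df _ erefl.
rewrite [X in _ + X](_ : _ = 0) ?addr0 //; apply: rawP => w u j.
by rewrite rcoh; case: ifP => // _; rewrite rco0 scaler0.
Qed.

(** A surjective chain map with acyclic kernel: cocycles and primitives are lifted and then
    corrected by an element of the kernel. *)
Lemma Qproj_quasi_iso n : quasi_iso (Qproj n).
Proof.
have P0 k l (e : l = k + 1) (x : Qop n k) :
  Qproj n l (dgd (Qop n) e x) = dgd (O n) e (Qproj n k x) := (oh_chain Qproj n).2 k l e x.
have PD k (x y : Qop n k) : Qproj n k (x - y) = Qproj n k x - Qproj n k y.
  have L := (oh_chain Qproj n).1 k.
  by rewrite (linear_funD L) (linear_funN L).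
move=> k; split=> [x cx [j [e [y xy]]]|y cy].
  have [z zy] := Qproj_surjective y.
  pose x' : Qop n k := x - dgd (Qop n) e z.
  have [|l el|g _ Eg] := @Qproj_ker_acyclic n k j e x'.
  - by rewrite PD P0 zy xy subrr.
  - rewrite (linear_funD (dgd_linear el)) (linear_funN (dgd_linear el)).
    by rewrite cx dgd_dgd subrr.
  exists j, e, (z + g).
  by rewrite (linear_funD (dgd_linear e)) -Eg /x' addrC subrK.
have [z zy] := Qproj_surjective y.
have [||g g0 Eg] := Qproj_ker_acyclic (erefl (k + 1)) (f := dgd (Qop n) erefl z).
- by rewrite P0 zy cy.
- by move=> l e; apply: dgd_dgd.
exists (z - g).
  move=> l el; subst l; rewrite (linear_funD (dgd_linear _)) (linear_funN (dgd_linear _)).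
  by rewrite Eg subrr.
exists (k - 1), (esym (subrK 1 k)), 0.
by rewrite PD g0 zy subr0 subrr (linear_fun0 (dgd_linear _)).
Qed.

(** In arity at most 1 a word is empty or a single letter, so the conditions on the output h leave
    nothing free. This is the purpose of strict unitality: it makes Q a unital augmented operad. *)
Lemma qconst_qproj n k (f : Qop n k) : (n <= 1)%N -> qconst (Qproj n k f) = f.
Proof.
move=> n1; apply: qval_inj; apply: rawP => w u j; rewrite /= rcoK.
have E : dcast j (Qproj n k f) = rco (qval f) cw L1 j.
  have [<-|jk] := eqVneq k j; first exact: dcast_id.
  by rewrite dcast_ne // qproj_ne // eq_sym.
rewrite E; have nf := qvalN f; case: u => [[]|].
- case: n n1 f nf E => [|[|]] // _ f nf E.
    rewrite (normal_local nf (w := cw)) // (normal_c nf).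
    by case: ifP => // /existsP[[]].
  have wE : eqw 1 w (updw cw 0 (w 0%N)) by move=> [].
  rewrite (isprod_eq _ wE) (normal_local nf _ _ wE) isprod_h //.
  by rewrite (normal_h nf).
- by rewrite [RHS](normal_t nf).
- by rewrite [RHS](normal_1 nf).
Qed.

End PathOperad.

(** * The section given by cofibrancy *)

Section CofibrantSection.
Variables (R : comPzRingType) (O : uaoperad R).

Definition Qaug : operad_hom (Qop O) (Com R).
Proof.
refine (@OperadHom R (Qop O) (Com R) (fun n k f => ua_aug O n k (Qproj O n k f)) _ _ _ _).
- move=> n; split=> [k c f g|k l e f].
    by rewrite (oh_chain (Qproj O) n).1 (oh_chain (ua_aug O) n).1.
  by rewrite (oh_chain (Qproj O) n).2 (oh_chain (ua_aug O) n).2.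
- by move=> n s k f; rewrite !oh_act.
- by rewrite !oh_one.
- by move=> *; rewrite !oh_comp.
Defined.

Lemma Qproj_bij n k : (n <= 1)%N -> bijective (Qproj O n k).
Proof.
move=> n1; exists (@qconst R O n k) => f; [exact: qconst_qproj|exact: qconstK].
Qed.

Definition Qua : uaoperad R.
Proof.
refine (@UAOperad R (Qop O) Qaug _ _) => k.
- exact: (bij_comp (ua_aug0 O k) (Qproj_bij k (leqnSn 0))).
- exact: (bij_comp (ua_aug1 O k) (Qproj_bij k (leqnn 1))).
Defined.

Definition Quaproj : uaoperad_hom Qua O.
Proof. by exists (Qproj O). Defined.

(** The identity of O is lifted against Q -> O; the square to be filled starts at an initial object,
    so it commutes. *)
Lemma cofibrant_section : cofibrant (O : UAOp R) ->
  exists s : operad_hom O (Qop O), forall n k (a : O n k), Qproj O n k (s n k a) = a.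
Proof.
case=> I [i [Iinit lift]].
have [f _] := Iinit (Qua : UAOp R).
have [|| h [_ hE]] := lift _ _ Quaproj _ f (idm (O : UAOp R)).
- by move=> n; split; [exact: Qproj_surjective | exact: Qproj_quasi_iso].
- have [z zE] := Iinit (O : UAOp R); by rewrite (zE (compm _ f)) (zE (compm _ i)).
exists (h : uaoperad_hom O Qua) => n k a.
by have /(congr1 (fun g : uaoperad_hom O O => g n k a)) := hE.
Qed.

End CofibrantSection.

(** * Signs and degrees for tensors of letters with elements of an algebra *)

Definition bil (n : nat) (a b : nat -> int) : int :=
  \sum_(0 <= j < n) pre a j * b j.

Lemma pre_eq a b n : (forall x, (x < n)%N -> a x = b x) -> pre a n = pre b n.
Proof. by move=> ab; apply: eq_big_nat => j /andP[_ jn]; apply: ab. Qed.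

Lemma bil_eq n a a' b b' : (forall x, (x < n)%N -> a x = a' x) ->
  (forall x, (x < n)%N -> b x = b' x) -> bil n a b = bil n a' b'.
Proof.
move=> aa bb; apply: eq_big_nat => j /andP[_ jn]; rewrite bb //; congr (_ * _).
by apply: pre_eq => x xj; apply: aa; apply: ltn_trans jn.
Qed.

Lemma pre_add a i n : pre a (i + n) = pre a i + pre (inwt i a) n.
Proof. by rewrite /pre (@big_cat_nat _ _ _ i) ?(sum_shift _ i n) //= leq_addr. Qed.

Lemma pre_outwt a v m n i p : arity m n i p ->
  pre (outwt n i a v) m = pre a p - pre (inwt i a) n + v.
Proof.
move=> h; have im : (i < m)%N by case/andP: h.
rewrite /pre (sum_block _ h) (sum_pluck _ im).
rewrite [outwt _ _ _ _ i]/outwt ltnn eqxx.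
rewrite (@eq_big_nat _ _ _ _ _ _ a); last first.
  by move=> j /andP[_ ji]; rewrite /outwt ji.
rewrite (@eq_big_nat _ _ _ i.+1 _ _ (fun j => a (j + n).-1)); last first.
  by move=> j /andP[ij _]; rewrite /outwt !ifF //; lia.
rewrite /inwt; ring.
Qed.

Lemma pre_outwt_lt a v n i j : (j <= i)%N -> pre (outwt n i a v) j = pre a j.
Proof. by move=> ji; apply: pre_eq => x xj; rewrite /outwt ifT //; lia. Qed.

(** The last two terms correct for replacing the degrees of the block by [al] and [be] in its
    crossings with what stands before and after it. *)
Lemma bil_block m n i p a b al be : arity m n i p ->
  bil p a b = bil n (inwt i a) (inwt i b) +
    bil m (outwt n i a al) (outwt n i b be) +
    pre a i * (pre (inwt i b) n - be) +
    (pre (inwt i a) n - al) * (pre b p - pre b (i + n)).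
Proof.
move=> h; have im : (i < m)%N by case/andP: h.
rewrite /bil (sum_block _ h) (sum_pluck _ im).
rewrite [outwt _ _ b _ i]/outwt ltnn eqxx pre_outwt_lt //.
have -> : \sum_(0 <= j < n) pre a (i + j) * b (i + j)%N =
   \sum_(0 <= j < n) pre (inwt i a) j * inwt i b j + pre a i * pre (inwt i b) n.
  rewrite /(pre (inwt i b)) mulr_sumr -big_split; apply: eq_bigr => j _ /=.
  by rewrite pre_add /inwt; ring.
have -> : \sum_(i.+1 <= j < m) pre a (j + n).-1 * b (j + n).-1 =
   \sum_(i.+1 <= j < m) pre (outwt n i a al) j * outwt n i b be j +
   (pre (inwt i a) n - al) * (pre b p - pre b (i + n)).
  have -> : pre b p - pre b (i + n) = \sum_(i.+1 <= j < m) b (j + n).-1.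
    by rewrite /pre (sum_block _ h) (@big_cat_nat _ _ _ i 0 (i + n)) ?leq_addr //=
               (sum_shift _ i n); ring.
  rewrite mulr_sumr -big_split; apply: eq_big_nat => j /andP[ij jm] /=.
  have ha : arity j n i (j + n).-1 by rewrite /arity; lia.
  rewrite (pre_outwt a al ha) [outwt _ _ b _ j]/outwt !ifF; [ring|lia|lia].
have -> : \sum_(0 <= j < i) pre a j * b j =
   \sum_(0 <= j < i) pre (outwt n i a al) j * outwt n i b be j.
  by apply: eq_big_nat => j /andP[_ ji]; rewrite pre_outwt_lt ?(ltnW ji) // /outwt ji.
ring.
Qed.

(** [bil] is the exponent for moving the letters, of degrees [b], in front of the elements, of
    degrees [a]. Permuting the pairs and then separating them is the same as separating first and
    then permuting letters and elements apart. *)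
Lemma kosD_sgn (R : comPzRingType) n (s : 'S_n) a b :
  sgn (kos s (fun x => a x + b x) + bil n (fun x => a (pn s x)) (fun x => b (pn s x))) =
  sgn (kos s a + kos s b + bil n a b) :> R.
Proof.
pose X := \sum_(0 <= x < n) \sum_(0 <= y < n)
  (if (x < y)%N && (pn s y < pn s x)%N then a (pn s x) * b (pn s y) else 0).
pose Y := \sum_(0 <= x < n) \sum_(0 <= y < n)
  (if (x < y)%N && (pn s y < pn s x)%N then b (pn s x) * a (pn s y) else 0).
pose Z := \sum_(0 <= x < n) \sum_(0 <= y < n)
  (if (x < y)%N && (pn s x < pn s y)%N then a (pn s x) * b (pn s y) else 0).
have preE c j : (j <= n)%N -> pre c j = \sum_(0 <= y < n) if (y < j)%N then c y else 0.
  move=> jn; rewrite (@big_cat_nat _ _ _ j 0 n) //= [X in _ = _ + X]big_nat_cond.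
  rewrite [X in _ = _ + X]big1 ?addr0; last by move=> y; case: ifP => //; lia.
  by apply: eq_big_nat => y /andP[_ ->].
have bilE c d : bil n c d = \sum_(0 <= x < n) \sum_(0 <= y < n)
    if (x < y)%N then c x * d y else 0.
  rewrite exchange_big /=; apply: eq_big_nat => y /andP[_ yn].
  rewrite preE ?(ltnW yn) // mulr_suml; apply: eq_bigr => x _.
  by case: ifP => _; rewrite ?mul0r.
have E1 : kos s (fun x => a x + b x) = kos s a + kos s b + X + Y.
  rewrite /kos /X /Y -!big_split /=; apply: eq_bigr => x _.
  rewrite -!big_split /=; apply: eq_bigr => y _.
  by case: ifP => _; ring.
have E2 : bil n (fun x => a (pn s x)) (fun x => b (pn s x)) = X + Z.
  rewrite bilE /X /Z -big_split /=; apply: eq_big_nat => x /andP[_ xn].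
  rewrite -big_split /=; apply: eq_big_nat => y /andP[_ yn].
  have [xy|xy] := ltnP x y; last by rewrite addr0.
  have ne : pn s x != pn s y by apply/eqP => /(pn_inj xn yn); lia.
  by case: (ltngtP (pn s x) (pn s y)) ne => //= _ _; rewrite ?addr0 ?add0r.
have E3 : bil n a b = Y + Z.
  rewrite bilE -(sum_pn s).
  transitivity (\sum_(0 <= x < n) \sum_(0 <= y < n)
     if (pn s x < pn s y)%N then a (pn s x) * b (pn s y) else 0).
    by apply: eq_bigr => x _; rewrite -(sum_pn s).
  rewrite /Y [X in _ = X + _]exchange_big /Z -big_split /=.
  apply: eq_big_nat => x /andP[_ xn].
  rewrite -big_split /=; apply: eq_big_nat => y /andP[_ yn].
  have [xy|xy|->] := ltngtP x y; rewrite ?ltnn ?addr0 ?add0r //=.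
  by case: ifP => _; rewrite // mulrC.
apply: (@sgn_mod2 _ _ _ X); rewrite E1 E2 E3; ring.
Qed.

Lemma upd_id (T : Type) n (x : 'I_n -> T) i : upd x i (x i) = x.
Proof. by apply: funext => j; rewrite /upd; case: eqP => [->|]. Qed.

Section Degrees.
Variables (R : comPzRingType) (A : dgmod R).

Lemma tag_upd n (x : 'I_n -> hel A) i k (u v : A k) :
  \sum_(j < n) tag (upd x i (mkhel u) j) = \sum_(j < n) tag (upd x i (mkhel v) j).
Proof. by apply: eq_bigr => j _; rewrite /upd; case: eqP. Qed.

Lemma sum_tag_upd n (x : 'I_n -> hel A) i u :
  \sum_(j < n) tag (upd x i u j) = \sum_(j < n) tag (x j) - tag (x i) + tag u.
Proof.
rewrite (bigD1 i) //= [in RHS](bigD1 i) //= {1}/upd eqxx.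
rewrite (eq_bigr (fun j => tag (x j))); last by move=> j /negbTE ji; rewrite /upd ji.
ring.
Qed.

Definition hdeg n (x : 'I_n -> hel A) : nat -> int :=
  fun t => if insub t is Some i then tag (x i) else 0.

Lemma hdeg_ord n (x : 'I_n -> hel A) (i : 'I_n) : hdeg x i = tag (x i).
Proof. by rewrite /hdeg valK. Qed.

Lemma sum_hdeg n (x : 'I_n -> hel A) : \sum_(i < n) tag (x i) = pre (hdeg x) n.
Proof. by rewrite /pre big_mkord; apply: eq_bigr => i _; rewrite hdeg_ord. Qed.

Lemma pre_hdeg n (x : 'I_n -> hel A) i : (i <= n)%N ->
  \sum_(j < n | (j < i)%N) tag (x j) = pre (hdeg x) i.
Proof.
move=> ni; rewrite /pre (big_nat_widen _ _ _ _ _ ni) big_mkord.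
by apply: eq_bigr => j _; rewrite hdeg_ord.
Qed.
End Degrees.

Section Total.
Variables (R : comPzRingType) (O : operad R) (A : opalg O).

Definition tact n l (a : O n l) (x : 'I_n -> hel A) m : A m :=
  match eq_comparable m (l + \sum_(i < n) tag (x i)) with
  | left e => oa_act A a x e
  | right _ => 0
  end.

Lemma tactE n l (a : O n l) (x : 'I_n -> hel A) m
  (e : m = l + \sum_(i < n) tag (x i)) : tact a x m = oa_act A a x e.
Proof.
rewrite /tact; case: (eq_comparable _ _) => // e'; exact: act_irr.
Qed.

Lemma tact_ne n l (a : O n l) (x : 'I_n -> hel A) m :
  m != l + \sum_(i < n) tag (x i) -> tact a x m = 0.
Proof. by rewrite /tact; case: (eq_comparable _ _) => // e; rewrite {1}e eqxx. Qed.

Lemma tact_linl n l (x : 'I_n -> hel A) m : linear (fun a : O n l => tact a x m).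
Proof.
move=> c a b; have [e|e] := eqVneq m (l + \sum_(i < n) tag (x i)).
  by rewrite !tactE (act_linl (oa_axioms A)).
by rewrite !tact_ne // scaler0 addr0.
Qed.

Lemma tact_linr n l (a : O n l) (x : 'I_n -> hel A) i k m :
  linear (fun u : A k => tact a (upd x i (mkhel u)) m).
Proof.
move=> c u v.
have [e|e] := eqVneq m (l + \sum_(j < n) tag (upd x i (mkhel (c *: u + v)) j)).
  have eu : m = l + \sum_(j < n) tag (upd x i (mkhel u) j) by rewrite e (tag_upd _ _ _ u).
  have ev : m = l + \sum_(j < n) tag (upd x i (mkhel v) j) by rewrite e (tag_upd _ _ _ v).
  by rewrite (tactE _ e) (tactE _ eu) (tactE _ ev) (act_linr (oa_axioms A) a e eu ev).
rewrite !tact_ne ?scaler0 ?addr0 // ?(tag_upd _ _ u (c *: u + v)) //.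
by rewrite (tag_upd _ _ v (c *: u + v)).
Qed.

Lemma tact_d n l l' m m' (a : O n l) (x : 'I_n -> hel A) (em : m' = m + 1)
  (el : l' = l + 1) :
  dgd A em (tact a x m) = tact (dgd (O n) el a) x m' +
    \sum_(i < n) sgn (l + \sum_(j < n | (j < i)%N) tag (x j)) *:
       tact a (upd x i (hd (x i))) m'.
Proof.
have S i : \sum_(j < n) tag (upd x i (hd (x i)) j) = \sum_(j < n) tag (x j) + 1.
  by rewrite sum_tag_upd /=; ring.
have [e|e] := eqVneq m (l + \sum_(i < n) tag (x i)).
  have e0 : m' = l' + \sum_(i < n) tag (x i) by rewrite em e el; ring.
  have e1 i : m' = l + \sum_(j < n) tag (upd x i (hd (x i)) j) by rewrite em e S; ring.
  rewrite (tactE _ e) (tactE _ e0) (act_d (oa_axioms A) a e em el e0 e1).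
  by congr (_ + _); apply: eq_bigr => i _; rewrite (tactE _ (e1 i)).
rewrite tact_ne // (linear_fun0 (dgd_linear _)) tact_ne ?add0r; last first.
  by apply: contraNneq e; rewrite em el => E; apply/eqP/(addIr 1); rewrite E; ring.
rewrite [RHS]big1 // => i _; rewrite tact_ne ?scaler0 // S.
by apply: contraNneq e; rewrite em => E; apply/eqP/(addIr 1); rewrite E; ring.
Qed.

Lemma tact_perm n l (a : O n l) (s : 'S_n) (x : 'I_n -> hel A) m :
  tact (op_act O s a) x m =
  sgn (kos s (hdeg x)) *: tact a (fun i => x (s i)) m.
Proof.
have S : \sum_(i < n) tag (x (s i)) = \sum_(i < n) tag (x i).
  by rewrite [RHS](reindex_inj (@perm_inj _ s)).
have [e|e] := eqVneq m (l + \sum_(i < n) tag (x i)); last first.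
  by rewrite !tact_ne ?scaler0 ?S.
have es : m = l + \sum_(i < n) tag (x (s i)) by rewrite S.
rewrite (tactE _ e) (tactE _ es) (act_perm (oa_axioms A) a e es).
congr (sgn _ *: _); rewrite /kos big_mkord; apply: eq_bigr => i _.
rewrite big_mkord [LHS]big_mkcond; apply: eq_bigr => j _.
by rewrite !pn_ord !hdeg_ord.
Qed.

Lemma tact_one k (u : A k) : tact (op_one O) (fun=> mkhel u) k = u.
Proof.
have e : k = 0 + \sum_(i < 1) tag (mkhel u) by rewrite big_ord1 add0r.
by rewrite (tactE _ e) (act_one (oa_axioms A)).
Qed.

Lemma tact_comp m n p (i : 'I_m) (h : arity m n i p) k l kl (ek : kl = k + l)
    (a : O m k) (b : O n l)
    (x : 'I_p -> hel A) (y : 'I_m -> hel A) (z : 'I_n -> hel A) w q :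
  w = l + \sum_(j < n) tag (z j) ->
  (forall (j : 'I_n) (u : 'I_p), u = (i + j)%N :> nat -> z j = x u) ->
  (forall (j : 'I_m) (u : 'I_p), j != i -> outer n i j u -> y j = x u) ->
  y i = mkhel (tact b z w) ->
  tact (op_comp O h ek a b) x q = sgn (l * pre (hdeg y) i) *: tact a y q.
Proof.
move=> ez zx yx yi.
have [im /eqP pmn] := andP h.
have yE j (jm : (j < m)%N) : j != i ->  hdeg y j = hdeg x (outi n i j).
  move=> ji; have jp : (outi n i j < p)%N by move: ji; rewrite /outi; case: ifP; lia.
  rewrite -[j]/(val (Ordinal jm)) -[outi n i _]/(val (Ordinal jp)) !hdeg_ord.
  have o : outer n i j (outi n i j) by rewrite /outer /outi; case: (ltnP j i) => /= ?; lia.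
  by rewrite (yx (Ordinal jm) (Ordinal jp)).
have zE j (jn : (j < n)%N) : hdeg z j = hdeg x (i + j).
  have jp : (i + j < p)%N by lia.
  rewrite -[j]/(val (Ordinal jn)) -[(i + _)%N]/(val (Ordinal jp)) !hdeg_ord.
  by rewrite (zx _ (Ordinal jp)).
have S : kl + \sum_(j < p) tag (x j) = k + \sum_(j < m) tag (y j).
  rewrite !sum_hdeg /pre (sum_block_neq _ h) (sum_neq _ im) hdeg_ord yi /= ez.
  rewrite sum_hdeg ek /pre.
  have -> : \sum_(0 <= j < n) hdeg z j = \sum_(0 <= j < n) hdeg x (i + j).
    by apply: eq_big_nat => j /andP[_ jn]; apply: zE.
  have -> : \sum_(0 <= j < m | j != i) hdeg y j = \sum_(0 <= j < m | j != i) hdeg x (outi n i j).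
    rewrite [LHS]big_nat_cond [RHS]big_nat_cond.
    by apply: eq_bigr => j /andP[/andP[_ jm] ji]; apply: yE.
  ring.
have [e|e] := eqVneq q (kl + \sum_(j < p) tag (x j)); last first.
  by rewrite !tact_ne -?S // scaler0.
have ey : q = k + \sum_(j < m) tag (y j) by rewrite -S.
rewrite (tactE _ e) (tactE _ ey).
have yi' : y i = mkhel (oa_act A b z ez) by rewrite yi (tactE _ ez).
by rewrite (act_comp (oa_axioms A) h ek a e ey zx yx yi') pre_hdeg ?(ltnW im).
Qed.

End Total.

(** * The path object *)

Section WordSums.
Variable V : nmodType.

Definition nw n (w : {ffun 'I_n -> letter}) : word :=
  fun x => if insub x is Some i then w i else L1.

Lemma nw_ord n (w : {ffun 'I_n -> letter}) (i : 'I_n) : nw w i = w i.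
Proof. by rewrite /nw valK. Qed.

Lemma nwP n (w : {ffun 'I_n -> letter}) x (xn : (x < n)%N) : nw w x = w (Ordinal xn).
Proof. by rewrite -[x]/(val (Ordinal xn)) nw_ord. Qed.

Lemma nw_finfun n (w : word) : eqw n (nw [ffun i : 'I_n => w i]) w.
Proof. by move=> x xn; rewrite nwP ffunE. Qed.

Definition wsum n (F : word -> V) : V := \sum_(w : {ffun 'I_n -> letter}) F (nw w).

Definition winv n (F : word -> V) : Prop := forall v w, eqw n v w -> F v = F w.

Lemma wsum_perm n (s : 'S_n) (F : word -> V) : winv n F ->
  wsum n F = wsum n (fun w => F (pw s w)).
Proof.
move=> Finv; rewrite /wsum.
rewrite (reindex (fun w : {ffun 'I_n -> letter} => [ffun i => w (s i)])) /=.
  apply: eq_bigr => w _; apply: Finv => x xn.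
  by rewrite nwP ffunE /pw -[X in pn s X]/(val (Ordinal xn)) pn_ord nw_ord.
exists (fun w : {ffun 'I_n -> letter} => [ffun i => w (s^-1%g i)]) => w _;
  by apply/ffunP => i; rewrite !ffunE ?permK ?permKV.
Qed.

Lemma wsum_toggle n i a b (F : word -> V) : (i < n)%N -> winv n F ->
  wsum n (fun w => if w i == a then F (updw w i b) else 0) =
  wsum n (fun w => if w i == b then F w else 0).
Proof.
move=> ni Finv; rewrite /wsum -!big_mkcond /=.
pose o := Ordinal ni.
have nwu c (w : {ffun 'I_n -> letter}) :
    eqw n (nw [ffun j => if j == o then c else w j]) (updw (nw w) i c).
  by move=> x xn; rewrite !nwP ffunE /updw -val_eqE /=; case: ifP; rewrite ?nwP.
rewrite [RHS](reindex_onto (fun w : {ffun 'I_n -> letter} => [ffun j => if j == o then b else w j])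
   (fun w : {ffun 'I_n -> letter} => [ffun j => if j == o then a else w j])) /=.
  apply: eq_big => [w|w wa]; last exact/esym/Finv.
  rewrite (nwu b w i ni) {1}/updw eqxx eqxx /= nwP -/o; apply/eqP/eqP => [wa|/ffunP/(_ o)].
    by apply/ffunP => j; rewrite !ffunE; case: eqP => // ->.
  by rewrite !ffunE eqxx.
move=> w; rewrite nwP -/o => /eqP wb; apply/ffunP => j; rewrite !ffunE.
by case: eqP => // ->.
Qed.

Definition glue n i (w1 w2 : word) : word :=
  fun x => if (x < i)%N then w1 x else
           if (x < i + n)%N then w2 (x - i)%N else w1 (x - n).+1.

(** A word of the composite together with a joining letter v amounts to an outer word with v at
    place i and an inner word. *)
Lemma wsum_block m n i p (G : word -> letter -> V) : arity m n i p ->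
  (forall v, winv p (G^~ v)) ->
  wsum p (fun w => \sum_v G w v) =
  wsum m (fun w1 => wsum n (fun w2 => G (glue n i w1 w2) (w1 i))).
Proof.
move=> h Ginv; have [im /eqP pmn] := andP h.
rewrite /wsum !pair_big /=.
pose f (q : {ffun 'I_m -> letter} * {ffun 'I_n -> letter}) :
    {ffun 'I_p -> letter} * letter :=
  ([ffun j : 'I_p => glue n i (nw q.1) (nw q.2) j], nw q.1 i).
rewrite (reindex f) /=.
  by apply: eq_bigr => q _; apply: Ginv; apply: nw_finfun.
exists (fun q : {ffun 'I_p -> letter} * letter =>
  ([ffun j : 'I_m => outw n i (nw q.1) q.2 j], [ffun j : 'I_n => inw i (nw q.1) j])).
- case=> w1 w2 _; rewrite /f /=; congr pair; apply/ffunP => j; rewrite ffunE.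
    rewrite /outw; have [ji|ji] := ltnP j i.
      by rewrite nw_finfun ?/glue ?ji ?nw_ord //; lia.
    have [<-|ji'] := eqVneq (j : nat) i; first by rewrite nw_ord.
    have jm := ltn_ord j; rewrite nw_finfun; last lia.
    rewrite /glue !ifF; try lia.
    by rewrite (_ : ((j + n).-1 - n).+1 = j)%N ?nw_ord //; lia.
  have jn := ltn_ord j; rewrite /inw nw_finfun; last lia.
  by rewrite /glue ifF ?ifT; try lia; rewrite addKn nw_ord.
case=> w v _; rewrite /f /=; congr pair; last first.
  by rewrite nw_finfun // /outw ltnn eqxx.
apply/ffunP => j; rewrite ffunE; have jp := ltn_ord j.
rewrite /glue; have [ji|ji] := ltnP j i.
  by rewrite nw_finfun ?/outw ?ji ?nw_ord //; lia.
have [jin|jin] := ltnP j (i + n).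
  by rewrite nw_finfun ?/inw ?subnKC ?nw_ord //; lia.
rewrite nw_finfun; last lia.
rewrite /outw !ifF; try lia.
by rewrite (_ : ((j - n).+1 + n).-1 = j)%N ?nw_ord //; lia.
Qed.

Lemma glue_out m n i p w1 w2 : arity m n i p ->
  outw n i (glue n i w1 w2) (w1 i) = w1.
Proof.
move=> h; apply: funext => x; rewrite /outw /glue.
have [//|xi] := ltnP x i; have [->//|xi'] := eqVneq x i.
rewrite !ifF; try lia.
by congr w1; lia.
Qed.

Lemma glue_in n i w1 w2 : eqw n (inw i (glue n i w1 w2)) w2.
Proof.
move=> x xn; rewrite /inw /glue ifF; last lia.
by rewrite ifT ?addKn //; lia.
Qed.

Lemma wsumD n (F G : word -> V) :
  wsum n F + wsum n G = wsum n (fun w => F w + G w).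
Proof. by rewrite /wsum big_split. Qed.

End WordSums.

Section PathAlgebra.
Variables (R : comPzRingType) (O : operad R) (s : operad_hom O (Qop O)).
Variable A : opalg O.

(* The element (x, y, z) is 1 (x) x + t (x) y + dt (x) z in N (x) A. *)
Definition pmod (k : int) : lmodType R := (A k * A k * A (k - 1))%type.

(** Reading components in every degree, as zero outside the right one, lets equalities of triples be
    proved without transport between degrees. *)
Definition pget k (X : pmod k) (u : letter) (j : int) : A j :=
  match u with
  | None => dcast j X.1.1
  | Some false => dcast j X.1.2
  | Some true => dcast j X.2
  end.

Lemma pget_linear k u j : linear (fun X : pmod k => pget X u j).
Proof.
move=> c X Y; case: u => [[]|].
- exact: (dcast_linear j c X.2 Y.2).
- exact: (dcast_linear j c X.1.2 Y.1.2).
- exact: (dcast_linear j c X.1.1 Y.1.1).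
Qed.

Lemma pget_inj k (X Y : pmod k) : (forall u j, pget X u j = pget Y u j) -> X = Y.
Proof.
case: X Y => [[x1 xt] xh] [[y1 yt] yh] E.
have E1 : x1 = y1 by have := E L1 k; rewrite /pget !dcast_id.
have Et : xt = yt by have := E Lt k; rewrite /pget !dcast_id.
have Eh : xh = yh by have := E Lh (k - 1); rewrite /pget !dcast_id.
by rewrite E1 Et Eh.
Qed.

Lemma pget_ne k (X : pmod k) u j : j != k - ldeg u -> pget X u j = 0.
Proof.
by case: u => [[]|] ne; apply: dcast_ne; rewrite eq_sym //; move: ne; rewrite subr0.
Qed.

Lemma dcast_dcast (B : dgmod R) k l j (x : B k) : k = l -> dcast j (dcast l x) = dcast j x.
Proof. by move=> e; case: l / e; rewrite dcast_id. Qed.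

Lemma dcast_dgd (B : dgmod R) k l j (e : l = k + 1) (x : B k) :
  dcast j (dgd B e x) = dgd B (esym (subrK 1 j)) (dcast (j - 1) x).
Proof.
have [lj|lj] := eqVneq l j; last first.
  rewrite dcast_ne // dcast_ne ?(linear_fun0 (dgd_linear _)) //.
  by apply: contra_neq lj => kj; rewrite e kj subrK.
subst j; rewrite dcast_id.
have k1 : k = l - 1 by rewrite e addrK.
move: (esym _); case: (l - 1) / k1 => e'.
by rewrite dcast_id; congr dgd; apply: Prop_irrelevance.
Qed.

Fact pd_subproof (k l : int) : l = k + 1 -> l - 1 = (k - 1) + 1.
Proof. by move=> ->; rewrite addrK subrK. Qed.

(** From d(t (x) y) = h (x) y + t (x) dy and d(h (x) z) = - h (x) dz. *)
Definition pd k l (e : l = k + 1) (X : pmod k) : pmod l :=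
  (dgd A e X.1.1, dgd A e X.1.2,
   dcast (l - 1) X.1.2 - dgd A (pd_subproof e) X.2).

Lemma pget_d k l (e : l = k + 1) (X : pmod k) u j :
  pget (pd e X) u j = (if u == Lh then pget X Lt j else 0) +
    sgn (ldeg u) *: dgd A (esym (subrK 1 j)) (pget X u (j - 1)).
Proof.
case: u => [[]|] /=.
- rewrite (linear_funD (dcast_linear _)) (linear_funN (dcast_linear _)).
  rewrite dcast_dcast; last by rewrite e addrK.
  by rewrite dcast_dgd sgn1 scaleN1r.
- by rewrite dcast_dgd sgn0 scale1r add0r.
- by rewrite dcast_dgd sgn0 scale1r add0r.
Qed.

Fact pd_linear k l (e : l = k + 1) : linear (pd e).
Proof.
move=> c X Y; apply: pget_inj => u j.
rewrite pget_d (pget_linear u j c (pd e X) (pd e Y)) !pget_d.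
rewrite (pget_linear u (j - 1) c X Y) (dgd_linear (esym _) c) scalerDr !scalerA.
rewrite (pget_linear Lt j c X Y) scalerDr scalerA (mulrC c).
by case: ifP => _; rewrite ?scaler0 ?add0r //; apply: addrACA.
Qed.

Fact pd_pd k l m (e : l = k + 1) (e' : m = l + 1) (X : pmod k) : pd e' (pd e X) = 0.
Proof.
apply: pget_inj => u j; rewrite (linear_fun0 (pget_linear u j)) !pget_d.
rewrite (linear_funD (dgd_linear _)) (linear_funZ (dgd_linear _)) dgd_dgd scaler0 addr0.
case: u => [[]|] /=; rewrite ?sgn0 ?sgn1 ?scale1r ?scaleN1r ?add0r.
- by rewrite subrr.
- by rewrite (linear_fun0 (dgd_linear _)).
- by rewrite (linear_fun0 (dgd_linear _)).
Qed.

Definition pdg : dgmod R := @DGMod R pmod pd pd_linear pd_pd.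

Definition pc (X : hel pdg) (u : letter) : hel A :=
  mkhel (pget (tagged X : pmod (tag X)) u (tag X - ldeg u)).

Definition pcs n (X : 'I_n -> hel pdg) (w : word) : 'I_n -> hel A :=
  fun i => pc (X i) (w i).

Definition cf n l (a : O n l) w u : O n (l + wdeg w n - ldeg u) :=
  rco (qval (s n l a)) w u (l + wdeg w n - ldeg u).

(** The Koszul sign of (E (x) c) applied to (w_1 (x) x_1, ..., w_n (x) x_n): [bil] moves the letters
    in front of the elements, then the coefficient c, of degree l + |w| - |u|, moves past all the
    letters. *)
Definition pexp n l (X : 'I_n -> hel pdg) (w : word) (u : letter) : int :=
  (l + wdeg w n - ldeg u) * wdeg w n +
  bil n (fun t => hdeg X t - ldeg (w t)) (ldegw w).

Definition pterm n l (a : O n l) (X : 'I_n -> hel pdg) u j (w : word) : A j :=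
  sgn (pexp l X w u) *: tact (cf a w u) (pcs X w) j.

Definition path_act n l (a : O n l) X u j : A j := wsum n (pterm a X u j).

Lemma hdeg_pcs n (X : 'I_n -> hel pdg) w t : (t < n)%N ->
  hdeg (pcs X w) t = hdeg X t - ldeg (w t).
Proof. by move=> tn; rewrite -[t]/(val (Ordinal tn)) !hdeg_ord. Qed.

Lemma sum_pcs n (X : 'I_n -> hel pdg) w :
  \sum_(i < n) tag (pcs X w i) = \sum_(i < n) tag (X i) - wdeg w n.
Proof. by rewrite sumrB /wdeg big_mkord. Qed.

Lemma pterm_inv n l (a : O n l) X u j : winv n (pterm a X u j).
Proof.
move=> v w vw; rewrite /pterm /pexp /cf (wdeg_eq vw).
rewrite (normal_local (qvalN (s n l a)) _ _ vw).
have -> : pcs X v = pcs X w by apply: funext => i; rewrite /pcs vw.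
congr (sgn (_ + _) *: _); apply: bil_eq => x xn; by rewrite /ldegw vw.
Qed.

Lemma pterm_ne n l (a : O n l) X u j w :
  j != l + \sum_(i < n) tag (X i) - ldeg u -> pterm a X u j w = 0.
Proof.
move=> ne; rewrite /pterm tact_ne ?scaler0 // sum_pcs.
by apply: contraNneq ne => ->; apply/eqP; ring.
Qed.

Definition pact : action_on O pdg := fun n l a X m e =>
  (path_act a X L1 m, path_act a X Lt m, path_act a X Lh (m - 1)).

Lemma pget_act n l (a : O n l) (X : 'I_n -> hel pdg) m
  (e : m = l + \sum_(i < n) tag (X i)) u j :
  pget (@pact n l a X m e : pmod m) u j = path_act a X u j.
Proof.
have [->|jm] := eqVneq j (m - ldeg u); last first.
  by rewrite pget_ne // /path_act /wsum big1 // => w _; rewrite pterm_ne -?e.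
by case: u => [[]|] /=; rewrite ?subr0 dcast_id.
Qed.

Lemma cf_lin n l c (a b : O n l) w u : cf (c *: a + b) w u = c *: cf a w u + cf b w u.
Proof. by rewrite /cf ((oh_chain s n).1 l c a b). Qed.

Lemma pact_linl n l (X : 'I_n -> hel pdg) m (e : m = l + \sum_(i < n) tag (X i)) :
  linear (fun a : O n l => @pact n l a X m e).
Proof.
move=> c a b; apply: pget_inj => u j.
rewrite (pget_linear u j c (@pact n l a X m e) (@pact n l b X m e)) !pget_act.
rewrite /path_act /wsum scaler_sumr -big_split; apply: eq_bigr => w _ /=.
rewrite /pterm cf_lin (tact_linl (pcs X (nw w)) j c) scalerDr !scalerA.
by rewrite mulrC.
Qed.

Lemma pcs_upd n (X : 'I_n -> hel pdg) i U w :
  pcs (upd X i U) w = upd (pcs X w) i (pc U (w i)).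
Proof. by apply: funext => j; rewrite /pcs /upd; case: eqP => // ->. Qed.

Lemma hdeg_upd n (X : 'I_n -> hel pdg) i k (U V : pdg k) :
  hdeg (upd X i (mkhel U)) = hdeg (upd X i (mkhel V)).
Proof.
apply: funext => t; rewrite /hdeg; case: insub => // j.
by rewrite /upd; case: eqP.
Qed.

Lemma pterm_upd_linear n l (a : O n l) (X : 'I_n -> hel pdg) i k u j w :
  linear (fun U : pmod k => pterm a (upd X i (mkhel (U : pdg k))) u j w).
Proof.
move=> c U V; rewrite /pterm !pcs_upd /pexp.
rewrite !(hdeg_upd X i (_ : pdg k) (0 : pdg k)) /pc /=.
rewrite (pget_linear (w i) (k - ldeg (w i)) c U V).
rewrite (tact_linr (cf a w u) (pcs X w) i j c) scalerDr !scalerA.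
by rewrite mulrC.
Qed.

Lemma pact_linr n l (a : O n l) (X : 'I_n -> hel pdg) (i : 'I_n)
    k (c : R) (U V : pdg k) m
    (e : m = l + \sum_(j < n) tag (upd X i (mkhel (c *: U + V)) j))
    (eu : m = l + \sum_(j < n) tag (upd X i (mkhel U) j))
    (ev : m = l + \sum_(j < n) tag (upd X i (mkhel V) j)) :
    @pact n l a _ m e = c *: @pact n l a _ m eu + @pact n l a _ m ev.
Proof.
apply: pget_inj => u j.
rewrite (pget_linear u j c (@pact n l a _ m eu) (@pact n l a _ m ev)) !pget_act.
rewrite /path_act /wsum scaler_sumr -big_split; apply: eq_bigr => w _ /=.
exact: (pterm_upd_linear a X i u j (nw w) c U V).
Qed.

Lemma mkhel_dgd (B : dgmod R) (f : forall j, B j) j j' : j' = j + 1 ->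
  mkhel (dgd B (esym (subrK 1 j')) (f (j' - 1))) = hd (mkhel (f j)).
Proof.
move=> E; subst j'; rewrite /hd /=; congr mkhel.
have E : j + 1 - 1 = j by rewrite addrK.
move: (esym _); rewrite E => e; congr dgd; exact: Prop_irrelevance.
Qed.

Lemma mkhel_at (B : dgmod R) (f : forall j, B j) j j' : j = j' -> mkhel (f j) = mkhel (f j').
Proof. by move=> ->. Qed.

Lemma tact_pc_hd n l (a : O n l) (x : 'I_n -> hel A) i (X : hel pdg) v j :
  tact a (upd x i (pc (hd X) v)) j =
  (if v == Lh then tact a (upd x i (pc X Lt)) j else 0) +
  sgn (ldeg v) *: tact a (upd x i (hd (pc X v))) j.
Proof.
case: X => k X; rewrite /pc /= pget_d.
have L := tact_linr a x i j (k := k + 1 - ldeg v).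
rewrite (linear_funD L) (linear_funZ L).
rewrite (@mkhel_dgd A (fun j => pget X v j) (k - ldeg v)); last by ring.
congr (_ + _); case: eqP => [->|_]; last exact: (linear_fun0 L).
congr (tact a (upd x i _) j); apply: (@mkhel_at A (fun j => pget X Lt j)); rewrite /=; ring.
Qed.

Lemma pact_d n l (a : O n l) (X : 'I_n -> hel pdg) l' m m'
    (e : m = l + \sum_(i < n) tag (X i)) (em : m' = m + 1) (el : l' = l + 1)
    (e0 : m' = l' + \sum_(i < n) tag (X i))
    (e1 : forall i, m' = l + \sum_(j < n) tag (upd X i (hd (X i)) j)) :
    dgd pdg em (@pact n l a X m e) =
    @pact n l' (dgd (O n) el a) X m' e0 +
    \sum_(i < n) sgn (l + \sum_(j < n | (j < i)%N) tag (X j)) *: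
       @pact n l a (upd X i (hd (X i))) m' (e1 i).
Proof.
subst l'; apply: pget_inj => u j.
rewrite (linear_funD (pget_linear u j)) (linear_fun_sum (pget_linear u j)).
rewrite [LHS](pget_d em (@pact n l a X m e)) !pget_act.
under eq_bigr => i _ do rewrite (linear_funZ (pget_linear u j)) pget_act.
pose T1 w := if u == Lh then pterm a X Lt j w else 0.
pose T2 w := sgn (ldeg u + pexp l X w u) *:
   tact (dgd (O n) erefl (cf a w u)) (pcs X w) j.
pose T3 (i : 'I_n) (w : word) := sgn (ldeg u + pexp l X w u +
      (l + wdeg w n - ldeg u + pre (hdeg (pcs X w)) i)) *:
   tact (cf a w u) (upd (pcs X w) i (hd (pcs X w i))) j.
pose N (i : 'I_n) (w : word) := if w i == Lt then
   sgn (pexp (l + 1) X w u + (ldeg u - wdeg w n) + wdeg w i) *: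
   tact (rco (qval (s n l a)) (updw w i Lh) u (l + 1 + wdeg w n - ldeg u)) (pcs X w) j
   else 0.
pose F (i : 'I_n) (w : word) := sgn (l + pre (hdeg X) i + pexp l (upd X i (hd (X i))) w u) *:
   tact (cf a w u) (upd (pcs X w) i (pc (X i) Lt)) j.
have hX' i t : hdeg (upd X i (hd (X i))) t = if t == i then hdeg X t + 1 else hdeg X t.
  rewrite /hdeg; case: insubP => [q _ <-|tn]; last first.
    by rewrite ifF //; apply: contraNF tn => /eqP ->.
  by rewrite /upd -val_eqE; case: eqP => // /val_inj ->.
have LHS_E : (if u == Lh then path_act a X Lt j else 0) +
    sgn (ldeg u) *: dgd A (esym (subrK 1 j)) (path_act a X u (j - 1)) =
    wsum n T1 + wsum n T2 + \sum_(i < n) wsum n (T3 i).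
  rewrite -addrA; congr (_ + _).
    by rewrite /T1 /path_act /wsum; case: ifP => _ //; rewrite big1.
  rewrite /path_act (linear_fun_sum (dgd_linear _)) scaler_sumr.
  rewrite /wsum exchange_big -big_split; apply: eq_bigr => w _ /=.
  rewrite /pterm (linear_funZ (dgd_linear _)) (tact_d _ _ _ erefl).
  rewrite scalerA -sgnD scalerDr; congr (_ + _).
  rewrite scaler_sumr; apply: eq_bigr => i _.
  by rewrite scalerA -sgnD pre_hdeg // ltnW.
have R1 : path_act (dgd (O n) (erefl (l + 1)) a) X u j =
    wsum n T1 + (\sum_(i < n) wsum n (N i) + wsum n T2).
  rewrite /wsum exchange_big -!big_split.
  apply: eq_bigr => w0 _ /=; set w := nw w0.
  rewrite /pterm /cf ((oh_chain s n).2 l _ erefl a) /= rcod.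
  have EL : l + 1 + wdeg w n - ldeg u = l + wdeg w n - ldeg u + 1 by ring.
  have L k := @tact_linl _ _ A n k (pcs X w) j.
  have W1 : pexp (l + 1) X w u = pexp l X w u + wdeg w n by rewrite /pexp; ring.
  rewrite EL (linear_funD (L _)) (linear_funZ (L _)) (linear_funD (L _)).
  rewrite !scalerDr !scalerA -!sgnD; congr (_ + (_ + _)).
  - rewrite /T1; case: eqP => [uh|_]; last by rewrite (linear_fun0 (L _)) scaler0.
    rewrite /pterm /cf; have -> : l + wdeg w n - ldeg u + 1 = l + wdeg w n - ldeg Lt.
      by rewrite uh /=; ring.
    by rewrite W1 uh /pexp /=; congr (sgn _ *: _); ring.
  - rewrite (linear_fun_sum (L _)) scaler_sumr big_mkord; apply: eq_bigr => i _.
    rewrite /N; case: eqP => _; last by rewrite (linear_fun0 (L _)) scaler0.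
    by rewrite (linear_funZ (L _)) scalerA -sgnD EL.
  - rewrite /T2 /cf (rco_d _ _ _ (erefl (l + wdeg w n - ldeg u + 1))) W1.
    by congr (sgn _ *: _); ring.
have bil_add1 (i : 'I_n) (g b : nat -> int) :
    bil n (fun t => if t == i then g t + 1 else g t) b = bil n g b + (pre b n - pre b i.+1).
  have im := ltn_ord i; rewrite /bil !(sum_pluck _ im).
  have pE t : pre (fun t => if t == i then g t + 1 else g t) t =
      pre g t + (if (i < t)%N then 1 else 0).
    rewrite /pre; case: ifP => it; last first.
      by rewrite addr0; apply: eq_big_nat => q /andP[_ qt]; rewrite ifF //; lia.
    rewrite !(sum_pluck _ it) eqxx.
    rewrite (@eq_big_nat _ _ _ 0 i _ g) => [|q /andP[_ qi]]; last by rewrite ifF //; lia.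
    rewrite (@eq_big_nat _ _ _ i.+1 t _ g) => [|q /andP[iq _]]; last by rewrite ifF //; lia.
    ring.
  have -> : pre b n - pre b i.+1 = \sum_(i.+1 <= q < n) b q.
    rewrite /pre (sum_pluck _ im) big_nat_recr //=; ring.
  rewrite !pE ltnn addr0.
  rewrite (@eq_big_nat _ _ _ 0 i _ (fun q => pre g q * b q)); last first.
    by move=> q /andP[_ qi]; rewrite pE ifF ?addr0 //; lia.
  rewrite (@eq_big_nat _ _ _ i.+1 n _ (fun q => pre g q * b q + b q)); last first.
    by move=> q /andP[iq _]; rewrite pE iq; ring.
  rewrite big_split /=; ring.
have R2 (i : 'I_n) : sgn (l + \sum_(q < n | (q < i)%N) tag (X q)) *:
     path_act a (upd X i (hd (X i))) u j =
   wsum n (fun w => if w i == Lh then F i w else 0) + wsum n (T3 i).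
  rewrite pre_hdeg ?(ltnW (ltn_ord i)) //.
  rewrite /path_act /wsum scaler_sumr -big_split; apply: eq_bigr => w0 _ /=; set w := nw w0.
  rewrite /pterm pcs_upd tact_pc_hd scalerA -sgnD scalerDr.
  congr (_ + _); first by rewrite /F; case: ifP => // _; rewrite scaler0.
  rewrite scalerA -sgnD /T3; congr (sgn _ *: _).
  have -> : pre (hdeg (pcs X w)) i = pre (hdeg X) i - wdeg w i.
    rewrite /pre /wdeg -sumrB; apply: eq_big_nat => t /andP[_ ti].
    by rewrite hdeg_pcs // (ltn_trans ti).
  rewrite /pexp (@bil_eq n _ (fun t => if t == i :> nat then (hdeg X t - ldeg (w t)) + 1
     else hdeg X t - ldeg (w t)) _ (ldegw w)) //; last first.
    by move=> t _; rewrite hX'; case: eqP => // _; ring.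
  rewrite bil_add1.
  have -> : pre (ldegw w) n = wdeg w n by [].
  have -> : pre (ldegw w) i.+1 = wdeg w i + ldeg (w i).
    by rewrite /pre big_nat_recr.
  ring.
(* The terms of [rd] in which the i-th input turns from t to h cancel those in which the
   differential of the i-th argument turns its t component into an h component; [wsum_toggle] pairs
   them. *)
have NF (i : 'I_n) : wsum n (N i) + wsum n (fun w => if w i == Lh then F i w else 0) = 0.
  have Finv : winv n (fun w => - F i w).
    move=> v w vw; congr (- _); rewrite /F /pexp /cf (wdeg_eq vw).
    rewrite (normal_local (qvalN (s n l a)) _ _ vw).
    have -> : pcs X v = pcs X w by apply: funext => q; rewrite /pcs vw.
    congr (sgn (_ + (_ + _)) *: _); apply: bil_eq => x xn; by rewrite /ldegw vw.
  have -> : wsum n (fun w => if w i == Lh then F i w else 0) =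
     - wsum n (fun w => if w i == Lh then - F i w else 0).
    by rewrite /wsum -sumrN; apply: eq_bigr => w _; case: ifP; rewrite ?opprK ?oppr0.
  rewrite -(wsum_toggle Lt Lh (ltn_ord i) Finv).
  apply/eqP; rewrite subr_eq0; apply/eqP; apply: eq_bigr => w0 _; set w := nw w0.
  rewrite /N; case: eqP => // wi; rewrite /F -scaleNr.
  have Wd : wdeg (updw w i Lh) n = wdeg w n + 1 by rewrite wdeg_updw // wi /=; ring.
  have -> : upd (pcs X (updw w i Lh)) i (pc (X i) Lt) = pcs X w.
    apply: funext => q; rewrite /upd /pcs /updw; case: eqP => [->|qi]; first by rewrite wi.
    by rewrite ifF //; apply/eqP => /val_inj.
  rewrite /cf Wd.
  have -> : l + (wdeg w n + 1) - ldeg u = l + 1 + wdeg w n - ldeg u by ring.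
  congr (_ *: _).
  apply: (@sgnS _ _ _ (ldeg u - wdeg w n - l + wdeg w i - pre (hdeg X) i - 1)).
  rewrite /pexp Wd.
  have -> : bil n (fun t => hdeg (upd X i (hd (X i))) t - ldeg (updw w i Lh t))
      (ldegw (updw w i Lh)) =
     bil n (fun t => hdeg X t - ldeg (w t)) (ldegw w) +
     (pre (hdeg X) i - wdeg w i).
    have im := ltn_ord i.
    rewrite (@bil_eq n _ (fun t => hdeg X t - ldeg (w t)) _ (ldegw (updw w i Lh))) //; last first.
      move=> t _; rewrite hX' /updw; case: eqP => // ->; rewrite wi /=; ring.
    rewrite /bil !(sum_pluck _ im).
    rewrite (@eq_big_nat _ _ _ 0 i _ (fun t => pre (fun t => hdeg X t - ldeg (w t)) t * ldegw w t)); last first.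
      by move=> q /andP[_ qi]; rewrite /ldegw /updw ifF //; lia.
    rewrite (@eq_big_nat _ _ _ i.+1 n _ (fun t => pre (fun t => hdeg X t - ldeg (w t)) t * ldegw w t)); last first.
      by move=> q /andP[iq _]; rewrite /ldegw /updw ifF //; lia.
    have -> : ldegw (updw w i Lh) i = 1 by rewrite /ldegw /updw eqxx.
    have -> : ldegw w i = 0 by rewrite /ldegw wi.
    have -> : pre (hdeg X) i - wdeg w i = pre (fun t => hdeg X t - ldeg (w t)) i.
      by rewrite /pre sumrB.
    ring.
  ring.
rewrite LHS_E R1 (eq_bigr _ (fun i _ => R2 i)) big_split /=.
set b := wsum n T1; set c := wsum n T2; set d := \sum_(i < n) wsum n (T3 i).
set f := \sum_(i < n) wsum n (N i); set g := \sum_(i < n) _.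
have fg : f + g = 0 by rewrite /f /g -big_split big1 // => i _; apply: NF.
transitivity (b + c + d + (f + g)); first by rewrite fg addr0.
by zac.
Qed.

Lemma pact_perm n l (a : O n l) (t : 'S_n) (X : 'I_n -> hel pdg) m
    (e : m = l + \sum_(i < n) tag (X i))
    (es : m = l + \sum_(i < n) tag (X (t i))) :
    @pact n l (op_act O t a) X m e =
    sgn (\sum_(i < n) \sum_(j < n | (i < j)%N && (t j < t i)%N)
           tag (X (t i)) * tag (X (t j))) *:
      @pact n l a (fun i => X (t i)) m es.
Proof.
have -> : \sum_(i < n) \sum_(j < n | (i < j)%N && (t j < t i)%N)
           tag (X (t i)) * tag (X (t j)) = kos t (hdeg X).
  rewrite /kos big_mkord; apply: eq_bigr => i _.
  rewrite big_mkord [LHS]big_mkcond; apply: eq_bigr => j _.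
  by rewrite !pn_ord !hdeg_ord.
apply: pget_inj => u j; rewrite (linear_funZ (pget_linear u j)) !pget_act.
rewrite /path_act [in RHS](wsum_perm t (@pterm_inv n l a (fun i => X (t i)) u j)).
rewrite /wsum scaler_sumr; apply: eq_bigr => w0 _; set w := nw w0.
rewrite /pterm /cf (oh_act s t a) /= rcoA -(wdeg_pw t w).
rewrite (linear_funZ (tact_linl _ _)) tact_perm !scalerA -!sgnD.
have -> : (fun i => pcs X w (t i)) = pcs (fun i => X (t i)) (pw t w).
  by apply: funext => i; rewrite /pcs /pw pn_ord.
congr (_ *: _).
pose d x := hdeg X x - ldeg (w x).
have Eh : kos t (hdeg (pcs X w)) = kos t d.
  by apply: kos_eq => x xn; rewrite hdeg_pcs.
have Ed : kos t (hdeg X) = kos t (fun x => d x + ldegw w x).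
  by apply: kos_eq => x xn; rewrite /d /ldegw subrK.
have Eb : bil n (fun x => hdeg (fun i => X (t i)) x - ldeg (pw t w x)) (ldegw (pw t w)) =
    bil n (fun x => d (pn t x)) (fun x => ldegw w (pn t x)).
  apply: bil_eq => x xn //; rewrite /d /pw; congr (_ - _).
  by rewrite -[x]/(val (Ordinal xn)) pn_ord !hdeg_ord.
rewrite Eh Ed /pexp Eb wdeg_pw; set B := bil n _ (ldegw w); set B' := bil n _ _.
set P := (_ * _).
have -> : P + B + kos t (ldegw w) + kos t d = P + (kos t d + kos t (ldegw w) + B) by ring.
have K : sgn (kos t (fun x => d x + ldegw w x) + B') =
  sgn (kos t d + kos t (ldegw w) + B) :> R := kosD_sgn R t d (ldegw w).
rewrite (sgnD _ P) -K -sgnD; congr (sgn _); ring.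
Qed.

Lemma tact_one_dcast k (x : A k) j : tact (op_one O) (fun=> mkhel x) j = dcast j x.
Proof.
have [<-|kj] := eqVneq k j; first by rewrite tact_one dcast_id.
by rewrite dcast_ne // tact_ne // big_ord1 add0r eq_sym.
Qed.

Lemma pact_one k (U : pdg k) (e : k = 0 + \sum_(i < 1) tag (mkhel U)) :
  @pact 1%N 0 (op_one O) (fun=> mkhel U) k e = U.
Proof.
apply: pget_inj => u j; rewrite pget_act /path_act /wsum.
rewrite (bigD1 [ffun=> u]) //= [X in _ + X]big1 ?addr0; last first.
  move=> w wu; rewrite /pterm /cf (oh_one s) /= rco1.
  have -> : (nw w 0%N == u) = false.
    apply: contra_neqF wu => /eqP E; apply/ffunP => i.
    by rewrite ord1 !ffunE -E nwP; congr (w _); apply: val_inj.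
  by rewrite (linear_fun0 (tact_linl _ _)) scaler0.
set w := nw _; have w0 : w 0%N = u by rewrite /w nwP ffunE.
have Wd : wdeg w 1 = ldeg u by rewrite /wdeg big_nat1 w0.
rewrite /pterm /cf (oh_one s) /= rco1 w0 eqxx /pexp Wd.
have -> : 0 + ldeg u - ldeg u = 0 by ring.
rewrite tone0 mul0r /bil big_nat1 /pre big_nil mul0r sgn0 scale1r.
have -> : pcs (fun _ : 'I_1 => mkhel U) w =
    (fun _ : 'I_1 => mkhel (pget (U : pmod k) u (k - ldeg u))).
  by apply: funext => i; rewrite /pcs ord1 w0.
rewrite tact_one_dcast; have [->|jE] := eqVneq j (k - ldeg u); first by rewrite dcast_id.
by rewrite dcast_ne 1?eq_sym // pget_ne.
Qed.

(** [wsum_block] matches the summands. The exponents agree modulo 2 because [bil_block] splits the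
    sorting sign of the composite word into those of the two words plus the crossings between
    them. *)
Lemma pact_comp m n p (i : 'I_m) (h : arity m n i p) k l kl (ek : kl = k + l)
    (a : O m k) (b : O n l)
    (x : 'I_p -> hel pdg) (y : 'I_m -> hel pdg) (z : 'I_n -> hel pdg)
    w (ez : w = l + \sum_(j < n) tag (z j))
    q (ex : q = kl + \sum_(j < p) tag (x j))
    (ey : q = k + \sum_(j < m) tag (y j)) :
    (forall (j : 'I_n) (u : 'I_p), u = (i + j)%N :> nat -> z j = x u) ->
    (forall (j : 'I_m) (u : 'I_p), j != i -> outer n i j u -> y j = x u) ->
    y i = mkhel (@pact n l b z w ez) ->
    @pact p kl (op_comp O h ek a b) x q ex =
    sgn (l * \sum_(j < m | (j < i)%N) tag (y j)) *: @pact m k a y q ey.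
Proof.
move=> zx yx yi; have [im /eqP pmn] := andP h.
rewrite pre_hdeg ?(ltnW im) //.
apply: pget_inj => u j; rewrite (linear_funZ (pget_linear u j)) !pget_act.
pose f := qval (s m k a); pose g := qval (s n l b).
pose G W v := sgn (pexp kl x W u + cexp k m n i W u v) *:
  tact (tcomp h (kl + wdeg W p - ldeg u)
    (rco f (outw n i W v) u (k + wdeg (outw n i W v) m - ldeg u))
    (rco g (inw i W) v (l + wdeg (inw i W) n - ldeg v))) (pcs x W) j.
have LE : path_act (op_comp O h ek a b) x u j = wsum p (fun W => \sum_v G W v).
  apply: eq_bigr => W _; rewrite /pterm /cf (oh_comp s h ek a b) /= rcoC.
  rewrite (linear_fun_sum (tact_linl _ _)) scaler_sumr; apply: eq_bigr => v _.
  by rewrite (linear_funZ (tact_linl _ _)) scalerA -sgnD.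
have Ginv v : winv p (G^~ v).
  move=> V W VW; rewrite /G.
  have E1 : eqw n (inw i V) (inw i W) by move=> t tn; apply: VW; lia.
  have E2 : eqw m (outw n i V v) (outw n i W v).
    move=> t tm; rewrite /outw; case: ifP => ti; first by apply: VW; lia.
    by case: eqP => // ti'; apply: VW; lia.
  rewrite /cexp /pexp (wdeg_eq E1) (wdeg_eq E2) (wdeg_eq VW).
  have -> : wdeg V i = wdeg W i by apply: wdeg_eq => t ti; apply: VW; lia.
  rewrite (normal_local (qvalN (s m k a)) _ _ E2) (normal_local (qvalN (s n l b)) _ _ E1).
  have -> : pcs x V = pcs x W by apply: funext => t; rewrite /pcs VW.
  by congr (sgn (_ + _ + _) *: _); apply: bil_eq => t tn; rewrite /ldegw VW.
rewrite LE (wsum_block h Ginv) /path_act /wsum scaler_sumr.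
apply: eq_bigr => w10 _; set w1 := nw w10.
have slot : pcs y w1 i = mkhel (path_act b z (w1 i) (w - ldeg (w1 i))).
  by rewrite /pcs yi /pc /= (pget_act b ez).
rewrite /pterm -(upd_id (pcs y w1) i) slot /path_act /wsum.
rewrite (linear_fun_sum (tact_linr _ _ _ _)) !scaler_sumr.
apply: eq_bigr => w20 _; set w2 := nw w20; set v := w1 i.
rewrite /pterm (linear_funZ (tact_linr _ _ _ _)) !scalerA -!sgnD.
set W := glue n i w1 w2.
rewrite /G.
have Eo : outw n i W v = w1 by apply: glue_out h.
have Ei : eqw n (inw i W) w2 by apply: glue_in.
rewrite Eo (normal_local (qvalN (s n l b)) _ _ Ei) (wdeg_eq Ei).
have Wo := wdeg_outw W v h; rewrite Eo (wdeg_eq Ei) in Wo.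
have eW : kl + wdeg W p - ldeg u =
  (k + wdeg w1 m - ldeg u) + (l + wdeg w2 n - ldeg v) by rewrite Wo ek; ring.
rewrite (tcompE h eW).
set y' := upd _ i _.
have ez' : w - ldeg v = l + wdeg w2 n - ldeg v + \sum_(t < n) tag (pcs z w2 t).
  by rewrite sum_pcs ez; ring.
rewrite (@tact_comp _ _ A m n p i h _ _ _ eW _ _ (pcs x W) y' (pcs z w2) _ j ez'); first last.
- by rewrite /y' /upd eqxx.
- move=> t t' ti o; rewrite /y' /upd (negbTE ti) /pcs (yx t t' ti o); congr pc.
  move: o; rewrite /outer /W /glue; have := ltn_ord t; have := ltn_ord t'.
  have {}ti : t != i :> nat by [].
  move: (t : nat) (t' : nat) ti => T T' ti; case: ifP => Ti T'p Tm.
    by move/eqP->; rewrite Ti.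
  move/eqP => E; rewrite !ifF; [congr w1|..]; lia.
- move=> t t' E; rewrite /pcs (zx t t' E); congr pc.
  by rewrite E -(Ei t) //.
rewrite scalerA -sgnD; congr (_ *: _).
have D1 : pre (hdeg y') i = pre (hdeg y) i - wdeg w1 i.
  rewrite /pre /wdeg -sumrB; apply: eq_big_nat => t /andP[_ ti].
  have tm : (t < m)%N by lia.
  rewrite -[t]/(val (Ordinal tm)) !hdeg_ord /y' /upd ifF //.
  by apply/eqP => /(congr1 val) /=; lia.
have hyi : hdeg y i = l + pre (hdeg z) n by rewrite hdeg_ord yi /= ez sum_hdeg.
have Wi : wdeg W i = wdeg w1 i by rewrite -(wdeg_outw_pre W v n i) Eo.
have Win : pre (ldegw W) (i + n) = wdeg w1 i + wdeg w2 n.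
  by rewrite [LHS]wdeg_inw Wi (wdeg_eq Ei).
have BB := @bil_block m n i p (fun t => hdeg x t - ldeg (W t)) (ldegw W)
  (hdeg y i - ldeg v) (ldeg v) h.
have B1 : bil n (inwt i (fun t => hdeg x t - ldeg (W t))) (inwt i (ldegw W)) =
   bil n (fun t => hdeg z t - ldeg (w2 t)) (ldegw w2).
  apply: bil_eq => t tn; rewrite /inwt.
    have ixp : (i + t < p)%N by lia.
    rewrite -[W _]/(inw i W t) Ei //; congr (_ - _).
    rewrite -[(i + t)%N]/(val (Ordinal ixp)) -[t]/(val (Ordinal tn)) !hdeg_ord.
    by rewrite (zx _ (Ordinal ixp)).
  by rewrite /ldegw -[W _]/(inw i W t) Ei.
have yE t : (t < m)%N -> t != i -> hdeg y t = hdeg x (outi n i t).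
  move=> tm ti; have tp : (outi n i t < p)%N by move: ti; rewrite /outi; case: ifP; lia.
  have o : outer n i t (outi n i t) by rewrite /outer /outi; case: (ltnP t i) => /= ?; lia.
  rewrite -[t]/(val (Ordinal tm)) -[outi n i _]/(val (Ordinal tp)) !hdeg_ord.
  by rewrite (yx (Ordinal tm) (Ordinal tp)).
have w1E (t : nat) : t != i :> nat -> w1 t = W (outi n i t).
  move=> ti; move: (congr1 (fun F : word => F t) Eo).
  by rewrite /outw /outi (negbTE ti) /=; case: ifP.
have Bo t : (t < m)%N -> outwt n i (fun t => hdeg x t - ldeg (W t)) (hdeg y i - ldeg v) t =
   hdeg y t - ldeg (w1 t).
  move=> tm; have [->|ti] := eqVneq t i; first by rewrite /outwt ltnn eqxx.
  by rewrite (yE t tm ti) (w1E t ti) /outwt /outi (negbTE ti); case: ifP.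
have Bo' t : (t < m)%N -> outwt n i (ldegw W) (ldeg v) t = ldegw w1 t.
  move=> tm; rewrite /ldegw; have [->|ti] := eqVneq t i; first by rewrite /outwt ltnn eqxx.
  by rewrite (w1E t ti) /outwt /outi (negbTE ti); case: ifP.
have B2 := bil_eq Bo Bo'.
have P1 : pre (fun t => hdeg x t - ldeg (W t)) i = pre (hdeg y) i - wdeg w1 i.
  rewrite -(pre_outwt_lt _ (hdeg y i - ldeg v) n (leqnn i)).
  rewrite (@pre_eq _ (fun t => hdeg y t - ldeg (w1 t))) /pre ?sumrB //.
  by move=> t ti; apply: Bo; lia.
have P2 : pre (inwt i (ldegw W)) n = wdeg w2 n by rewrite -(wdeg_eq Ei).
have P3 : pre (inwt i (fun t => hdeg x t - ldeg (W t))) n = pre (hdeg z) n - wdeg w2 n.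
  rewrite (@pre_eq _ (fun t => hdeg z t - ldeg (w2 t))) /pre ?sumrB //.
  move=> t tn; rewrite /inwt -[W _]/(inw i W t) Ei //; congr (_ - _).
  have ixp : (i + t < p)%N by lia.
  rewrite -[(i + t)%N]/(val (Ordinal ixp)) -[t]/(val (Ordinal tn)) !hdeg_ord.
  by rewrite (zx _ (Ordinal ixp)).
have P4 : pre (ldegw W) p = wdeg W p by [].
rewrite B1 B2 P1 P2 P3 P4 Win hyi in BB.
apply: (@sgn_mod2 _ _ _ ((pre (hdeg y) i - wdeg w1 i) * (wdeg w2 n - ldeg v))).
have Wp : wdeg W p = wdeg w1 m + wdeg w2 n - ldeg v by rewrite Wo; ring.
rewrite /pexp BB D1 /cexp Eo (wdeg_eq Ei) Wi Wp ek; ring.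
Qed.

Fact path_axioms : opalg_axioms pact.
Proof.
split.
- exact: pact_linl.
- by move=> n l a X i k c U V m e eu ev; apply: pact_linr.
- exact: pact_d.
- exact: pact_perm.
- exact: pact_one.
- exact: pact_comp.
Qed.

Definition Path : opalg O := Opalg path_axioms.

End PathAlgebra.

(** * Evaluation at the ends of the interval *)

Section MultiExpand.
Variables (R : comPzRingType) (O : operad R) (A : opalg O).

(** Multilinear expansion, one argument at a time: after r steps the index runs over the words in 1
    and t that are 1 from place r on. Words containing h enter with value 0, to match the sums over
    all words in [path_act]. *)
Lemma tact_add_expand n l (a : O n l) (k : 'I_n -> int) (x : forall i, letter -> A (k i)) m :
  tact a (fun i => mkhel (x i L1 + x i Lt)) m =
  wsum n (fun w => if hasw Lh w n then 0 else tact a (fun i => mkhel (x i (w i))) m).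
Proof.
pose good r (w : word) := all (fun j => (w j != Lh) && ((r <= j)%N ==> (w j == L1))) (iota 0 n).
pose y r (w : word) (i : 'I_n) := if (i < r)%N then mkhel (x i (w i)) else mkhel (x i L1 + x i Lt).
pose T r (w : word) := tact a (y r w) m.
have goodP r w : reflect (forall j, (j < n)%N -> w j != Lh /\ ((r <= j)%N -> w j = L1)) (good r w).
  apply: (iffP allP) => [H j jn|H j].
    have := H j; rewrite mem_iota /= => /(_ jn) /andP[-> /implyP E].
    by split=> // rj; apply/eqP/E.
  by rewrite mem_iota /= => /H[-> E]; apply/implyP => /E ->.
have good_eq r v w : eqw n v w -> good r v = good r w.
  by move=> vw; apply: eq_in_all => j; rewrite mem_iota /= => jn; rewrite vw.
have claim r : (r <= n)%N -> tact a (fun i => mkhel (x i L1 + x i Lt)) m =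
    wsum n (fun w => if good r w then T r w else 0).
  elim: r => [_|r IHr rn].
    rewrite /wsum (bigD1 [ffun=> L1]) //= big1 ?addr0 => [|w w1].
      rewrite ifT /T //.
      by apply/goodP => j jn; rewrite nwP ffunE.
    case: ifP => // /goodP H; case/eqP: w1; apply/ffunP => i; rewrite ffunE.
    by have [_] := H i (ltn_ord i); rewrite nw_ord => ->.
  rewrite (IHr (ltnW rn)).
  pose F w := if good r.+1 w then T r.+1 w else 0.
  have Finv : winv n F.
    move=> v w vw; rewrite /F (good_eq _ _ _ vw) /T; case: ifP => // _.
    by congr (tact a _ m); apply: funext => i; rewrite /y vw.
  have -> : wsum n F = wsum n (fun w => if w r == L1 then F w else 0) +
                       wsum n (fun w => if w r == Lt then F w else 0).
    rewrite wsumD; apply: eq_bigr => w0 _; set w := nw w0.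
    case E: (w r) => [[]|] /=; rewrite ?addr0 ?add0r //.
    by rewrite /F ifF //; apply/negP => /goodP /(_ r rn)[]; rewrite E.
  rewrite -(wsum_toggle L1 Lt rn Finv) wsumD; apply: eq_bigr => w0 _; set w := nw w0.
  pose o := Ordinal rn.
  have g1 : good r w = (w r == L1) && good r.+1 w.
    apply/goodP/andP => [H|[/eqP wr /goodP H] j jn].
      split; first by apply/eqP; have [_] := H r rn; apply.
      by apply/goodP => j jn; have [h1 h2] := H j jn; split=> // rj; apply: h2; lia.
    have [h1 h2] := H j jn; split=> // rj.
    by have [->|jr] := eqVneq j r; [|apply: h2; lia].
  rewrite g1; case: eqP => wr /=; last by rewrite addr0.
  have g2 : good r.+1 (updw w r Lt) = good r.+1 w.
    apply/goodP/goodP => H j jn; have := H j jn; rewrite /updw;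
      (have [->|_ //] := eqVneq j r); rewrite ?wr ?eqxx; by split=> // ; lia.
  rewrite /F g2; case: ifP => _; last by rewrite addr0.
  have L := tact_linr a (y r w) o m (k := k o).
  have U u : upd (y r w) o (mkhel (x o u)) = y r.+1 (updw w r u).
    apply: funext => i; rewrite /upd /y ltnS.
    have [->|io] := eqVneq i o; first by rewrite leqnn /updw eqxx.
    have {}io : i != r :> nat by rewrite -val_eqE in io.
    by rewrite ltn_neqAle io /updw (negbTE io).
  rewrite /T -(upd_id (y r w) o) {2}/y ltnn (linear_funD L) !U; congr (tact a _ m + _).
  by apply: funext => i; rewrite /y /updw; case: ifP => //; case: eqP => // ->; rewrite wr.
rewrite (claim n) //; apply: eq_bigr => w0 _; set w := nw w0.
have -> : good n w = ~~ hasw Lh w n.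
  apply/goodP/idP => [H|/negP H j jn].
    by apply/negP => /haswP[j jn wj]; have [/eqP] := H j jn.
  split=> [|nj]; last by rewrite leqNgt jn in nj.
  by apply/eqP => wj; apply: H; apply/haswP; exists j.
by case: hasw => //=; congr (tact a _ m); apply: funext => i; rewrite /y ltn_ord.
Qed.

Lemma hom_tact (B : opalg O) (g : opalg_hom A B) n l (a : O n l) (x : 'I_n -> hel A) m :
  g m (tact a x m) = tact a (fun i => hmap g (x i)) m.
Proof.
have [e|e] := eqVneq m (l + \sum_(i < n) tag (x i)); last by rewrite !tact_ne // ah_zero.
by rewrite (tactE _ e) ah_act (tactE (A := B) _ (x := fun i => hmap g (x i)) e).
Qed.

Lemma hom_dcast (B : opalg O) (g : opalg_hom A B) k j (x : A k) :
  g j (dcast j x) = dcast j (g k x).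
Proof.
have [<-|kj] := eqVneq k j; first by rewrite !dcast_id.
by rewrite !dcast_ne // ah_zero.
Qed.

End MultiExpand.

Section Evaluations.
Variables (R : comPzRingType) (O : operad R) (s : operad_hom O (Qop O)).
Hypothesis sK : forall n k (a : O n k), Qproj O n k (s n k a) = a.
Variable A : opalg O.

(** Here the section property enters: the coefficient read by [Qproj] is the operation itself, so
    the evaluations at the ends respect the action of O. *)
Lemma cf_cw n l (a : O n l) j : rco (qval (s n l a)) cw L1 j = dcast j a.
Proof.
have [<-|lj] := eqVneq l j; first by rewrite dcast_id; apply: sK.
by rewrite dcast_ne // qproj_ne // eq_sym.
Qed.

Lemma tact_dcast n l l' (a : O n l) x m : l = l' ->
  tact (A := A) (dcast l' a) x m = tact a x m.
Proof. by move=> e; case: l' / e; rewrite dcast_id. Qed.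

Lemma pterm_nohasw n l (a : O n l) (X : 'I_n -> hel (pdg A)) u m w :
  ~~ hasw Lh w n -> u != Lh ->
  pterm s a X u m w = if (u == Lt) == hasw Lt w n then tact a (pcs X w) m else 0.
Proof.
move=> Hh uh; have W0 := wdeg_nohasw Hh.
have E0 : pexp l X w u = 0.
  rewrite /pexp W0 mulr0 add0r /bil big_nat_cond big1 // => t /andP[/andP[_ tn] _].
  rewrite /ldegw; case E: (w t) => [[]|]; rewrite ?mulr0 //.
  by case/negP: Hh; apply/haswP; exists t.
have nf := qvalN (s n l a).
have V j : rco (qval (s n l a)) w u j =
    if (u == Lt) == hasw Lt w n then dcast j a else 0.
  have C : rco (qval (s n l a)) cw L1 j = dcast j a by apply: cf_cw.
  case: u uh {E0} => [[]|] // _.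
    rewrite (normal_t nf w j) Hh C; by case: (hasw Lt w n).
  rewrite (normal_1 nf w j) Hh C; by case: (hasw Lt w n).
rewrite /pterm E0 sgn0 scale1r /cf V.
case: ifP => _; last exact: (linear_fun0 (tact_linl _ _)).
by apply: tact_dcast; rewrite W0 addr0; case: u uh {E0 V} => [[]|] // _; rewrite subr0.
Qed.

Lemma pterm_hasw n l (a : O n l) (X : 'I_n -> hel (pdg A)) u m w :
  hasw Lh w n -> u != Lh -> pterm s a X u m w = 0.
Proof.
move=> Hh uh; have nf := qvalN (s n l a).
have V j : rco (qval (s n l a)) w u j = 0.
  case: u uh => [[]|] // _; first by rewrite (normal_t nf w j) Hh.
  by rewrite (normal_1 nf w j) Hh.
by rewrite /pterm /cf V (linear_fun0 (tact_linl _ _)) scaler0.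
Qed.

Lemma pc_dcast k (X : pdg A k) u : u != Lh ->
  pc (mkhel X) u = mkhel (if u is Some false then X.1.2 else X.1.1).
Proof. by case: u => [[]|] // _; rewrite /pc /= mkhel_dcast //; ring. Qed.

(** Evaluation at t = 0; only the word 1 ... 1 has output 1. *)
Definition path_ev0 : opalg_hom (Path s A) A.
Proof.
refine (@OpalgHom R O (Path s A) A (fun k (X : Path s A k) => X.1.1) _ _).
  by split.
move=> n l a X m e; rewrite [LHS](_ : _ = path_act s a X L1 m) //.
rewrite /path_act /wsum (bigD1 [ffun=> L1]) //= big1 ?addr0.
  set w := nw _; have w1 : eqw n w cw by move=> t tn; rewrite /w nwP ffunE.
  rewrite pterm_nohasw ?(hasw_eq _ w1) ?hasw_cw //=.
  rewrite -(tactE (A := A) a (x := fun i => hmap (fun k (X : Path s A k) => X.1.1) (X i)) e).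
  congr (tact a _ m); apply: funext => i; rewrite /pcs w1 //.
  by case: (X i) => k x; rewrite pc_dcast.
move=> w w1; have [Hh|Hh] := boolP (hasw Lh (nw w) n); first by rewrite pterm_hasw.
rewrite pterm_nohasw //; have [//|/haswP Ht] := boolP (hasw Lt (nw w) n); case/eqP: w1.
apply/ffunP => i; rewrite ffunE -nw_ord; case E: (nw w i) => [[]|] //.
  by case/negP: Hh; apply/haswP; exists i.
by case: Ht; exists i.
Defined.

(** Evaluation at t = 1. A word in 1 and t contributes to exactly one of the outputs 1 and t, with
    the operation itself as coefficient, so the two outputs together form the full multilinear
    expansion. *)
Definition path_ev1 : opalg_hom (Path s A) A.
Proof.
refine (@OpalgHom R O (Path s A) A (fun k (X : Path s A k) => X.1.1 + X.1.2) _ _).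
  split=> [k c X Y|k l e X] /=.
    by rewrite scalerDr addrACA.
  by rewrite (linear_funD (dgd_linear _)).
move=> n l a X m e; rewrite [LHS](_ : _ = path_act s a X L1 m + path_act s a X Lt m) // /path_act wsumD.
rewrite -(tactE (A := A) a (x := fun i => hmap (fun k (X : Path s A k) => X.1.1 + X.1.2) (X i)) e).
pose x i (u : letter) : A (tag (X i)) := if u is Some false then (tagged (X i) : Path s A (tag (X i))).1.2 else (tagged (X i) : Path s A (tag (X i))).1.1.
rewrite [RHS](tact_add_expand a x m); apply: eq_bigr => w0 _; set w := nw w0.
have [Hh|Hh] := boolP (hasw Lh w n); first by rewrite !pterm_hasw ?addr0.
rewrite !pterm_nohasw //=.
have E : pcs X w = fun i => mkhel (x i (w i)).
  apply: funext => i; rewrite /pcs /x; case: (X i) => k U; rewrite pc_dcast //.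
  by apply/eqP => wi; case/negP: Hh; apply/haswP; exists i.
by rewrite E; case: (hasw Lt w n); rewrite ?addr0 ?add0r.
Defined.

End Evaluations.

Section PathMap.
Variables (R : comPzRingType) (O : operad R) (s : operad_hom O (Qop O)).
Variables (A B : opalg O) (g : opalg_hom A B).

Definition path_fun k (X : Path s A k) : Path s B k :=
  (g k X.1.1, g k X.1.2, g (k - 1) X.2).

Lemma pget_path k (X : Path s A k) u j :
  pget (path_fun X : pmod B k) u j = g j (pget (X : pmod A k) u j).
Proof. by case: u => [[]|] /=; rewrite hom_dcast. Qed.

Definition pathalg_map : opalg_hom (Path s A) (Path s B).
Proof.
refine (@OpalgHom R O (Path s A) (Path s B) path_fun _ _).
  split=> [k c X Y|k l e X].
    rewrite /path_fun /= !(ah_chain g).1 //.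
  rewrite /path_fun /= /pd /= !(ah_chain g).2 ah_add hom_dcast.
  by rewrite (linear_funN ((ah_chain g).1 _)) (ah_chain g).2.
move=> n l a X m e; apply: pget_inj => u j.
rewrite pget_path [oa_act _ _ _ _]/(pact s a e) pget_act.
have -> : oa_act (Path s B) a (fun i => hmap path_fun (X i)) e =
  @pact R O s B n l a (fun i => hmap path_fun (X i)) m e by [].
rewrite pget_act /path_act /wsum (linear_fun_sum ((ah_chain g).1 j)).
apply: eq_bigr => w0 _; set w := nw w0.
rewrite /pterm (linear_funZ ((ah_chain g).1 j)) hom_tact; congr (_ *: tact _ _ _).
apply: funext => i; rewrite /pcs /pc; case: (X i) => k U.
  by rewrite /hmap /= pget_path.
exact: e.
Defined.

End PathMap.

Arguments ua_alg_unit : simpl never.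

Section HomSub.
Variables (R : comPzRingType) (O : operad R) (A B : opalg O) (f : opalg_hom A B).

Lemma ah_opp k (x : A k) : f k (- x) = - f k x.
Proof. by rewrite -scaleN1r ah_scale scaleN1r. Qed.

Lemma ah_sub k (x y : A k) : f k (x - y) = f k x - f k y.
Proof. by rewrite ah_add ah_opp. Qed.

End HomSub.

(** * Contraction of the forms on a simplex *)

Section Unit.
Variables (R : comPzRingType) (O : uaoperad R).

Lemma com_mod_eq k (x y : com_mod R k) : k != 0 -> x = y.
Proof. by move=> k0; apply: com_val_inj; rewrite !com_val0. Qed.

Lemma ua_unit_cocycle : cocycle (ua_unit O).
Proof.
move=> l e; have [g gK _] := ua_aug0 O l.
by apply: (can_inj gK); apply: com_mod_eq; rewrite e.
Qed.

Lemma ua_alg_unit_d (B : opalg O) l (e : l = 0 + 1) : dgd B e (ua_alg_unit B) = 0.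
Proof.
have e0 : 0 = 0 + \sum_(i < 0) tag (mkhel (0 : B 0)) by rewrite big_ord0.
have -> : ua_alg_unit B = tact (A := B) (ua_unit O) (fun=> mkhel (0 : B 0)) 0.
  by rewrite tactE; apply: act_irr.
rewrite (tact_d _ _ _ e) ua_unit_cocycle big_ord0 addr0.
exact: (linear_fun0 (tact_linl _ _)).
Qed.

Lemma ua_alg_unit_hom (A B : opalg O) (f : opalg_hom A B) :
  f 0 (ua_alg_unit A) = ua_alg_unit B.
Proof. exact: (ua_alg_unit_morph (ah_act f)). Qed.

Lemma Omega_const_x m n (j i : 'I_n.+1) : Omega_map O (delta_const m j) 0 (Omega_x i) =
  if i == j then ua_alg_unit (Omega O m) else 0.
Proof.
rewrite Omega_map_x (eq_bigl (fun=> i == j)) => [|q]; last by rewrite eq_sym.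
case: (i == j); last by rewrite big_pred0.
exact: (cx_sum (Omega_coords O m)).
Qed.

End Unit.

Section Contraction.
Variables (R : comPzRingType) (O : uaoperad R) (s : operad_hom O (Qop O)).
Hypothesis sK : forall n k (a : O n k), Qproj O n k (s n k a) = a.

(** The two ends fix the components of 1 and t; the component of h vanishes because strict unitality
    forbids the output h on the empty word. *)
Lemma path_unit (B : opalg O) : ua_alg_unit (Path s B) = (ua_alg_unit B, 0, 0).
Proof.
pose U : pmod B 0 := ua_alg_unit (Path s B).
have E0 : U.1.1 = ua_alg_unit B := ua_alg_unit_hom (path_ev0 sK B).
have E1 : U.1.2 = 0.
  have E : U.1.1 + U.1.2 = ua_alg_unit B := ua_alg_unit_hom (path_ev1 sK B).
  by rewrite -(addKr U.1.1 U.1.2) E E0 addNr.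
have E2 : U.2 = 0.
  rewrite [LHS](_ : _ = path_act s (ua_unit O) (fun=> mkhel (0 : Path s B 0)) Lh (0 - 1)) //.
  rewrite /path_act /wsum big1 // => w _; rewrite /pterm /cf.
  have nf := qvalN (s 0%N 0 (ua_unit O)).
  rewrite (normal_local nf Lh _ (v := nw w) (w := cw)) // (normal_c nf).
  by rewrite (linear_fun0 (tact_linl _ _)) scaler0.
rewrite [LHS](_ : _ = U) //.
by case: U E0 E1 E2 => [[a b] c] /= -> -> ->.
Qed.

Variable n : nat.
Let A := Omega O n.

(* d_0i + t (x_i - d_0i) *)
Definition cone_x (i : 'I_n.+1) : Path s A 0 :=
  let e := if i == ord0 then ua_alg_unit A else 0 in (e, Omega_x i - e, 0).

Lemma pmod_sum (B : opalg O) k (I : finType) (F : I -> pmod B k) :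
  \sum_i F i = (\sum_i (F i).1.1, \sum_i (F i).1.2, \sum_i (F i).2).
Proof.
by elim: index_enum => [|i r IHr]; rewrite ?big_nil // !big_cons IHr; case: (F i) => [[]].
Qed.

Fact cone_sum : \sum_i cone_x i = ua_alg_unit (Path s A).
Proof.
rewrite path_unit (pmod_sum (B := A)) /=.
have E : \sum_(i < n.+1) (if i == ord0 then ua_alg_unit A else 0) = ua_alg_unit A.
  by rewrite -big_mkcond big_pred1_eq.
by rewrite sumrB E (cx_sum (Omega_coords O n)) subrr big1.
Qed.

Definition cone_coords : coords n (Path s A).
Proof.
exists cone_x (fun i => dgd (Path s A) (esym (add0r 1)) (cone_x i)).
- by move=> i e; congr dgd; apply: Prop_irrelevance.
- exact: cone_sum.
- by rewrite -(linear_fun_sum (dgd_linear _)) cone_sum ua_alg_unit_d.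
Defined.

Definition cone k (v : A k) : A (k - 1) :=
  (Omega_lift cone_coords k v : pmod A k).2.

Lemma cone_ev0 k (v : A k) :
  (Omega_lift cone_coords k v : pmod A k).1.1 = Omega_map O (delta_const n ord0) k v.
Proof.
suff <- : opalg_comp (path_ev0 sK A) (Omega_lift cone_coords) = Omega_map O (delta_const n ord0) by [].
by apply: Omega_hom_eq => i; rewrite Omega_const_x /= omega_evE.
Qed.

Lemma cone_ev1 k (v : A k) : (Omega_lift cone_coords k v : pmod A k).1.1 +
  (Omega_lift cone_coords k v : pmod A k).1.2 = v.
Proof.
suff E : opalg_comp (path_ev1 sK A) (Omega_lift cone_coords) = opalg_id A.
  by have := congr1 (fun f : opalg_hom A A => f k v) E.
by apply: Omega_hom_eq => i /=; rewrite omega_evE /= addrC subrK.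
Qed.

(** The image X of a cocycle in the path object is closed, and the h component of dX = 0 says that
    the differential of [X.2] is [X.1.2], the difference of the values of X at the two ends. *)
Lemma cone_d k (v : A k) (e : k = k - 1 + 1) : cocycle v ->
  dgd A e (cone v) = v - Omega_map O (delta_const n ord0) k v.
Proof.
move=> vc; set X : pmod A k := Omega_lift cone_coords k v.
have -> : v - Omega_map O (delta_const n ord0) k v = X.1.2.
  by rewrite -cone_ev0 -/X -(cone_ev1 v) -/X -addrA addrC -addrA addNr addr0.
rewrite [cone v](_ : _ = X.2) //.
have := (ah_chain (Omega_lift cone_coords)).2 k (k + 1) erefl v.
rewrite vc ah_zero -/X => /(congr1 (fun Y : pmod A (k + 1) => Y.2)) H.
(* The h component of dX lies in degree k + 1 - 1, which is only provably k; generalising this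
   degree removes the cast. *)
have G j (ej : j = k) (e' : j = k - 1 + 1) :
    dcast j X.1.2 - dgd A e' X.2 = 0 -> dgd A e X.2 = X.1.2.
  case: j / {ej}(esym ej) e' => e'; rewrite dcast_id => /eqP.
  by rewrite subr_eq0 => /eqP ->; congr dgd; apply: Prop_irrelevance.
by apply: (G _ _ _ (esym H)); ring.
Qed.

End Contraction.

Section ConeNat.
Variables (R : comPzRingType) (O : uaoperad R) (s : operad_hom O (Qop O)).
Hypothesis sK : forall n k (a : O n k), Qproj O n k (s n k a) = a.

(** Both sides are h components of morphisms out of Omega_n, which are compared on the x_i. As [f]
    fixes the vertex 0, the units placed over that vertex correspond. *)
Lemma cone_nat m n (f : delta m n) : f ord0 = ord0 ->
  forall k (v : Omega O n k), cone sK (Omega_map O f k v) = Omega_map O f (k - 1) (cone sK v).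
Proof.
move=> f0 k v.
suff E : opalg_comp (Omega_lift (cone_coords sK m)) (Omega_map O f) =
    opalg_comp (pathalg_map s (Omega_map O f)) (Omega_lift (cone_coords sK n)).
  by have := congr1 (fun g : opalg_hom (Omega O n) (Path s (Omega O m)) =>
    (g k v : pmod (Omega O m) k).2) E.
apply: Omega_hom_eq => i.
rewrite [RHS](_ : _ = pathalg_map s (Omega_map O f) 0 (cone_x s i)); last first.
  exact: (congr1 (pathalg_map s (Omega_map O f) 0) (Omega_lift_x (cone_coords sK n) i)).
rewrite [LHS](_ : _ = Omega_lift (cone_coords sK m) 0 (Omega_map O f 0 (Omega_x i))) //.
rewrite Omega_map_x ah_sum (eq_bigr (@cone_x R O s m)) => [|j _]; last exact: (Omega_lift_x (cone_coords sK m)).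
pose e n (i : 'I_n.+1) : Omega O n 0 := if i == ord0 then ua_alg_unit (Omega O n) else 0.
have es : \sum_(j < m.+1 | f j == i) e m j = Omega_map O f 0 (e n i).
  rewrite /e -big_mkcondr; case: eqVneq => [->|i0].
    rewrite ua_alg_unit_hom (big_pred1 ord0) // => j /=.
    by case: (eqVneq j ord0) => [->|]; rewrite ?f0 ?eqxx ?andbF.
  rewrite ah_zero big_pred0 // => j; case: (eqVneq j ord0) => [->|_]; rewrite ?andbF //.
  by rewrite f0 eq_sym (negbTE i0).
rewrite [RHS](_ : _ = (Omega_map O f 0 (e n i), Omega_map O f 0 (Omega_x i - e n i), Omega_map O f (0 - 1) 0)) //.
rewrite big_mkcond (pmod_sum (B := Omega O m)).
have H (T : lmodType R) (p : pmod (Omega O m) 0 -> T) (q : 'I_m.+1 -> T) : linear p ->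
    (forall j, p (cone_x s j) = q j) ->
    \sum_(j < m.+1) p (if f j == i then cone_x s j else 0) = \sum_(j < m.+1 | f j == i) q j.
  move=> pl pq; rewrite [RHS]big_mkcond; apply: eq_bigr => j _; case: ifP => // _.
  exact: (linear_fun0 pl).
congr (_, _, _).
- by rewrite (H _ (fun X => X.1.1) (e m)) // es.
- rewrite (H _ (fun X => X.1.2) (fun j => Omega_x j - e m j)) // sumrB es.
  by rewrite -Omega_map_x -ah_sub.
- by rewrite (H _ (fun X => X.2) (fun=> 0)) // big1 // ah_zero.
Qed.

End ConeNat.

Lemma Omega_contraction (R : comPzRingType) (O : uaoperad R) :
  cofibrant (O : UAOp R) ->
  exists c : forall n k, Omega O n k -> Omega O n (k - 1),
    (forall n k (v : Omega O n k) (e : k = k - 1 + 1), cocycle v ->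
       dgd (Omega O n) e (c n k v) = v - Omega_map O (delta_const n ord0) k v) /\
    (forall m n (f : delta m n), f ord0 = ord0 ->
       forall k (v : Omega O n k), c m k (Omega_map O f k v) = Omega_map O f (k - 1) (c n k v)).
Proof.
move=> /cofibrant_section[s sK]; exists (fun n k => @cone R O s sK n k); split.
  by move=> n k v e; apply: cone_d.
by move=> m n f f0 k v; apply: cone_nat.
Qed.

(** * Multiplication of forms by functions *)

Section Product.
Variables (R : comPzRingType) (O : uaoperad R) (mu : O 2%N 0).
Hypothesis mu1 : ua_aug O 2%N 0 mu = com_elt 0 1.

Definition pair_in (A : opalg O) (x y : hel A) : 'I_2 -> hel A :=
  fun i => if i == ord0 then x else y.

(** Linearity in the function, naturality and the left unit law are what the extension of forms
    uses. *)
Definition umul (A : opalg O) k (x : A 0) (u : A k) : A k :=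
  tact mu (pair_in (mkhel x) (mkhel u)) k.

Lemma umul_linl (A : opalg O) k (u : A k) : linear (fun x => umul x u).
Proof.
move=> c x y; have := tact_linr mu (pair_in (mkhel (0 : A 0)) (mkhel u)) ord0 (k := 0) k c x y.
have E v : upd (pair_in (mkhel (0 : A 0)) (mkhel u)) ord0 (mkhel (v : A 0)) =
    pair_in (mkhel v) (mkhel u).
  by apply: funext => i; rewrite /upd /pair_in; case: eqP.
by rewrite !E.
Qed.

Lemma hom_umul (A B : opalg O) (f : opalg_hom A B) k (x : A 0) (u : A k) :
  f k (umul x u) = umul (f 0 x) (f k u).
Proof.
rewrite /umul hom_tact; congr (tact mu _ k).
by apply: funext => i; rewrite /pair_in; case: eqP.
Qed.

(** Inserting 1_0 in the first input of [mu] gives an operation of arity 1 and augmentation 1; the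
    augmentation is injective in arity 1, so this is the identity of O. *)
Lemma umul_unit (A : opalg O) k (u : A k) : umul (ua_alg_unit A) u = u.
Proof.
have h : arity 2 0 (@ord0 1) 1 by [].
have E : op_comp O h (esym (add0r 0)) mu (ua_unit O) = op_one O.
  have [g gK _] := ua_aug1 O 0; apply: (can_inj gK).
  rewrite oh_comp oh_one mu1 (svalP (cid (ua_unit_exists O))).
  by apply: com_val_inj; rewrite com_val_comp mulr1.
have := tact_one u; rewrite -E.
have ez : 0 = 0 + \sum_(j < 0) tag (mkhel (0 : A 0)) by rewrite big_ord0.
rewrite (@tact_comp _ _ A _ _ _ _ h _ _ _ _ mu (ua_unit O) (fun=> mkhel u)
  (pair_in (mkhel (ua_alg_unit A)) (mkhel u)) (fun=> mkhel (0 : A 0)) 0) //.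
- by rewrite mul0r sgn0 scale1r.
- by case.
- by move=> j v j0 _; rewrite /pair_in (negbTE j0).
- by rewrite /pair_in eqxx; congr mkhel; rewrite (tactE _ ez); apply: act_irr.
Qed.

Lemma umul_suml (A : opalg O) k (I : finType) (P : pred I) (F : I -> A 0) (u : A k) :
  umul (\sum_(i | P i) F i) u = \sum_(i | P i) umul (F i) u.
Proof. exact: (linear_fun_sum (umul_linl u)). Qed.

Lemma umul0 (A : opalg O) k (u : A k) : umul 0 u = 0.
Proof. exact: (linear_fun0 (umul_linl u)). Qed.

End Product.

(** * Extension of forms *)

Section GaussSeidel.
Variables (R : comPzRingType) (V : lmodType R) (I : eqType) (e : I -> V -> V) (t : I -> V).
Hypothesis e_linear : forall r, linear (e r).
Hypothesis e_idem : forall r v, e r (e r v) = e r v.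
Hypothesis e_comm : forall r q v, e r (e q v) = e q (e r v).

(* Each step of this Gauss-Seidel iteration corrects one component; commutation
   preserves those already corrected. *)
Fixpoint gs (L : seq I) : V :=
  if L is r :: L' then gs L' + t r - e r (gs L') else 0.

(** The product of the commuting projections 1 - e_r. It kills the image of every e_r and fixes what
    all e_r kill, so a sum of vectors in these images that is killed by all e_r is zero: the
    uniqueness argument for extensions. *)
Fixpoint gsN (L : seq I) (v : V) : V :=
  if L is r :: L' then gsN L' v - e r (gsN L' v) else v.

Lemma gs_e L : {in L, forall r, e r (t r) = t r} ->
  {in L &, forall r q, e r (t q) = e q (t r)} -> {in L, forall r, e r (gs L) = t r}.
Proof.
have B r u v : e r (u - v) = e r u - e r v.
  by rewrite (linear_funD (e_linear r)) (linear_funN (e_linear r)).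
elim: L => // q L IHL H1 H2 r /=.
have {}IHL : {in L, forall r, e r (gs L) = t r}.
  by apply: IHL => [p pL|p p' pL p'L]; [apply: H1|apply: H2]; rewrite inE ?pL ?p'L orbT.
rewrite B (linear_funD (e_linear r)) inE => /orP[/eqP ->|rL].
  by rewrite e_idem addrAC subrr add0r H1 ?mem_head.
by rewrite e_comm IHL // (H2 r q) ?mem_head ?inE ?rL ?orbT // addrK.
Qed.

(** Every term of the iteration lies in the image of some e_r, so a linear map that vanishes on
    these images vanishes on [gs L]. *)
Lemma gs_ker L (W : lmodType R) (T : V -> W) : linear T ->
  {in L, forall r, e r (t r) = t r} -> {in L, forall r v, T (e r v) = 0} -> T (gs L) = 0.
Proof.
move=> TL; elim: L => [|r L IHL] H1 H2 /=; first exact: linear_fun0.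
rewrite !(linear_funD TL) (linear_funN TL) -(H1 r) ?mem_head // !(H2 r) ?mem_head //.
by rewrite subr0 addr0 IHL // => q qL; [apply: H1|apply: H2]; rewrite inE qL orbT.
Qed.

Lemma gsN_linear L : linear (gsN L).
Proof.
elim: L => //= r L IHL c u v; rewrite IHL e_linear scalerBr.
by rewrite addrACA opprD.
Qed.

Lemma gsN_comm L r v : gsN L (e r v) = e r (gsN L v).
Proof.
elim: L => //= q L ->.
by rewrite (linear_funD (e_linear r)) (linear_funN (e_linear r)) e_comm.
Qed.

Lemma gsN_e L r v : r \in L -> gsN L (e r v) = 0.
Proof.
elim: L => // q L IHL; rewrite inE /= => /orP[/eqP <-|rL].
  by rewrite gsN_comm e_idem subrr.
by rewrite IHL // (linear_fun0 (e_linear q)) subrr.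
Qed.

Lemma gsN_id L v : {in L, forall r, e r v = 0} -> gsN L v = v.
Proof.
elim: L => //= r L IHL H; rewrite IHL => [|q qL]; last by apply: H; rewrite inE qL orbT.
by rewrite H ?mem_head ?subr0.
Qed.

Lemma gs_ind (P : V -> Prop) L : P 0 -> (forall u v, P u -> P v -> P (u + v)) ->
  (forall r v, P v -> P (- e r v)) -> {in L, forall r, P (t r)} -> P (gs L).
Proof.
move=> P0 PD Pe; elim: L => //= r L IHL Pt.
have Pg : P (gs L) by apply: IHL => q qL; apply: Pt; rewrite inE qL orbT.
by apply: (PD); [apply: (PD) => //; apply: Pt; rewrite mem_head | apply: Pe].
Qed.

End GaussSeidel.

(** * Collapses of a simplex onto its faces *)

Section Pull.
Variables (R : comPzRingType) (O : uaoperad R).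

(** The relations of Omega_n are symmetric in the vertices, so any map of vertices acts. The
    collapse of the complement of a face to a chosen vertex is in general not monotone. *)
Definition pull_coords m n (r : 'I_m.+1 -> 'I_n.+1) : coords n (Omega O m).
Proof.
exists (fun i => \sum_(j < m.+1 | r j == i) Omega_x j)
       (fun i => \sum_(j < m.+1 | r j == i) Omega_dx j).
- move=> i e; rewrite (linear_fun_sum (dgd_linear _)).
  by apply: eq_bigr => j _; apply: (cx_d (Omega_coords O m)).
- by rewrite -(cx_sum (Omega_coords O m)) [RHS](partition_big r predT).
- by rewrite -[RHS](cdx_sum (Omega_coords O m)) [RHS](partition_big r predT).
Defined.

Definition pull m n (r : 'I_m.+1 -> 'I_n.+1) : opalg_hom (Omega O n) (Omega O m) :=
  Omega_lift (pull_coords r).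

Lemma pull_x m n (r : 'I_m.+1 -> 'I_n.+1) i :
  pull r 0 (Omega_x i) = \sum_(j < m.+1 | r j == i) Omega_x j.
Proof. exact: Omega_lift_x. Qed.

Lemma pull_delta m n (f : delta m n) : Omega_map O f = pull f.
Proof. by apply: Omega_hom_eq => i; rewrite pull_x Omega_map_x. Qed.

Lemma pull_comp l m n (r : 'I_m.+1 -> 'I_n.+1) (q : 'I_l.+1 -> 'I_m.+1) k (v : Omega O n k) :
  pull q k (pull r k v) = pull (r \o q) k v.
Proof.
suff -> : pull (r \o q) = opalg_comp (pull q) (pull r) by [].
apply: Omega_hom_eq => i; rewrite pull_x.
rewrite [RHS](_ : _ = pull q 0 (pull r 0 (Omega_x i))) // pull_x.
rewrite ah_sum [LHS](partition_big q (fun j => r j == i)) //.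
apply: eq_bigr => j gj; rewrite pull_x; apply: eq_bigl => p /=.
by rewrite andbC; case: eqP => //= ->; rewrite (eqP gj) eqxx.
Qed.

Lemma pull_eq m n (r q : 'I_m.+1 -> 'I_n.+1) k (v : Omega O n k) :
  r =1 q -> pull r k v = pull q k v.
Proof. by move=> /funext ->. Qed.

Lemma pull_linear m n (r : 'I_m.+1 -> 'I_n.+1) k : linear (pull r k).
Proof. exact: (ah_chain (pull r)).1. Qed.

End Pull.

Section Retraction.
Variable n : nat.
Implicit Types (rho : {set 'I_n.+1}) (i j : 'I_n.+1).

(** The vertex j goes to the largest element of rho that is at most j, or to the least element of
    rho if there is none. *)
Lemma retraction_exists rho i : i \in rho ->
  exists g : delta n n, (forall j, g j \in rho) /\ {in rho, forall j, g j = j}.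
Proof.
move=> ir; case: (arg_minnP (fun x : 'I_n.+1 => x : nat) ir) => m0 m0r m0min.
have {}m0r : m0 \in rho := m0r.
pose P j x := (x \in rho) && (x <= maxn j m0)%N.
pose g j := [arg max_(x > m0 | P j x) (x : nat)].
have P0 j : P j m0 by rewrite /P m0r leq_maxr.
have gP j : P j (g j) /\ forall x, P j x -> (x <= g j)%N.
  by rewrite /g; case: (arg_maxnP (fun x : 'I_n.+1 => x : nat) (P0 j)).
have g_mono : {homo g : i j / (i <= j)%N}.
  move=> j q jq; have [/andP[gr gj] _] := gP j; have [_] := gP q; apply.
  by rewrite /P gr (leq_trans gj) // geq_max !leq_max jq leqnn orbT.
exists (Delta g_mono); split=> [j|j jr] /=; first by have [/andP[]] := gP j.
have [/andP[gr gj] H] := gP j; apply/val_inj/eqP; rewrite eqn_leq H ?andbT.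
  by move: gj; rewrite (maxn_idPl (m0min _ jr)).
by rewrite /P jr leq_maxl.
Qed.

(* A monotone retraction onto rho, the identity if rho is empty. *)
Definition retr rho : delta n n :=
  if pselect (exists g : delta n n, (forall j, g j \in rho) /\ {in rho, forall j, g j = j})
    is left e then sval (cid e) else delta_id n.

Lemma retr_in rho i j : i \in rho -> retr rho j \in rho.
Proof.
move=> /retraction_exists H; rewrite /retr; case: pselect => // e.
by case: (cid e) => g [].
Qed.

Lemma retr_id rho : {in rho, forall j, retr rho j = j}.
Proof.
move=> j jr; rewrite /retr; case: pselect => [e|//].
by case: (cid e) => g [gr H] /=; apply: H.
Qed.

(** Two such collapses to the same vertex compose to the one for the intersection of the faces;
    hence the induced operators on forms are commuting projections. *)
Definition coll i rho j : 'I_n.+1 := if j \in rho then j else i.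

Lemma coll_in i rho j : i \in rho -> coll i rho j \in rho.
Proof. by rewrite /coll; case: ifP. Qed.

Lemma coll_id i rho j : j \in rho -> coll i rho j = j.
Proof. by rewrite /coll => ->. Qed.

End Retraction.

(** The least preimage depends monotonically on the vertex. This exhibits the retraction onto the
    image of [s] as a restriction of [s], so it belongs to every sieve containing [s]. *)
Lemma monotone_section m n (s : delta m n) (rho : {set 'I_n.+1}) i :
  i \in rho -> (forall x, x \in rho -> exists a, s a = x) ->
  exists h : delta n m, forall j, s (h j) = retr rho j.
Proof.
move=> ir sr.
have ex j : exists a, s a == retr rho j.
  by have [a <-] := sr _ (retr_in j ir); exists a.
pose h j := [arg min_(a < xchoose (ex j) | s a == retr rho j) (a : nat)].
have hP j : s (h j) = retr rho j /\ forall a, s a = retr rho j -> (h j <= a)%N.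
  rewrite /h; case: (arg_minnP (fun a : 'I_m.+1 => a : nat) (xchooseP (ex j))).
  by move=> a /eqP sa amin; split=> // b /eqP; apply: amin.
have h_mono : {homo h : i j / (i <= j)%N}.
  move=> j q jq; have [sj jmin] := hP j; have [sq _] := hP q.
  have := dmap_mono (retr rho) jq; rewrite -sj -sq leq_eqVlt => /orP[/eqP/val_inj E|].
    by apply: jmin; rewrite -E.
  by rewrite ltnNge; apply: contraNleq => hqj; apply/dmap_mono/ltnW.
by exists (Delta h_mono) => j /=; have [] := hP j.
Qed.

Section Extension.
Variables (R : comPzRingType) (O : uaoperad R).

Definition sieve n (P : forall m, delta m n -> Prop) : Prop :=
  forall l m (s : delta m n) (f : delta l m), P m s -> P l (delta_comp s f).

(** [th] is given on all simplices, so that it does not depend on a proof of [P]; its values outside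
    the sieve are arbitrary. *)
Definition partial_form n k (P : forall m, delta m n -> Prop)
  (th : forall m, delta m n -> Omega O m k) : Prop :=
  forall l m (s : delta m n) (f : delta l m), P m s ->
    th l (delta_comp s f) = Omega_map O f k (th m s).

Section Fixed.
Variables (n : nat) (k : int) (i : 'I_n.+1) (P : forall m, delta m n -> Prop).
Variable th : forall m, delta m n -> Omega O m k.
Arguments P {m}. Arguments th {m}.

(** A face is represented by the monotone retraction onto it, an endomorphism of the simplex, so
    that the data on all faces lie in the same module. Only faces through i are kept, as the
    collapse to i fixes these pointwise and has its values in them. *)
Definition faces : seq {set 'I_n.+1} :=
  enum [pred rho : {set 'I_n.+1} | (i \in rho) && `[< P (retr rho) >]].

Definition th_face (rho : {set 'I_n.+1}) : Omega O n k :=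
  pull O (coll i rho) k (th (retr rho)).

Definition eface (rho : {set 'I_n.+1}) (v : Omega O n k) : Omega O n k :=
  pull O (coll i rho) k v.

Definition ext : Omega O n k := gs eface th_face faces.

Lemma facesP (rho : {set 'I_n.+1}) : reflect (i \in rho /\ P (retr rho)) (rho \in faces).
Proof.
rewrite mem_enum inE; apply: (iffP andP) => -[ir].
  by move=> /asboolP.
by move=> Pr; split=> //; apply/asboolP.
Qed.

Lemma eface_linear rho : linear (eface rho).
Proof. exact: pull_linear. Qed.

Lemma eface_comp (rho sig : {set 'I_n.+1}) v : eface rho (eface sig v) = eface (rho :&: sig) v.
Proof.
rewrite /eface pull_comp; apply: pull_eq => j /=; rewrite /coll inE.
by case: (j \in rho) => //=; case: ifP.
Qed.

Lemma eface_idem rho v : eface rho (eface rho v) = eface rho v.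
Proof. by rewrite eface_comp setIid. Qed.

Lemma eface_comm rho sig v : eface rho (eface sig v) = eface sig (eface rho v).
Proof. by rewrite !eface_comp setIC. Qed.

Lemma faceN_e rho v : rho \in faces -> gsN eface faces (eface rho v) = 0.
Proof. exact: (gsN_e eface_linear eface_idem eface_comm). Qed.

Hypothesis P_sieve : sieve (@P).
Hypothesis th_form : partial_form (@P) (@th).

Lemma sieve_retr m (s : delta m n) (rho : {set 'I_n.+1}) : (forall j, s j \in rho) -> P (retr rho) -> P s.
Proof.
move=> sr Pr; have := P_sieve s Pr.
have -> // : delta_comp (retr rho) s = s.
by apply: delta_eq => j /=; apply: retr_id.
Qed.

Lemma form_retr m (s : delta m n) (rho : {set 'I_n.+1}) : (forall j, s j \in rho) -> P (retr rho) ->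
  th s = Omega_map O s k (th (retr rho)).
Proof.
move=> sr Pr; rewrite -th_form //; congr th.
by apply: delta_eq => j /=; rewrite retr_id.
Qed.

Lemma th_coh m (r : 'I_m.+1 -> 'I_n.+1) (rho tau : {set 'I_n.+1}) :
  i \in tau -> tau \subset rho -> P (retr rho) -> (forall j, r j \in tau) ->
  pull O r k (th (retr rho)) = pull O r k (th (retr tau)).
Proof.
move=> it tr Pr rt; rewrite (form_retr (s := retr tau) _ Pr) => [|j]; last first.
  exact/(subsetP tr)/(retr_in j it).
rewrite pull_delta pull_comp; apply: pull_eq => j /=; by rewrite retr_id.
Qed.

Lemma th_face_idem : {in faces, forall rho, eface rho (th_face rho) = th_face rho}.
Proof. by move=> rho _; apply: eface_idem. Qed.

Lemma th_face_coh :
  {in faces &, forall rho sig, eface rho (th_face sig) = eface sig (th_face rho)}.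
Proof.
move=> rho sig /facesP[ir Pr] /facesP[is_ Ps]; rewrite /th_face.
have E r q v : eface r (pull O (coll i q) k v) = pull O (coll i (r :&: q)) k v.
  exact: eface_comp.
rewrite !E (setIC sig).
have it : i \in rho :&: sig by rewrite inE ir.
rewrite (th_coh it _ Ps) ?(th_coh it _ Pr) ?subsetIl ?subsetIr // => j; exact: coll_in.
Qed.

Lemma eface_ext (rho : {set 'I_n.+1}) : i \in rho -> P (retr rho) -> eface rho ext = th_face rho.
Proof.
move=> ir Pr; apply: (gs_e eface_linear eface_idem eface_comm th_face_idem th_face_coh).
by apply/facesP.
Qed.

(** The image of [s] is a face through i, and restriction along [s] sees only its vertices, where
    the collapse is the identity. *)
Lemma ext_face m (s : delta m n) : P s -> (exists a, s a = i) ->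
  Omega_map O s k ext = th s.
Proof.
move=> Ps [a sa]; pose rho := [set s b | b : 'I_m.+1].
have ir : i \in rho by rewrite -sa; apply: imset_f.
have sr b : s b \in rho by apply: imset_f.
have [h hE] : exists h : delta n m, forall j, s (h j) = retr rho j.
  by apply: (monotone_section ir) => x /imsetP[b _ ->]; exists b.
have Pr : P (retr rho).
  have := P_sieve h Ps; have -> // : delta_comp s h = retr rho.
  exact: delta_eq.
rewrite (form_retr sr Pr) pull_delta.
have E v : pull O s k v = pull O s k (eface rho v).
  by rewrite pull_comp; apply: pull_eq => j /=; rewrite coll_id.
by rewrite E eface_ext // -[RHS]E.
Qed.

End Fixed.

(** Pulling back along [f] carries the projection for rho at the vertex f a to the one for the
    preimage of rho at the vertex a. So both sides solve the same system and are sums of vectors in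
    the images of the projections at a. *)
Lemma ext_nat m n k (f : delta m n) (a : 'I_m.+1) (P : forall l, delta l n -> Prop)
  (th : forall l, delta l n -> Omega O l k) : sieve P -> partial_form P th ->
  Omega_map O f k (ext (f a) P th) =
  ext a (fun l s => P l (delta_comp f s)) (fun l s => th l (delta_comp f s)).
Proof.
move=> Ps thf; set P' := (fun l s => P l _); set th' := fun l s => _.
have DA l l' (s : delta l m) (g : delta l' l) :
    delta_comp f (delta_comp s g) = delta_comp (delta_comp f s) g by apply: delta_eq.
have Ps' : sieve P'.
  by move=> l l' s g; rewrite /P' DA; apply: Ps.
have thf' : partial_form P' th' by move=> l l' s g H; rewrite /th' DA thf.
pose L' := faces a P'.
have NL := gsN_linear (eface_linear a (k := k)) L'.
apply/eqP; rewrite -subr_eq0; apply/eqP.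
(* The difference is killed by all projections, which is checked last, hence fixed by [gsN]; but
   [gsN] kills both of its terms. *)
rewrite -[LHS](gsN_id (e := eface a) (L := L')) => [|sig /facesP[asig Psig]].
  rewrite (linear_funD NL) (linear_funN NL).
  rewrite (gs_ker (e := eface a) NL (th_face_idem _)) ?subr0; last first.
    by move=> sig sL v; apply: faceN_e.
  have TL : linear (fun v => gsN (eface a) L' (Omega_map O f k v)).
    by move=> c u v; rewrite (ah_chain _).1 NL.
  rewrite (gs_ker (e := eface (f a)) TL (th_face_idem _)) // => rho /facesP[fr Pr] v.
  pose sig := f @^-1: rho.
  have E : Omega_map O f k (eface (f a) rho v) = eface a sig (Omega_map O f k v).
    rewrite pull_delta /eface !pull_comp; apply: pull_eq => j /=.
    by rewrite /coll inE; case: ifP.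
  rewrite E; apply: faceN_e.
  have asig : a \in sig by rewrite inE.
  apply/facesP; split=> //; apply: (sieve_retr Ps (rho := rho)) => // j /=.
  by have := retr_in j asig; rewrite inE.
rewrite (linear_funD (eface_linear a sig)) (linear_funN (eface_linear a sig)).
rewrite (eface_ext thf') //; apply/eqP; rewrite subr_eq0; apply/eqP.
rewrite /th_face -[th' _ _](ext_face (i := f a) Ps thf) //; last first.
  by exists a => /=; rewrite retr_id.
rewrite /eface !pull_delta !pull_comp; apply: pull_eq => j /=.
by rewrite retr_id // coll_in.
Qed.

(** The extension arises from pullbacks of the prescribed forms by sums, differences and further
    pullbacks, all compatible with the differential. *)
Lemma ext_cocycle n k (i : 'I_n.+1) (P : forall m, delta m n -> Prop)
  (th : forall m, delta m n -> Omega O m k) :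
  (forall m (s : delta m n), P m s -> cocycle (th m s)) -> cocycle (ext i P th).
Proof.
move=> H l e; have dl := dgd_linear (d := Omega O n) e.
apply: (gs_ind (P := fun v : Omega O n k => dgd (Omega O n) e v = 0)).
- exact: linear_fun0.
- by move=> u v u0 v0; rewrite (linear_funD dl) u0 v0 addr0.
- by move=> r v v0; rewrite (linear_funN dl) /eface -(ah_chain _).2 v0 ah_zero oppr0.
- move=> rho /facesP[_ Pr]; rewrite /th_face -(ah_chain _).2.
  by rewrite (H _ _ Pr l e) ah_zero.
Qed.

End Extension.

(** * Forms extend along monomorphisms *)

Section FormExtension.
Variables (R : comPzRingType) (O : uaoperad R) (mu : O 2%N 0).
Hypothesis mu1 : ua_aug O 2%N 0 mu = com_elt 0 1.
Variables (X Y : sset) (h : smap X Y).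
Hypothesis h_inj : forall n, injective (h n).
Variables (k : int) (om : Defs.form O X k).

Definition in_im m (y : Y m) : Prop := exists x, h m x = y.

(** The value 0 off the image is a placeholder: the extension reads [im_val] only on simplices of
    the sieve [P]. *)
Definition im_val m (y : Y m) : Omega O m k :=
  if pselect (in_im y) is left e then om m (sval (cid e)) else 0.

Lemma im_valE m (x : X m) : im_val (h m x) = om m x.
Proof.
rewrite /im_val; case: pselect => [e|[]]; last by exists x.
by congr (om m _); apply: (@h_inj m); case: (cid e).
Qed.

Lemma im_val_act l m (f : delta l m) (y : Y m) : in_im y ->
  in_im (sact Y f y) /\ im_val (sact Y f y) = Omega_map O f k (im_val y).
Proof.
case=> x <-; rewrite -sm_nat !im_valE fval_nat.
by split=> //; exists (sact X f x).
Qed.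

Let P n (y : Y n) m (s : delta m n) := in_im (sact Y s y).
Let th n (y : Y n) m (s : delta m n) := im_val (sact Y s y).

Let P_sieve n (y : Y n) : sieve (P y).
Proof. by move=> l m s f; rewrite /P sact_comp => /(im_val_act f)[]. Qed.

Let th_form n (y : Y n) : partial_form (P y) (th y).
Proof. by move=> l m s f; rewrite /th sact_comp => /(im_val_act f)[]. Qed.

(** The extension from a vertex is natural only when vertices are matched. The pullback of x_i is
    the sum of the x_a with f a = i, so the weights pair the extension from f a with the one from a;
    on simplices in the image all extensions agree, and the weights add up to the unit. *)
Definition extend_val n (y : Y n) : Omega O n k :=
  \sum_i umul mu (Omega_x i) (ext i (P y) (th y)).

Lemma extend_val_nat m n (f : delta m n) (y : Y n) :
  extend_val (sact Y f y) = Omega_map O f k (extend_val y).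
Proof.
rewrite /extend_val ah_sum.
have E a : ext a (P (sact Y f y)) (th (sact Y f y)) = Omega_map O f k (ext (f a) (P y) (th y)).
  rewrite (ext_nat f a (@P_sieve _ y) (@th_form _ y)).
  congr ext; apply: functional_extensionality_dep => l; apply: funext => s.
    by rewrite /P sact_comp.
  by rewrite /th sact_comp.
rewrite (eq_bigr (fun i => \sum_(a | f a == i) umul mu (Omega_x a) (Omega_map O f k (ext (f a) (P y) (th y))))).
  rewrite [LHS](partition_big f predT) //; apply: eq_bigr => i _.
  by apply: eq_bigr => a _; rewrite E.
move=> i _; rewrite hom_umul Omega_map_x umul_suml.
by apply: eq_bigr => a /eqP ->.
Qed.

Lemma extend_val_im n (x : X n) : extend_val (h n x) = om n x.
Proof.
have E i : ext i (P (h n x)) (th (h n x)) = om n x.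
  rewrite -[ext _ _ _]Omega_map_id (ext_face (i := i) (@P_sieve _ _) (@th_form _ _)).
  - by rewrite /th sact_id im_valE.
  - by rewrite /P sact_id; exists x.
  - by exists i.
rewrite /extend_val (eq_bigr (fun i => umul mu (Omega_x i) (om n x))) => [|i _]; last by rewrite E.
by rewrite -umul_suml (cx_sum (Omega_coords O n)) umul_unit.
Qed.

Lemma form_extension : exists w : Defs.form O Y k, Form_map O h k w = om.
Proof.
exists (Form extend_val_nat); apply: form_eq => n x; exact: extend_val_im.
Qed.

End FormExtension.

(** * The Kan complex of cocycles *)

Section Cocycles.
Variables (R : comPzRingType) (O : uaoperad R) (k : int).

Lemma cocycle_hom (A B : opalg O) (f : opalg_hom A B) (v : A k) :
  cocycle v -> cocycle (f k v).
Proof. by move=> vc l e; rewrite -(ah_chain f).2 vc ah_zero. Qed.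

Definition Zset : sset.
Proof.
refine (@MkSSet (fun n => {v : Omega O n k | cocycle v})
  (fun m n f v => exist _ (Omega_map O f k (sval v)) (cocycle_hom _ (svalP v))) _ _).
- by move=> n [v vc]; apply: eq_exist; apply: Omega_map_id.
- by move=> l m n g f [v vc]; apply: eq_exist; apply: Omega_map_comp.
Defined.

Lemma Zset_eq n (v w : Zset n) : sval v = sval w -> v = w.
Proof. by case: v w => v vc [w wc] /= E; apply: eq_exist. Qed.

(** A simplex of the horn misses some vertex a other than i, so it lies in the facet opposite to a,
    which contains i. Hence the extension from i restricts correctly to the whole horn. *)
Lemma kan_Zset : kan_complex Zset.
Proof.
move=> n i f; set N := n.+1.
pose P m (s : delta m N) := in_horn i s.
pose th m (s : delta m N) : Omega O m k :=
  if pselect (P m s) is left e then sval (f m (exist _ s e)) else 0.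
have thE m s (e : P m s) : th m s = sval (f m (exist _ s e)).
  by rewrite /th; case: pselect => // e'; rewrite (Prop_irrelevance e e').
have Ps : sieve P.
  by move=> l m s g [a ai sa]; exists a => // j; apply: sa.
have thf : partial_form P th.
  move=> l m s g e; rewrite (thE _ _ e) (thE _ _ (Ps _ _ _ g e)).
  have := sm_nat f g (exist _ s e : horn i m) => /(congr1 sval) /= <-.
  by congr (sval (f l _)); apply: eq_exist.
have Ec : cocycle (ext i P th).
  by apply: ext_cocycle => m s e; rewrite (thE _ _ e); apply: svalP.
pose g m (s : simplex N m) : Zset m := exist _ (Omega_map O s k (ext i P th)) (cocycle_hom _ Ec).
have gn l m (q : delta l m) (s : simplex N m) : g l (sact (simplex N) q s) = sact Zset q (g m s).
  by apply: Zset_eq; apply: Omega_map_comp.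
exists (SMap gn); apply: smap_eq => m [s e]; apply: Zset_eq => /=.
have [a ai sa] := e; pose rho := ~: [set a].
have ir : i \in rho by rewrite !inE eq_sym.
have Pr : P _ (retr rho).
  by exists a => // j; have := retr_in j ir; rewrite !inE.
have sr j : s j \in rho by rewrite !inE.
rewrite -(thE _ _ e) (form_retr thf sr Pr) -(ext_face Ps thf Pr (i := i)); last first.
  by exists i; apply: retr_id.
rewrite -Omega_map_comp; congr (Omega_map O _ k _).
by apply: delta_eq => j /=; rewrite retr_id.
Qed.

End Cocycles.

(** * Forms on cones *)

Section Toggle.
Variables (R : comPzRingType) (V : lmodType R) (T : finType).

Definition csgn (S : {set T}) : R := (-1) ^+ #|S|.+1.

Lemma csgnU (t : T) (S : {set T}) : t \notin S -> csgn (t |: S) = - csgn S.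
Proof. by move=> tS; rewrite /csgn cardsU1 tS exprS mulN1r. Qed.

(** The pairing of S with t |: S reverses the sign. *)
Lemma sum_toggle (t : T) (P : pred {set T}) (F : {set T} -> V) :
  (forall S : {set T}, t \notin S -> P (t |: S) = P S) ->
  (forall S : {set T}, t \notin S -> P S -> F (t |: S) = F S) ->
  \sum_(S | P S) csgn S *: F S = 0.
Proof.
move=> HP HF; rewrite (bigID (fun S : {set T} => t \in S)) /=.
rewrite (reindex_onto (fun S : {set T} => t |: S) (fun S : {set T} => S :\ t)) /=; last first.
  by move=> S /andP[_ tS]; rewrite setD1K.
rewrite [X in X + _](eq_bigl (fun S : {set T} => P S && (t \notin S))) => [|S]; last first.
  rewrite setU11 andbT; case tS: (t \in S) => /=.
    rewrite andbF; apply/negP => /andP[_ /eqP E].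
    by move: tS; rewrite -E !inE eqxx.
  by rewrite HP ?tS // setU1K ?tS // eqxx !andbT.
rewrite -big_split big1 //= => S /andP[PS tS].
by rewrite csgnU // HF // scaleNr addNr.
Qed.

End Toggle.

Section Cup.
Variable n : nat.
Implicit Types S : {set 'I_n.+1}.

(* The least element of S which is at least q. *)
Definition cup S (q : nat) : option 'I_n.+1 :=
  [pick c | [&& c \in S, (q <= c)%N & [forall s, (s \in S) && (q <= s)%N ==> (c <= s)%N]]].

Variant cup_spec S (q : nat) : option 'I_n.+1 -> Type :=
| CupSome c of c \in S & (q <= c)%N & (forall s, s \in S -> (q <= s)%N -> (c <= s)%N) :
    cup_spec S q (Some c)
| CupNone of (forall s, s \in S -> (s < q)%N) : cup_spec S q None.

Lemma cupP S q : cup_spec S q (cup S q).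
Proof.
rewrite /cup; case: pickP => [c /and3P[cS qc /forallP H]|H].
  by constructor=> // s sS qs; have /implyP := H s; rewrite sS; apply.
constructor=> s sS; rewrite ltnNge; apply/negP => qs.
have Ps : (s \in S) && (q <= s)%N by rewrite sS.
case: (arg_minnP (P := fun s : 'I_n.+1 => (s \in S) && (q <= s)%N) (fun s : 'I_n.+1 => s : nat) Ps).
move=> c /andP[cS qc] cmin; have /negP[] := negbT (H c).
by rewrite cS qc; apply/forallP => r; apply/implyP => /cmin.
Qed.

Lemma cup_some S q c : c \in S -> (q <= c)%N ->
  (forall s, s \in S -> (q <= s)%N -> (c <= s)%N) -> cup S q = Some c.
Proof.
move=> cS qc H; case: cupP => [d dS qd H'|H']; last by have := H' c cS; lia.
by congr Some; apply/val_inj/eqP; rewrite eqn_leq H // H'.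
Qed.

Lemma cup_none S q : (forall s, s \in S -> (s < q)%N) -> cup S q = None.
Proof. by move=> H; case: cupP => // c cS qc _; have := H c cS; lia. Qed.

(** The search from q does not see t if t lies before q or behind another element of S that is at
    least q. *)
Lemma cup_add S (t : 'I_n.+1) q :
  (t < q)%N \/ (exists2 s, s \in S & (q <= s < t)%N) -> cup (t |: S) q = cup S q.
Proof.
move=> tq; case: (cupP S q) => [c cS qc H|H].
  apply: cup_some => [||s]; rewrite ?inE ?cS ?orbT // => /orP[/eqP -> qt|]; last exact: H.
  by case: tq => [|[r rS /andP[qr rt]]]; [lia | have := H r rS qr; lia].
apply: cup_none => s; rewrite !inE => /orP[/eqP ->|]; last exact: H.
by case: tq => // -[r rS /andP[qr _]]; have := H r rS; lia.
Qed.

(** With [lev_fun], the map from the cone to the prism attached to S. The apex is the vertex 0, and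
    the vertex j of the base is j + 1: it goes to the next element of S after j at the end 0, or, if
    there is none, to j itself at the end 1. The apex goes to the least element of S at the end
    0. *)
Definition up_fun S (q : 'I_n.+2) : 'I_n.+1 :=
  if cup S q is Some c then c else inord q.-1.

Definition lev_fun S (q : 'I_n.+2) : 'I_2 := if cup S q is Some _ then ord0 else ord_max.

Fact up_mono S : {homo up_fun S : p q / (p <= q)%N}.
Proof.
move=> p q pq; rewrite /up_fun; have qn := ltn_ord q.
case: (cupP S p) => [c cS pc Hc|Hp]; case: (cupP S q) => [d dS qd Hd|Hq].
- by apply: Hc => //; lia.
- by rewrite inordK; have := Hq c cS; lia.
- by have := Hp d dS; lia.
- by rewrite !inordK; lia.
Qed.

Fact lev_mono S : {homo lev_fun S : p q / (p <= q)%N}.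
Proof.
move=> p q pq; rewrite /lev_fun.
case: (cupP S p) => [c cS pc Hc|Hp]; case: (cupP S q) => [d dS qd Hd|Hq] //.
by have := Hp d dS; lia.
Qed.

Definition up S : delta n.+1 n := Delta (@up_mono S).
Definition lev S : delta n.+1 1 := Delta (@lev_mono S).

End Cup.

Section ConeMap.
Variables (m n : nat) (f : delta m n).

Definition conemap_fun (q : 'I_m.+2) : 'I_n.+2 :=
  if unlift ord0 q is Some j then lift ord0 (f j) else ord0.

Fact conemap_mono : {homo conemap_fun : p q / (p <= q)%N}.
Proof.
move=> p q; rewrite /conemap_fun; case: unliftP => [i ->|->]; case: unliftP => [j ->|->] //.
rewrite !lift0 !ltnS; exact: dmap_mono.
Qed.

Definition conemap : delta m.+1 n.+1 := Delta conemap_mono.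

Lemma conemap0 : conemap ord0 = ord0.
Proof. by rewrite /= /conemap_fun unlift_none. Qed.

Lemma conemapS j : conemap (lift ord0 j) = lift ord0 (f j).
Proof. by rewrite /= /conemap_fun liftK. Qed.

Lemma conemap_face : delta_comp conemap (coface ord0) = delta_comp (coface ord0) f.
Proof. by apply: delta_eq => j; apply: conemapS. Qed.

End ConeMap.

Section ConeFace.
Variables (R : comPzRingType) (V : lmodType R) (n : nat).

(** On the base the search starts after 0, so toggling 0 in S changes nothing. All terms cancel
    except S = {0}, whose partner is the excluded empty set. *)
Lemma cone_face0 (G : delta n n -> delta n 1 -> V) :
  \sum_(S : {set 'I_n.+1} | S != set0) csgn R S *:
     G (delta_comp (up S) (coface ord0)) (delta_comp (lev S) (coface ord0)) =
  G (delta_id n) (delta_const n ord_max).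
Proof.
pose T S := G (delta_comp (up S) (coface ord0)) (delta_comp (lev S) (coface ord0)).
have cup0 (S : {set 'I_n.+1}) (j : 'I_n.+1) : cup (ord0 |: S) j.+1 = cup S j.+1.
  by apply: cup_add; left.
have TE (S : {set 'I_n.+1}) : T (ord0 |: S) = T S.
  by rewrite /T; congr G; apply: delta_eq => j; rewrite /= /up_fun /lev_fun lift0 cup0.
rewrite (bigID (fun S : {set 'I_n.+1} => S \subset [set ord0])) /=.
rewrite (big_pred1 [set ord0]) => [|S /=]; last first.
  rewrite subset1 andb_orr andNb orbF andb_idl // => /eqP ->.
  by apply/set0Pn; exists ord0; rewrite inE.
rewrite /csgn cards1 sqrrN expr1n scale1r.
have -> : G (delta_comp (up [set ord0]) (coface ord0)) (delta_comp (lev [set ord0]) (coface ord0)) =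
    G (delta_id n) (delta_const n ord_max).
  have E (j : 'I_n.+1) : cup [set ord0] (lift ord0 j) = None :> option 'I_n.+1.
    by apply: cup_none => s; rewrite inE => /eqP ->.
  congr G; apply: delta_eq => j; rewrite /= /up_fun /lev_fun E // lift0.
  by apply: val_inj; rewrite /= inordK.
have N (S : {set 'I_n.+1}) :
    (S != set0) && ~~ (S \subset [set ord0]) = ~~ (S \subset [set ord0]).
  by case: (eqVneq S set0) => [->|//]; rewrite sub0set.
rewrite [X in _ + X](sum_toggle (t := ord0) (F := T)) ?addr0 // => S _.
by rewrite !N subUset subxx.
Qed.

End ConeFace.

Section ConeNatural.
Variables (R : comPzRingType) (V : lmodType R) (m n : nat) (f : delta m n).
Variable G : delta m.+1 n -> delta m.+1 1 -> V.
Hypothesis G0 : forall s, G s (delta_const m.+1 ord0) = 0.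

Let Q q := conemap f q.
Let T (S : {set 'I_n.+1}) := G (delta_comp (up S) (conemap f)) (delta_comp (lev S) (conemap f)).
Let T' (S : {set 'I_m.+1}) := G (delta_comp f (up S)) (lev S).
Let im := [set f a | a : 'I_m.+1].

(** Let s be an element of S outside the image of [f]. If the image has elements above s, the least
    of them can be toggled unseen, as no vertex of the image lies between s and it. Otherwise all
    vertices lie below s, the level is constantly 0 and [G] vanishes. *)
Lemma cone_sum_image :
  \sum_(S : {set 'I_n.+1} | S != set0) csgn R S *: T S =
  \sum_(S : {set 'I_n.+1} | (S != set0) && (S \subset im)) csgn R S *: T S.
Proof.
rewrite (bigID (fun S : {set 'I_n.+1} => S \subset im)) /= [X in _ + X](_ : _ = 0) ?addr0 //.
pose pk (S : {set 'I_n.+1}) := [pick s in S :\: im].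
rewrite (partition_big pk predT) //= big1 // => o _.
case: o => [s|]; last first.
  rewrite big_pred0 // => S; apply/negP => /andP[/andP[_ /subsetPn[s sS sim]]].
  by rewrite /pk; case: pickP => // /(_ s); rewrite !inE sS sim.
have [/existsP[t0 t0P]|/existsPn NE] := boolP [exists t : 'I_n.+1, (t \in im) && (s < t)%N].
  case: (arg_minnP (P := fun t : 'I_n.+1 => (t \in im) && (s < t)%N) (fun t : 'I_n.+1 => t : nat) t0P) => t /andP[tim st] tmin.
  apply: (sum_toggle (t := t)) => S tS.
    have -> : pk (t |: S) = pk S.
      rewrite /pk (_ : (t |: S) :\: im = S :\: im) //; apply/setP => x; rewrite !inE.
      by have [->|] := eqVneq x t; rewrite ?tim.
    have [E|] := eqVneq (pk S) (Some s); rewrite ?andbF // !andbT.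
    have := E; rewrite /pk; case: pickP => // x; rewrite inE => /andP[xim xS] [xs].
    have -> : S != set0 by apply/set0Pn; exists x.
    have -> : t |: S != set0 by apply/set0Pn; exists x; rewrite inE xS orbT.
    have -> : S \subset im = false by apply/negbTE/subsetPn; exists x.
    by have -> : (t |: S \subset im) = false by apply/negbTE/subsetPn; exists x; rewrite ?inE ?xS ?orbT.
  move=> /andP[_ /eqP E]; have [sS sim] : s \in S /\ s \notin im.
    by have := E; rewrite /pk; case: pickP => // x; rewrite inE => /andP[xim xS] [<-].
  have C q : cup (t |: S) (conemap f q) = cup S (conemap f q).
    apply: cup_add; have [i ->|->] := unliftP ord0 q; last first.
      by right; exists s; rewrite ?conemap0.
    rewrite conemapS lift0; have fi : f i \in im by apply: imset_f.
    have [fis|sfi] := ltnP (f i) s; first by right; exists s; rewrite // fis.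
    have sfi' : (s < f i)%N.
      rewrite ltn_neqAle sfi andbT; apply: contraNneq sim => /val_inj ->; exact: fi.
    by left; rewrite ltnS; apply: tmin; rewrite fi.
  by rewrite /T; congr G; apply: delta_eq => q; rewrite /= /up_fun /lev_fun C.
rewrite big1 // => S /andP[_ /eqP E]; have [sS sim] : s \in S /\ s \notin im.
  by have := E; rewrite /pk; case: pickP => // x; rewrite inE => /andP[xim xS] [<-].
rewrite /T (_ : delta_comp (lev S) _ = delta_const m.+1 ord0) ?G0 ?scaler0 //.
apply: delta_eq => q; rewrite [LHS](_ : _ = lev_fun S (conemap f q)) // /lev_fun; case: cupP => // H.
have := H s sS; have [i ->|->] := unliftP ord0 q; last by rewrite conemap0.
rewrite conemapS lift0 ltnS leq_eqVlt => /orP[/eqP/val_inj si|sfi].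
  by case/negP: sim; rewrite si imset_f.
by have := NE (f i); rewrite sfi imset_f.
Qed.

Definition fib_min (a : 'I_m.+1) := [forall c : 'I_m.+1, (c < a)%N ==> (f c != f a)].

Lemma fib_minP (a : 'I_m.+1) : reflect (forall c : 'I_m.+1, (c < a)%N -> (f c < f a)%N) (fib_min a).
Proof.
apply: (iffP forallP) => H c; last by apply/implyP => /H fc; apply: contraTneq fc => ->; rewrite ltnn.
by move=> ca; rewrite ltn_neqAle (implyP (H c)) //= dmap_mono // ltnW.
Qed.

(** If S has elements that are not the least of their fibre, let b be the greatest of them. Its
    predecessor t lies in the same fibre; toggling t changes neither b nor the composite of [up S]
    with [f]. *)
Lemma cone_sum_fib :
  \sum_(S : {set 'I_m.+1} | S != set0) csgn R S *: T' S =
  \sum_(S : {set 'I_m.+1} | (S != set0) && [forall s in S, fib_min s]) csgn R S *: T' S.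
Proof.
rewrite (bigID (fun S : {set 'I_m.+1} => [forall s in S, fib_min s])) /= [X in _ + X](_ : _ = 0) ?addr0 //.
pose bd (S : {set 'I_m.+1}) b := [&& b \in S, ~~ fib_min b & [forall c in S, fib_min c || (c <= b)%N]].
pose pk (S : {set 'I_m.+1}) := [pick b | bd S b].
rewrite (partition_big pk predT) //= big1 // => o _.
case: o => [b|]; last first.
  rewrite big_pred0 // => S; apply/negP => /andP[/andP[_ ]].
  rewrite negb_forall => /existsP[s]; rewrite negb_imply => sP.
  case: (arg_maxnP (P := fun s : 'I_m.+1 => (s \in S) && ~~ fib_min s) (fun s : 'I_m.+1 => s : nat) sP) => b /andP[bS bm] bmax.
  rewrite /pk; case: pickP => // /(_ b); rewrite /bd bS bm /= => /negP[].
  apply/forall_inP => c cS; case: (boolP (fib_min c)) => //= cm; apply: bmax.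
  by rewrite cS.
have pkE S : (pk S == Some b) = bd S b.
  rewrite /pk; case: pickP => [b' b'P|->] //; apply/eqP/idP => [[<-]//|bP].
  move: b'P bP => /and3P[b'S b'm /forall_inP b'max] /and3P[bS bm /forall_inP bmax].
  congr Some; apply/val_inj/eqP; rewrite eqn_leq.
  by have := bmax _ b'S; have := b'max _ bS; rewrite (negbTE bm) (negbTE b'm) /= => -> ->.
have [bm|bm] := boolP (fib_min b).
  by rewrite big_pred0 // => S; rewrite pkE /bd bm andbF andbF.
have [t tb ft] : exists2 t : 'I_m.+1, b = t.+1 :> nat & f t = f b.
  move: bm; rewrite negb_forall => /existsP[c]; rewrite negb_imply negbK => /andP[cb /eqP fcb].
  have tm : (b.-1 < m.+1)%N by have := ltn_ord b; lia.
  exists (Ordinal tm); first by rewrite /= prednK //; lia.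
  apply/val_inj/eqP; rewrite eqn_leq -{2}fcb !dmap_mono //=; lia.
apply: (sum_toggle (t := t)) => S tS.
  rewrite !pkE; have E : bd (t |: S) b = bd S b.
    rewrite /bd !inE (_ : (b == t) = false) /=; last first.
      by apply/negbTE; apply: contraTneq isT => bt; move: tb; rewrite bt; lia.
    congr [&& _, _ & _]; apply/forall_inP/forall_inP => H c.
      by move=> cS; apply: H; rewrite inE cS orbT.
    by rewrite !inE => /orP[/eqP ->|/H //]; rewrite tb leqnSn orbT.
  rewrite E; case: (boolP (bd S b)) => [/and3P[bS _ _]|]; rewrite ?andbF // !andbT.
  have -> : S != set0 by apply/set0Pn; exists b.
  have -> : t |: S != set0 by apply/set0Pn; exists b; rewrite inE bS orbT.
  have -> : [forall s in S, fib_min s] = false by apply/negbTE; apply/forall_inPn; exists b.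
  by have -> : [forall s in t |: S, fib_min s] = false by apply/negbTE; apply/forall_inPn; exists b; rewrite ?inE ?bS ?orbT.
move=> /andP[_]; rewrite pkE => /and3P[bS _ _].
have C q : (exists2 c, cup S q = Some c & exists2 d, cup (t |: S) q = Some d & f c = f d) \/
    cup (t |: S) q = cup S q.
  have [qt|tq] := leqP q t; last by right; apply: cup_add; left.
  case: (cupP S q) => [c cS qc H|/(_ b bS)]; last by lia.
  have [ct|tc] := ltnP c t; first by right; rewrite cup_add; [exact: cup_some|right; exists c; rewrite ?qc].
  have cb : c = b by apply/val_inj/eqP; rewrite eqn_leq H //=; [|lia]; have : c != t by [apply: contraNneq tS => <-]; rewrite -val_eqE /=; lia.
  left; exists c => //; exists t; last by rewrite cb ft.
  apply: cup_some => [||s]; rewrite ?inE ?eqxx // => /orP[/eqP ->//|sS] qs.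
  by have := H s sS qs; lia.
rewrite /T'; congr G; apply: delta_eq => q; rewrite /= /up_fun /lev_fun.
  by case: (C q) => [[c -> [d -> ->]]|->].
by case: (C q) => [[c -> [d ->]]|->].
Qed.

(** On least elements of fibres [f] is injective, and a vertex is at most s exactly when its image
    is at most f s; so the search in the image set is the image of the search in S. *)
Lemma cone_sum_match (S : {set 'I_m.+1}) : S != set0 -> [forall s in S, fib_min s] ->
  csgn R (f @: S) *: T (f @: S) = csgn R S *: T' S.
Proof.
move=> /set0Pn[s0 s0S] /forall_inP Sm.
have lt_f (q : 'I_m.+1) s : s \in S -> (f q < f s)%N = (q < s)%N.
  move=> sS; apply/idP/idP => [|qs]; last exact: (fib_minP _ (Sm s sS)).
  by rewrite ltnNge; apply: contraNltn => sq; apply: dmap_mono; lia.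
have le_q (q : 'I_m.+2) s : s \in S -> (conemap f q <= f s)%N = (q <= s)%N.
  move=> sS; have [i ->|->] := unliftP ord0 q; last by rewrite conemap0.
  by rewrite conemapS !lift0 lt_f.
have C (q : 'I_m.+2) : cup (f @: S) (conemap f q) = omap f (cup S q).
  case: (cupP S q) => [c cS qc H|H] /=.
    apply: cup_some => [||_ /imsetP[s sS ->]]; first exact: imset_f.
      by rewrite le_q.
    by rewrite le_q // => qs; apply: dmap_mono; apply: H.
  by apply: cup_none => _ /imsetP[s sS ->]; rewrite ltnNge le_q // -ltnNge H.
congr (_ *: _).
  rewrite /csgn card_in_imset // => a b aS bS fab.
  have [ab|ba|/val_inj //] := ltngtP a b.
    by have := fib_minP _ (Sm b bS) a ab; rewrite fab ltnn.
  by have := fib_minP _ (Sm a aS) b ba; rewrite fab ltnn.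
rewrite /T /T'; congr G; apply: delta_eq => q; last first.
  rewrite [LHS](_ : _ = lev_fun (f @: S) (conemap f q)) // [RHS](_ : _ = lev_fun S q) //.
  by rewrite /lev_fun C; case: (cup S q).
rewrite [LHS](_ : _ = up_fun (f @: S) (conemap f q)) // [RHS](_ : _ = f (up_fun S q)) //.
have [i qi|q0] := unliftP ord0 q; last first.
  by rewrite /up_fun C q0; case: cupP => // /(_ s0 s0S).
rewrite /up_fun C (_ : conemap f q = lift ord0 (f i)); last by rewrite qi conemapS.
case: (cup S q) => // ; rewrite qi !lift0 /=; apply: val_inj; rewrite /= inordK //.
by congr (nat_of_ord (f _)); apply: val_inj; rewrite /= inordK.
Qed.

Lemma cone_natural :
  \sum_(S : {set 'I_n.+1} | S != set0) csgn R S *: T S =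
  \sum_(S : {set 'I_m.+1} | S != set0) csgn R S *: T' S.
Proof.
rewrite cone_sum_image cone_sum_fib.
pose g (S : {set 'I_n.+1}) := [set a : 'I_m.+1 | (f a \in S) && fib_min a].
rewrite (reindex_onto (fun S : {set 'I_m.+1} => f @: S) g) /=; last first.
  move=> S /andP[_ Sim]; apply/setP => x; apply/imsetP/idP => [[a]|xS].
    by rewrite inE => /andP[aS _] ->.
  have /imsetP[a _ xa] := subsetP Sim x xS.
  have aP : f a == x by rewrite xa.
  case: (arg_minnP (P := fun a : 'I_m.+1 => f a == x) (fun a : 'I_m.+1 => a : nat) aP) => b /eqP fb bmin.
  exists b; rewrite ?inE ?fb // xS /=; apply/forallP => c; apply/implyP => cb.
  by rewrite fb; apply: contraTneq cb => /eqP /bmin; rewrite -leqNgt.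
have PE (S : {set 'I_m.+1}) : (f @: S != set0) && (f @: S \subset im) && (g (f @: S) == S) =
   (S != set0) && [forall s in S, fib_min s].
  rewrite imset_eq0 (_ : (f @: S \subset im) = true) ?andbT; last first.
    by apply/subsetP => _ /imsetP[a _ ->]; apply: imset_f.
  congr (_ && _); apply/eqP/forall_inP => [<- s|H].
    by rewrite inE => /andP[].
  apply/setP => a; rewrite inE; apply/andP/idP => [[/imsetP[b bS fab] am]|aS]; last first.
    by rewrite imset_f // H.
  have [ab|ba|/val_inj -> //] := ltngtP a b.
    by have := fib_minP _ (H b bS) a ab; rewrite fab ltnn.
  by have := fib_minP _ am b ba; rewrite fab ltnn.
rewrite (eq_bigl _ _ PE); apply: eq_bigr => S /andP[S0 Sm]; exact: cone_sum_match.
Qed.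

End ConeNatural.

(** * Homotopy and cohomology *)

Section Cohomology.
Variables (R : comPzRingType) (O : uaoperad R).

Lemma cocycle_form (X : sset) k (v : Form_alg O X k) :
  cocycle v <-> forall n (x : X n), cocycle (v n x).
Proof.
split=> [vc n x l e|vc l e].
  by have := congr1 (fun w : Defs.form O X l => w n x) (vc l e).
by apply: form_eq => n x; apply: vc.
Qed.

Lemma form_oppE (X : sset) k (v : Defs.form O X k) n (x : X n) : (- v) n x = - v n x.
Proof. by rewrite [LHS](_ : _ = (-1) *: v n x) // scaleN1r. Qed.

Section Degree.
Variables (k : int) (X : sset).

Definition zmap (v : Form_alg O X k) (vc : forall n (x : X n), cocycle (v n x)) :
  smap X (Zset O k).
Proof.
exists (fun n x => exist _ (v n x) (vc n x)) => m n f x.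
by apply: Zset_eq; apply: fval_nat.
Defined.

Definition zform (f : smap X (Zset O k)) : Form_alg O X k.
Proof. by exists (fun n x => sval (f n x)) => m n g x; rewrite sm_nat. Defined.

Lemma zform_cocycle f : cocycle (zform f).
Proof. by apply/cocycle_form => n x; apply: (svalP (f n x)). Qed.

Section Product.
Variable mu : O 2%N 0.
Hypothesis mu1 : ua_aug O 2%N 0 mu = com_elt 0 1.

(** The homotopy is f + d(x_1 u), with x_1 the last coordinate of the 1-simplex, which is 0 at one
    end and the unit at the other. *)
Lemma cohomologous_homotopic (f g : smap X (Zset O k)) j (e : k = j + 1) (u : Form_alg O X j) :
  (forall n (x : X n), sval (g n x) = sval (f n x) + dgd (Omega O n) e (u n x)) ->
  homotopic f g.
Proof.
move=> E.
pose Hv n (p : sprod X (simplex 1) n) : Omega O n k := sval (f n p.1) +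
  dgd (Omega O n) e (umul mu (Omega_map O p.2 0 (Omega_x ord_max)) (u n p.1)).
have Hc n p : cocycle (@Hv n p).
  by move=> l el; rewrite (linear_funD (dgd_linear _)) (svalP (f n p.1)) dgd_dgd addr0.
pose Hm n p : Zset O k n := exist _ (Hv n p) (Hc n p).
have Hn m n (q : delta m n) (p : sprod X (simplex 1) n) :
    Hm m (sact (sprod X (simplex 1)) q p) = sact (Zset O k) q (Hm n p).
  apply: Zset_eq; rewrite [RHS](_ : _ = Omega_map O q k (Hv n p)) //.
  case: p => x s; rewrite /Hv ah_add (ah_chain _).2 hom_umul -Omega_map_comp -fval_nat.
  congr (_ + _); exact: (congr1 sval (sm_nat f q x)).
exists (SMap Hn) => n x; split; apply: Zset_eq.
  rewrite [LHS](_ : _ = Hv n (x, delta_const n ord0)) // /Hv Omega_const_x.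
  by rewrite umul0 (linear_fun0 (dgd_linear _)) addr0.
rewrite [LHS](_ : _ = Hv n (x, delta_const n ord_max)) // /Hv Omega_const_x eqxx.
by rewrite umul_unit // E.
Qed.

End Product.

Section Contraction.
Variable c : forall n k, Omega O n k -> Omega O n (k - 1).
Arguments c {n k}.
Hypothesis c_d : forall n k (v : Omega O n k) (e : k = k - 1 + 1), cocycle v ->
  dgd (Omega O n) e (c v) = v - Omega_map O (delta_const n ord0) k v.
Hypothesis c_nat : forall m n (f : delta m n), f ord0 = ord0 ->
  forall k (v : Omega O n k), c (Omega_map O f k v) = Omega_map O f (k - 1) (c v).

Lemma homotopic_cohomologous (f g : smap X (Zset O k)) (e : k = k - 1 + 1) :
  homotopic f g -> exists u : Form_alg O X (k - 1),
    forall n (x : X n), sval (g n x) - sval (f n x) = dgd (Omega O n) e (u n x).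
Proof.
case=> H Hfg.
(* Subtracting the value at the end 0 makes [G] vanish there, as [cone_natural] requires, and makes
   it g - f at the end 1. *)
pose G n (x : X n) (s : delta n 1) : Omega O n k :=
  sval (H n (x, s)) - sval (H n (x, delta_const n ord0)).
have Gnat m n (q : delta m n) x s : Omega_map O q k (G n x s) = G m (sact X q x) (delta_comp s q).
  rewrite /G ah_sub.
  have E s' : Omega_map O q k (sval (H n (x, s'))) = sval (H m (sact X q x, delta_comp s' q)).
    exact/esym/(congr1 sval (sm_nat H q (x, s'))).
  rewrite !E; congr (_ - sval (H m (_, _))); exact: delta_eq.
have G0 n x : G n x (delta_const n ord0) = 0 by rewrite /G subrr.
have Gc n x s : cocycle (G n x s).
  move=> l el; rewrite (linear_funD (dgd_linear _)) (linear_funN (dgd_linear _)).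
  by rewrite !(svalP (H n _)) subr0.
pose vt n (x : X n) : Omega O n.+1 k :=
  \sum_(S : {set 'I_n.+1} | S != set0) csgn R S *: G n.+1 (sact X (up S) x) (lev S).
have vtE m n (q : delta m n.+1) x : Omega_map O q k (vt n x) =
    \sum_(S : {set 'I_n.+1} | S != set0) csgn R S *:
       G m (sact X (delta_comp (up S) q) x) (delta_comp (lev S) q).
  rewrite (linear_fun_sum ((ah_chain (Omega_map O q)).1 k)); apply: eq_bigr => S _.
  by rewrite ah_scale Gnat sact_comp.
have vtc n x : cocycle (vt n x).
  move=> l el; rewrite (linear_fun_sum (dgd_linear _)) big1 // => S _.
  by rewrite (linear_funZ (dgd_linear _)) Gc scaler0.
have vt_nat m n (q : delta m n) x :
    Omega_map O (conemap q) k (vt n x) = vt m (sact X q x).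
  rewrite vtE (cone_natural q (G := fun a s => G m.+1 (sact X a x) s)) //.
  by apply: eq_bigr => S _; rewrite sact_comp.
have vt_face n x : Omega_map O (coface ord0) k (vt n x) = sval (g n x) - sval (f n x).
  rewrite vtE (cone_face0 (fun a s => G n (sact X a x) s)) sact_id /G.
  by have [-> ->] := Hfg n x.
have vt_vertex n x : Omega_map O (delta_const n.+1 ord0) k (vt n x) = 0.
  rewrite vtE big1 // => S /set0Pn[s sS].
  rewrite (_ : delta_comp (lev S) _ = delta_const n.+1 ord0) ?G0 ?scaler0 //.
  apply: delta_eq => j; rewrite /= /lev_fun; case: cupP => // Hs.
  by have := Hs s sS.
(* [conemap q] fixes the apex, so the contraction to the vertex 0 is natural for it; the value of
   [vt] at the apex is 0, so the contraction gives a primitive of [vt], and restriction to the base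
   a primitive of g - f. *)
pose u n (x : X n) := Omega_map O (coface ord0) (k - 1) (c (vt n x)).
have u_nat m n (q : delta m n) x : u m (sact X q x) = Omega_map O q (k - 1) (u n x).
  by rewrite /u -vt_nat c_nat ?conemap0 // -!Omega_map_comp conemap_face.
exists (Form u_nat) => n x.
rewrite [RHS](_ : _ = dgd (Omega O n) e (u n x)) // /u.
by rewrite -(ah_chain _).2 c_d // ah_sub vt_face vt_vertex ah_zero subr0.
Qed.

End Contraction.
End Degree.

(** Injectivity of [w] on homotopy classes of maps to Z^k, applied to a cocycle and 0, gives
    injectivity in cohomology; surjectivity on homotopy classes gives surjectivity. *)
Lemma form_map_quasi_iso (X Y : sset) (w : smap X Y) :
  cofibrant (O : UAOp R) -> surjective_augmentation O ->
  weak_equivalence w -> quasi_iso (Form_map O w).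
Proof.
move=> Ocof Osur ww k.
have [mu mu1] := Osur 2%N 0 (com_elt 0 1).
have [c [c_d c_nat]] := Omega_contraction Ocof.
have e : k = k - 1 + 1 by rewrite subrK.
have [ww1 ww2] := ww _ (kan_Zset (O := O) (k := k)).
split=> [v /cocycle_form vc [j [ej [y yE]]]|y /cocycle_form yc].
  have zc n (x : Y n) : cocycle ((0 : Form_alg O Y k) n x).
    by move=> l el; apply: (linear_fun0 (dgd_linear _)).
  have vE n (x : X n) : v n (w n x) = dgd (Omega O n) ej (y n x).
    by have := congr1 (fun a : Defs.form O X k => a n x) yE.
  have h0 : homotopic (smap_comp (zmap zc) w) (smap_comp (zmap vc) w).
    by apply: (cohomologous_homotopic mu1 (e := ej) (u := y)) => n x; rewrite /= vE add0r.
  have [u uE] := homotopic_cohomologous c_d c_nat e (ww1 _ _ h0).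
  exists (k - 1), e, u; apply: form_eq => n x.
  by have := uE n x; rewrite /= subr0.
have [f fy] := ww2 (zmap yc).
have [u uE] := homotopic_cohomologous c_d c_nat e fy.
exists (zform f); first exact: zform_cocycle.
exists (k - 1), e, (- u); apply: form_eq => n x.
rewrite [LHS](_ : _ = sval (f n (w n x)) + (- y : Defs.form O X k) n x) // form_oppE.
rewrite [RHS](_ : _ = dgd (Omega O n) e ((- u : Defs.form O X (k - 1)) n x)) // form_oppE.
by rewrite (linear_funN (dgd_linear _)) -uE opprB.
Qed.

End Cohomology.

(** * The adjunction and the Quillen condition *)

Section Adjunction.
Variables (R : comPzRingType) (O : uaoperad R).

Definition form_ev_hom (X : sset) n (x : X n) : opalg_hom (Form_alg O X) (Omega O n).
Proof. by exists (form_ev x). Defined.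

Definition adj_map (X : sset) (A : opalg O) (h : opalg_hom A (Form_alg O X)) :
  smap X (M_sset A).
Proof.
exists (fun n x => opalg_comp (form_ev_hom x) h) => m n f x.
by apply: opalg_hom_eq => k v; apply: fval_nat.
Defined.

Definition adj_inv (X : sset) (A : opalg O) (p : smap X (M_sset A)) :
  opalg_hom A (Form_alg O X).
Proof.
unshelve refine (@OpalgHom R O A (Form_alg O X)
  (fun k v => @Form R O X k (fun n x => p n x k v) _) _ _).
- by move=> m n f x; rewrite sm_nat.
- split=> [k c v w|k l e v]; apply: form_eq => n x.
    by rewrite /= (ah_chain (p n x)).1.
  by rewrite /= (ah_chain (p n x)).2.
- by move=> n l a x m e; apply: form_eq => q y; apply: ah_act.
Defined.

Definition Omega_M_adjunction : adjunction (Omega_functor O) (M_functor O).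
Proof.
refine (@Adjunction SSet (op_category (OAlg O)) (Omega_functor O) (M_functor O)
  (fun X A h => adj_map h) _ _).
- move=> X A; exists (@adj_inv X A) => h.
    by apply: opalg_hom_eq => k v; apply: form_eq.
  by apply: smap_eq => n x; apply: opalg_hom_eq.
- by move=> X X' A A' f g h; apply: smap_eq => n x; apply: opalg_hom_eq.
Defined.

End Adjunction.

Theorem proposition3p10 (R : comPzRingType) (O : uaoperad R)
  (O_cofibrant : cofibrant O)
  (O_augmentation : surjective_augmentation O)
  (O_degrees : nonpositively_graded O) :
  quillen_adjunction SSet_model (op_model_classes (OAlg_model O))
    (Omega_functor O) (M_functor O).
Proof.
(* Cofibrations in the opposite category are the surjections of algebras; lifting 1 along the
   augmentation in arity 2 supplies the product for the averaging. *)
have sur (X Y : sset) (f : smap X Y) : (forall n, injective (f n)) ->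
    surjective_map (Form_map O f).
  have [mu mu1] := O_augmentation 2%N 0 (com_elt 0 1).
  by move=> f_inj k om; apply: (form_extension mu1 f_inj om).
split=> [|X Y f]; first by split; apply: Omega_M_adjunction.
split=> [f_inj|f_inj fw]; first exact: sur.
split; last exact: form_map_quasi_iso.
exact: sur.
Qed.
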